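(* Let $\lambda>0$, $\mu>0$, let $G=\{G(t),t\ge 0\}$ be the birth and death random tree process with parameters $\lambda,\mu$ described in the context, let $\tau$ be the generic lifetime of a vertex and $p(t)$ its distribution function. (A) The Markov chain $G$ is ergodic if, and only if, \[ \rho:=\frac{\lambda}{\mu}\le \frac1e. \] (B) When the system is ergodic, the mean lifetime $m:=\mathsf{E}\,\tau$ is given by \[ m=\frac{r}{\lambda}, \] where $r\le 1$ denotes the smallest root of the equation $re^{-r}=\rho$ and represents the mean number of descendants of an arbitrary vertex at steady state. (C) When $\rho>\frac1e$, the system is transient. In this case, \[ \lim_{t\to\infty}p(t)=:\ell<1. \] As a rule, $x$ being the positive root of $xe^x=\rho^{-1}$, we have for any $\rho$ \[ x\le \ell\le \min\Bigl(1,\frac1\rho\Bigr)\quad\text{and}\quad \lim_{\rho\to\infty}\rho\,\ell=1. \]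
   Context: The process $G=\{G(t),t\ge0\}$ is a continuous-time Markov chain whose state space is the set of finite directed trees rooted at a fixed vertex $v_0$. At time $0$, $G(0)$ consists of the single vertex $v_0$. Transitions: (adjunction) at each vertex $v$ of the current tree, a new edge with origin $v$, producing a new leaf, is appended at the epochs of a Poisson process of rate $\lambda>0$; (deletion) each vertex other than the root, as long as it is a leaf (has no descendant), is deleted at rate $\mu>0$. The root is never deleted. ''Ergodic'' means positive recurrent. The lifetime $\tau_v$ of a non-root vertex $v$ is the length of time between its birth and its deletion ($\tau_v=\infty$ if $v$ is never deleted). All non-root vertices have the same (possibly defective) lifetime distribution function $p(t)$, with $p(0)=0$, and $\ell=\lim_{t\to\infty}p(t)$; the value of $\ell$ depends on $(\lambda,\mu)$ only through $\rho=\lambda/\mu$. In part (B), the number of descendants of a vertex $v$ refers to the number $X_v(t)$ of its direct descendants (those located at distance $1$ from $v$) when $v$ has age $t$. It is defined for all $t\ge0$ by the convention that, instead of deleting $v$ (at rate $\mu$ when it has no descendant), a ''$\mu$-event'' occurs, which does not stop the production of descendants. With this convention $\tau_v$ is the epoch of the first $\mu$-event; the same convention is applied to the root $v_0$, and $\tau=\tau_{v_0}$ is distributed according to $p$.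
   Formalization: The lower bound x ≤ ℓ is stated only for ρ ≥ 1/e rather than for any ρ: when ρ < 1/e, the positive root of xe^x = 1/ρ exceeds 1, while ℓ ≤ 1, so the bound fails there; the upper bound and the limit of ρℓ are kept as in the English. *)

(* Defs.v *)
From HB Require Import structures.
From mathcomp Require Import all_boot all_order all_algebra.
From mathcomp Require Import finmap.
From mathcomp Require Import all_classical all_reals all_analysis.

Set Implicit Arguments.
Unset Strict Implicit.
Unset Printing Implicit Defensive.

Import Order.TTheory GRing.Theory Num.Theory.
Import numFieldNormedType.Exports.

Local Open Scope ring_scope.
Local Open Scope fset_scope.
Local Open Scope classical_set_scope.

(* A vertex is the list of labels met on the path from it up to the root: the
   root v_0 is [::] and the children of v are the i :: v.  A finite tree rooted
   at v_0 is a finite set of vertices that contains v_0 and the parent of each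
   of its elements (behead [::] = [::]).  Labels of siblings need not be
   contiguous, so that a vertex keeps its name when a sibling is deleted. *)
Definition vertex : Type := seq nat.

Definition is_tree (T : {fset seq nat}) : bool :=
  ([::] \in T) && all (fun v => behead v \in T) (enum_fset T).

Record tree : Type := Tree { vertices :> {fset seq nat}; _ : is_tree vertices }.

HB.instance Definition _ := [isSub for vertices].
HB.instance Definition _ := [Countable of tree by <:].

Lemma is_tree_root : is_tree [fset [::]].
Proof.
rewrite /is_tree inE eqxx /=; apply/allP => v.
by rewrite !inE => /eqP ->.
Qed.

Definition root_tree : tree := Tree is_tree_root.

Definition is_child (v u : vertex) : bool :=
  if u is _ :: u' then u' == v else false.

Definition n_children (T : tree) (v : vertex) : nat :=
  count (is_child v) (enum_fset T).

Definition is_leaf (T : tree) (v : vertex) : bool :=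
  (v \in vertices T) && (n_children T v == 0%N).

(* A child born at v takes the least label not in use among the children of v;
   one of 0, ..., #|T| is always free. *)
Definition newborn (T : tree) (v : vertex) : vertex :=
  find (fun i => (i :: v) \notin vertices T) (iota 0 #|` T|.+1) :: v.

(* The vertex w is never deleted: it is the vertex for which deletion is
   replaced by a mu-event, which leaves the tree unchanged.  The root is never
   deleted either, so that w = [::] gives the transitions of G itself. *)
Definition deletable (w : vertex) (T : tree) (v : vertex) : bool :=
  [&& v != [::], v != w & is_leaf T v].

Definition rate (R : realType) (lambda mu : R) (w : vertex) (T T' : tree) : R :=
  lambda * (\sum_(v <- enum_fset T)
              (vertices T' == newborn T v |` vertices T)%fset%:R) +
  mu * (\sum_(v <- enum_fset T | deletable w T v)
              (vertices T' == vertices T `\ v)%fset%:R).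

(* This is the sum over T' of the rates (rate lambda mu w T T'). *)
Definition exit_rate (R : realType) (lambda mu : R) (w : vertex) (T : tree) : R :=
  lambda * (size (enum_fset T))%:R +
  mu * (count (deletable w T) (enum_fset T))%:R.

(* A continuous-time Markov chain with the above rates, in its jump chain /
   holding times description: jumpc n is the n-th tree visited, hold n is the
   time spent there, and chain_prob T is the law of the chain started at T.
   The field chain_law says that, under chain_prob T, the jump chain is Markov
   with transition probabilities rate / exit_rate and that, given the jump
   chain, the holding times are independent exponential variables, with
   parameters the exit rates of the trees visited. *)
Record tree_chain (R : realType) (lambda mu : R) (w : vertex) := TreeChain {
  chain_disp : measure_display;
  chain_space : measurableType chain_disp;
  chain_prob : tree -> probability chain_space R;
  jumpc : nat -> chain_space -> tree;
  hold : nat -> chain_space -> R;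
  jumpc_measurable : forall n T, measurable [set om | jumpc n om = T];
  hold_measurable : forall n, measurable_fun setT (hold n);
  hold_gt0 : forall n om, 0 < hold n om;
  chain_law : forall (T : tree) (n : nat) (t : nat -> tree) (s : nat -> R),
    (forall k, (k <= n)%N -> 0 <= s k) ->
    chain_prob T [set om | forall k, (k <= n)%N ->
                             jumpc k om = t k /\ s k < hold k om] =
    ((t 0%N == T)%:R *
     (\prod_(k < n) (rate lambda mu w (t k) (t k.+1) /
                     exit_rate lambda mu w (t k))) *
     \prod_(k < n.+1) expR (- (exit_rate lambda mu w (t k) * s k)))%:E
}.

Section chain.
Variables (R : realType) (lambda mu : R) (w : vertex).
Variable G : tree_chain lambda mu w.

Definition jump_time (n : nat) (om : chain_space G) : R :=
  \sum_(k < n) hold k om.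

(* The value is arbitrary at and after an explosion time, a null event. *)
Definition tree_at (t : R) (om : chain_space G) : tree :=
  jumpc (xget 0%N [set n | jump_time n om <= t < jump_time n.+1 om]) om.

Definition return_time (om : chain_space G) : \bar R :=
  ereal_inf [set (jump_time n om)%:E |
              n in [set n | (0 < n)%N /\ jumpc n om = jumpc 0 om]].

Definition positive_recurrent : Prop :=
  forall T : tree,
    (\int[chain_prob G T]_(om in setT) return_time om < +oo)%E.

Definition transient : Prop :=
  forall T : tree,
    (chain_prob G T [set om | (return_time om < +oo)%E] < 1)%E.

Definition proba : probability (chain_space G) R := chain_prob G root_tree.

(* The k.+1-st transition is the birth of v. *)
Definition born (k : nat) (v : vertex) : set (chain_space G) :=
  [set om | v \notin vertices (jumpc k om) /\ v \in vertices (jumpc k.+1 om)].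

Definition lifetime (k : nat) (v : vertex) (om : chain_space G) : \bar R :=
  ereal_inf [set (jump_time n om - jump_time k.+1 om)%:E |
              n in [set n | (k.+1 < n)%N /\ v \notin vertices (jumpc n om)]].

(* The label v may be used several times, or never, so the lifetime of a
   vertex is considered conditionally on its birth. *)
Definition lifetime_df (k : nat) (v : vertex) (t : R) : R :=
  fine (proba (born k v `&` [set om | (lifetime k v om <= t%:E)%E])) /
  fine (proba (born k v)).

Definition mean_lifetime (k : nat) (v : vertex) : \bar R :=
  ((\int[proba]_(om in born k v) lifetime k v om) *
   ((fine (proba (born k v)))^-1)%:E)%E.

Definition ell (k : nat) (v : vertex) : R :=
  lim (lifetime_df k v t @[t --> +oo]).

(* Law at time t of the number of children of w, when the chain starts at T.
   If T is the tree at the birth of w, then t is the age of w, and w is not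
   deleted but undergoes mu-events. *)
Definition descendants_law (T : tree) (t : R) (j : nat) : R :=
  fine (chain_prob G T [set om | n_children (tree_at t om) w = j]).

(* The limit law of the number of children of w has mean r. *)
Definition steady_mean_descendants (T : tree) (r : R) : Prop :=
  exists a : nat -> R,
    [/\ forall j, descendants_law T t j @[t --> +oo] --> a j,
        (\sum_(0 <= j <oo) (a j)%:E = 1)%E &
        (\sum_(0 <= j <oo) (j%:R * a j)%:E = r%:E)%E].

End chain.

Definition smallest_root (R : realType) (rho r : R) : Prop :=
  r * expR (- r) = rho /\ forall s, s * expR (- s) = rho -> r <= s.

Definition positive_root (R : realType) (rho x : R) : Prop :=
  0 < x /\ x * expR x = rho^-1.

(* Main.v *)
(* Let q(t) be the probability that a vertex lives longer than t. The children
   of a vertex evolve independently of each other, so that, given that no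
   mu-event removes the vertex, it has Poisson many children at age t, of mean
   u(t) = lambda * int_0^t q. A decomposition at the last mu-event yields the
   renewal equation q(t) = 1 - int_0^t q(y) b(t - y) dy, b = mu * exp(- u), which
   determines q and from which all the asymptotics follow: u * exp(- u) <= rho
   keeps u below the smallest root of r * exp(- r) = rho if rho <= 1/e, whereas q
   stays away from 0 if rho > 1/e.

   The renewal equation is solved by a fixed point argument, and its solution q
   defines explicit functions of a tree and of time: the probability that a given
   vertex is deleted by time t, and the generating function of the number of its
   children. Both satisfy the backward equations of the chain, and their
   expectations along the jump chain telescope, which, by non-explosion,
   identifies them with the probabilities they stand for.

   If int_0^oo q is finite, the mean epoch of the first mu-event at the root is a
   finite Foster-Lyapunov function for the return to the tree reduced to its root,
   and such functions propagate along transitions of positive rate, hence to every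
   tree. If q has a positive limit, a new leaf lives forever with positive
   probability, which rules out recurrence. *)

Require Import Defs.
From mathcomp Require Import all_boot all_order all_algebra.
From mathcomp Require Import all_classical all_reals all_analysis.
From mathcomp Require Import measurable_realfun finmap ring lra zify.

Set Implicit Arguments.
Unset Strict Implicit.
Unset Printing Implicit Defensive.

Import Order.TTheory GRing.Theory Num.Theory.
Import numFieldNormedType.Exports.

Local Open Scope ring_scope.
Local Open Scope classical_set_scope.

(** * Locally Lipschitz functions and convolution *)

(** The chain is given only through the joint law of finitely many trees and holding times, so that
    neither a regeneration at mu-events nor the independence of subtrees is directly at hand. The
    decomposition at the last mu-event is never carried out on the probability space: it only serves
    to guess [dead] and [gf], built from [q] by products and convolutions, whose backward equations
    are then checked by differentiation. Nothing there depends on how [q] was obtained: every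
    function that satisfies [survival] will do, and a contraction supplies one. The contraction does
    not show that [q] is nonincreasing, which the asymptotic analysis requires. This fact comes back
    from the chain, once [1 - q] is identified with a distribution function. The critical value
    [rho = 1/e] needs no separate treatment: [lambda * itg q 0 t] stays below every root of
    [s * exp(- s) = rho], and an infinite integral of [q] forces a positive limit of [q]. *)

Section LocallyLipschitz.
Context {R : realType}.
Implicit Types f g : R -> R.

(** This class is closed under products, exponentials, primitives and convolutions, and implies
    continuity and integrability on segments, so that closure lemmas settle the side conditions of
    all later integrals. Negative arguments are included because convolutions reverse functions, as
    in [t - x]. *)
Definition lip f := forall A : R, exists C : R, 0 <= C /\
  forall a b : R, - A <= a -> a <= b -> b <= A -> `|f b - f a| <= C * (b - a).

Lemma lip_bounded f A : lip f -> exists M : R, 0 <= M /\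
  forall x : R, - A <= x -> x <= A -> `|f x| <= M.
Proof.
move=> /(_ A)[C [C0 HC]]; exists (`|f A| + C * (2 * `|A|)); split.
  by rewrite addr_ge0// mulr_ge0// mulr_ge0.
move=> x Ax xA.
have := HC x A Ax xA (lexx _).
rewrite distrC => h.
rewrite -[f x](subrK (f A)) addrC (le_trans (ler_normD _ _))// lerD2l.
apply: (le_trans h); apply: ler_wpM2l => //.
have := ler_norm A; lra.
Qed.

Lemma lip_cst (c : R) : lip (fun=> c).
Proof.
by move=> A; exists 0; split=> // a b _ _ _; rewrite subrr normr0 mul0r.
Qed.

Lemma lip_id : lip id.
Proof.
by move=> A; exists 1; split=> // a b _ ab _; rewrite mul1r ger0_norm// subr_ge0.
Qed.

Lemma lipD f g : lip f -> lip g -> lip (fun x => f x + g x).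
Proof.
move=> lf lg A; have [C [C0 HC]] := lf A; have [D [D0 HD]] := lg A.
exists (C + D); split=> [|a b Aa ab bA]; first exact: addr_ge0.
rewrite (_ : _ - _ = (f b - f a) + (g b - g a)); last by ring.
by rewrite mulrDl (le_trans (ler_normD _ _))// lerD// ?HC ?HD.
Qed.

Lemma lipN f : lip f -> lip (fun x => - f x).
Proof.
move=> lf A; have [C [C0 HC]] := lf A; exists C; split=> // a b Aa ab bA.
by rewrite -opprD normrN HC.
Qed.

Lemma lipB f g : lip f -> lip g -> lip (fun x => f x - g x).
Proof. by move=> lf lg; apply: lipD => //; apply: lipN. Qed.

Lemma lipM f g : lip f -> lip g -> lip (fun x => f x * g x).
Proof.
move=> lf lg A; have [C [C0 HC]] := lf A; have [D [D0 HD]] := lg A.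
have [M [M0 HM]] := lip_bounded A lf; have [N [N0 HN]] := lip_bounded A lg.
exists (C * N + M * D); split=> [|a b Aa ab bA].
  by rewrite addr_ge0// mulr_ge0.
rewrite (_ : _ - _ = (f b - f a) * g b + f a * (g b - g a)); last by ring.
have h1 := HC a b Aa ab bA; have h2 := HD a b Aa ab bA.
have h3 := HM a Aa (le_trans ab bA); have h4 := HN b (le_trans Aa ab) bA.
rewrite (le_trans (ler_normD _ _))// !normrM mulrDl lerD//.
  by rewrite mulrAC ler_pM.
by rewrite -mulrA ler_pM.
Qed.

Lemma lip_prod (I : Type) (s : seq I) (P : pred I) (F : I -> R -> R) :
  (forall i, lip (F i)) -> lip (fun x => \prod_(i <- s | P i) F i x).
Proof.
move=> lF; elim: s => [|i s IH].
  rewrite (_ : (fun x => _) = fun=> 1); first exact: lip_cst.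
  by apply/funext => x; rewrite big_nil.
case: (boolP (P i)) => Pi.
  rewrite (_ : (fun x => _) =
    fun x => F i x * \prod_(j <- s | P j) F j x); first exact: lipM.
  by apply/funext => x; rewrite big_cons Pi.
rewrite (_ : (fun x => _) = fun x => \prod_(j <- s | P j) F j x) //.
by apply/funext => x; rewrite big_cons (negbTE Pi).
Qed.

Lemma lip_sum (I : Type) (s : seq I) (P : pred I) (F : I -> R -> R) :
  (forall i, lip (F i)) -> lip (fun x => \sum_(i <- s | P i) F i x).
Proof.
move=> lF; elim: s => [|i s IH].
  rewrite (_ : (fun x => _) = fun=> 0); first exact: lip_cst.
  by apply/funext => x; rewrite big_nil.
case: (boolP (P i)) => Pi.
  rewrite (_ : (fun x => _) =
    fun x => F i x + \sum_(j <- s | P j) F j x); first exact: lipD.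
  by apply/funext => x; rewrite big_cons Pi.
rewrite (_ : (fun x => _) = fun x => \sum_(j <- s | P j) F j x) //.
by apply/funext => x; rewrite big_cons (negbTE Pi).
Qed.

Lemma lip_rev f t : lip f -> lip (fun x => f (t - x)).
Proof.
move=> lf A; have [C [C0 HC]] := lf (A + `|t|); exists C; split=> //.
move=> a b Aa ab bA; rewrite distrC.
have := ler_norm t; have := ler_norm (- t); rewrite normrN => h1 h2.
have := HC (t - b) (t - a); rewrite (_ : t - a - (t - b) = b - a); last by ring.
by apply; lra.
Qed.

Lemma lip_comp_contr f g : lip f ->
  (forall x y, `|g x - g y| <= `|x - y|) -> lip (fun x => g (f x)).
Proof.
move=> lf gc A; have [C [C0 HC]] := lf A; exists C; split=> // a b Aa ab bA.
exact: le_trans (gc _ _) (HC _ _ _ _ _).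
Qed.

Lemma expR_le_local (x y M : R) : x <= y -> y <= M ->
  expR y - expR x <= expR M * (y - x).
Proof.
move=> xy yM; have := expR_ge1Dx (x - y).
have e0 := expR_gt0 y.
have -> : expR x = expR y * expR (x - y) by rewrite -expRD; congr expR; ring.
move=> h; have h2 : expR y <= expR M by rewrite ler_expR.
have : 0 <= (y - x) * (expR M - expR y).
  by rewrite mulr_ge0 // subr_ge0.
nra.
Qed.

Lemma lip_expR f : lip f -> lip (fun x => expR (f x)).
Proof.
move=> lf A; have [C [C0 HC]] := lf A; have [M [M0 HM]] := lip_bounded A lf.
exists (expR M * C); split=> [|a b Aa ab bA]; first by rewrite mulr_ge0// expR_ge0.
have h := HC a b Aa ab bA.
have ha : f a <= M := le_trans (ler_norm _) (HM a Aa (le_trans ab bA)).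
have hb : f b <= M := le_trans (ler_norm _) (HM b (le_trans Aa ab) bA).
rewrite -mulrA; apply: (le_trans _ (ler_wpM2l (expR_ge0 M) h)).
case: (leP (f a) (f b)) => fab.
  rewrite !ger0_norm ?subr_ge0 ?ler_expR//; exact: expR_le_local.
rewrite distrC (distrC (f b)).
rewrite !ger0_norm ?subr_ge0 ?ler_expR ?(ltW fab)//.
exact: expR_le_local (ltW fab) _.
Qed.

(** Meant for primitives from 0 and convolutions, which are constant on the negative half-line. *)
Lemma lip_half f : (forall t, t <= 0 -> f t = f 0) ->
  (forall A, exists C : R, 0 <= C /\ forall a b : R, 0 <= a -> a <= b -> b <= A ->
     `|f b - f a| <= C * (b - a)) -> lip f.
Proof.
move=> f0 H A; have [C [C0 HC]] := H A; exists C; split=> // a b Aa ab bA.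
have [a0|a0] := leP 0 a; first exact: HC.
have [b0|b0] := leP b 0.
  by rewrite (f0 b)// (f0 a (ltW a0)) subrr normr0 mulr_ge0// subr_ge0.
rewrite (f0 a (ltW a0)); apply: (le_trans (HC 0 b _ _ _)) => //; first exact: ltW.
by apply: ler_wpM2l => //; lra.
Qed.

Lemma lip_continuous f : lip f -> continuous f.
Proof.
move=> lf x; have [C [C0 HC]] := lf (`|x| + 1).
have HC' y : `|x - y| <= 1 -> `|f x - f y| <= (C + 1) * `|x - y|.
  rewrite ler_norml => /andP[xy1 xy2].
  have := ler_norm x; have := ler_norm (- x); rewrite normrN => h1 h2.
  apply: (@le_trans _ _ (C * `|x - y|)); last by rewrite ler_wpM2r// lerDl.
  have [xy|xy] := leP x y.
    rewrite distrC (distrC x) (ger0_norm (_ : 0 <= y - x)) ?subr_ge0//.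
    by apply: HC => //; lra.
  rewrite (ger0_norm (_ : 0 <= x - y)) ?subr_ge0 ?(ltW xy)//.
  by apply: HC; lra.
clear HC; have C1 : 0 < C + 1 by rewrite ltr_pwDr.
apply/cvgrPdist_le => e e0; near=> y.
have xy : `|x - y| <= 1 by near: y; apply: cvgr_dist_le => //; exact: cvg_id.
have xyC : `|x - y| <= e / (C + 1).
  near: y; apply: cvgr_dist_le; first exact: cvg_id.
  by rewrite divr_gt0.
apply: (le_trans (HC' _ xy)).
by rewrite mulrC -ler_pdivlMr.
Unshelve. all: by end_near. Qed.

Lemma lip_measurable f : lip f -> measurable_fun setT f.
Proof.
move=> lf; apply: measurable_realfun.open_continuous_measurable_fun; first exact: openT.
by move=> x _; apply: lip_continuous.
Qed.

Lemma lip_integrable f (a b : R) : lip f ->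
  (@lebesgue_measure R).-integrable `[a, b] (EFin \o f).
Proof.
move=> lf; apply: continuous_compact_integrable; first exact: segment_compact.
apply: continuous_subspaceT; exact: lip_continuous.
Qed.

(** Not an oriented integral: it vanishes for [b <= a]. *)
Definition itg f (a b : R) : R := \int[lebesgue_measure]_(x in `[a, b]) f x.

Lemma itg_nil f a b : b <= a -> itg f a b = 0.
Proof.
rewrite /itg le_eqVlt => /orP[/eqP->|ba]; first by rewrite set_itv1 Rintegral_set1.
by rewrite set_itv_ge ?Rintegral_set0// bnd_simp -ltNge.
Qed.

Lemma eq_itg f g a b : (forall x : R, a <= x -> x <= b -> f x = g x) ->
  itg f a b = itg g a b.
Proof.
move=> fg; apply: eq_Rintegral => x; rewrite in_setE/= in_itv/= => /andP[? ?].
exact: fg.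
Qed.

Lemma itg_ge0 f a b : (forall x : R, a <= x -> x <= b -> 0 <= f x) -> 0 <= itg f a b.
Proof.
move=> f0; apply: Rintegral_ge0 => x; rewrite /= in_itv/= => /andP[? ?].
exact: f0.
Qed.

Lemma le_itg f g a b : lip f -> lip g ->
  (forall x : R, a <= x -> x <= b -> f x <= g x) -> itg f a b <= itg g a b.
Proof.
move=> lf lg fg; apply: le_Rintegral => //; do ? exact: lip_integrable.
by move=> x; rewrite /= in_itv/= => /andP[? ?]; exact: fg.
Qed.

Lemma itgD f g a b : lip f -> lip g ->
  itg (fun x => f x + g x) a b = itg f a b + itg g a b.
Proof. by move=> lf lg; apply: RintegralD => //; exact: lip_integrable. Qed.

Lemma itgB f g a b : lip f -> lip g ->
  itg (fun x => f x - g x) a b = itg f a b - itg g a b.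
Proof. by move=> lf lg; apply: RintegralB => //; exact: lip_integrable. Qed.

Lemma itgZ f c a b : lip f -> itg (fun x => c * f x) a b = c * itg f a b.
Proof. by move=> lf; apply: RintegralZl => //; exact: lip_integrable. Qed.

Lemma itg_cst c a b : a <= b -> itg (fun=> c) a b = c * (b - a).
Proof.
move=> ab; rewrite /itg Rintegral_cst//= lebesgue_measure_itv/=.
rewrite lte_fin; case: ltP => //= ba.
by rewrite (_ : b = a) ?subrr//; apply/le_anti; rewrite ab ba.
Qed.

Lemma itg_split f c a b : lip f -> a <= c -> c <= b ->
  itg f a b = itg f a c + itg f c b.
Proof.
move=> lf ac cb; apply/eqP; rewrite addrC -subr_eq; apply/eqP.
rewrite /itg Rintegral_itvB; rewrite ?bnd_simp//; last exact: lip_integrable.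
apply: Rintegral_itv_obnd_cbnd.
apply: integrableS (lip_integrable c b lf) => //.
by apply: subset_itvr; rewrite bnd_simp.
Qed.

Lemma itg_norm_le f M a b : lip f -> a <= b ->
  (forall x : R, a <= x -> x <= b -> `|f x| <= M) -> `|itg f a b| <= M * (b - a).
Proof.
move=> lf ab H; have lM := lip_cst M; have lN := lip_cst (- M).
rewrite ler_norml; apply/andP; split.
  rewrite -mulNr -itg_cst//; apply: le_itg => // x ax xb.
  by have := H x ax xb; rewrite ler_norml => /andP[].
by rewrite -itg_cst//; apply: le_itg => // x ax xb; apply: ler_normlW; apply: H.
Qed.

Lemma le_itg_cst f M a b : lip f -> a <= b ->
  (forall x : R, a <= x -> x <= b -> f x <= M) -> itg f a b <= M * (b - a).
Proof. by move=> lf ab H; rewrite -itg_cst//; apply: le_itg => //; exact: lip_cst. Qed.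

Lemma ge_itg_cst f M a b : lip f -> a <= b ->
  (forall x : R, a <= x -> x <= b -> M <= f x) -> M * (b - a) <= itg f a b.
Proof. by move=> lf ab H; rewrite -itg_cst//; apply: le_itg => //; exact: lip_cst. Qed.

End LocallyLipschitz.

(** * Functions with a locally Lipschitz derivative *)

Section ContinuouslyDifferentiable.
Context {R : realType}.
Implicit Types f g : R -> R.

(* Differentiability on [0, +oo[ with locally Lipschitz derivative, in a form
   whose stability under convolution needs no interchange of integrals. *)
Definition C11 f f' := [/\ lip f, lip f' &
  forall A : R, exists C : R, 0 <= C /\ forall a b : R, 0 <= a -> a <= b -> b <= A ->
    `|f b - f a - (b - a) * f' a| <= C * (b - a) ^+ 2].

Lemma C11_cst (c : R) : C11 (fun=> c) (fun=> 0).
Proof.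
split; [exact: lip_cst|exact: lip_cst|move=> A; exists 0; split=> // a b _ _ _].
by rewrite subrr mulr0 subrr normr0 mul0r.
Qed.

Lemma C11D f f' g g' : C11 f f' -> C11 g g' ->
  C11 (fun t => f t + g t) (fun t => f' t + g' t).
Proof.
move=> [lf lf' H] [lg lg' K]; split; [exact: lipD|exact: lipD|move=> A].
have [C [C0 {}H]] := H A; have [D [D0 {}K]] := K A.
exists (C + D); split=> [|a b a0 ab bA]; first exact: addr_ge0.
rewrite (_ : _ - _ = (f b - f a - (b - a) * f' a) + (g b - g a - (b - a) * g' a)).
  by rewrite [leRHS]mulrDl (le_trans (ler_normD _ _))// lerD ?H ?K.
by ring.
Qed.

Lemma C11M f f' g g' : C11 f f' -> C11 g g' ->
  C11 (fun t => f t * g t) (fun t => f' t * g t + f t * g' t).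
Proof.
move=> [lf lf' H] [lg lg' K]; split; first exact: lipM.
  by apply: lipD; exact: lipM.
move=> A.
have [C [C0 {}H]] := H A; have [D [D0 {}K]] := K A.
have [M [M0 HM]] := lip_bounded A lf; have [N [N0 HN]] := lip_bounded A lg.
have [E [E0 HE]] := lf A; have [F [F0 HF]] := lg A.
exists (C * N + M * D + E * F); split=> [|a b a0 ab bA].
  by rewrite !addr_ge0// mulr_ge0.
have ba : 0 <= b - a by rewrite subr_ge0.
have aA : - A <= a by lra.
rewrite (_ : _ - _ = (f b - f a - (b - a) * f' a) * g a +
  f a * (g b - g a - (b - a) * g' a) + (f b - f a) * (g b - g a)); last by ring.
rewrite 2!(mulrDl _ _ (_ ^+ 2)).
apply: le_trans (ler_normD _ _) _; apply: lerD.
  apply: le_trans (ler_normD _ _) _; rewrite !normrM; apply: lerD.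
    by rewrite mulrAC ler_pM ?H ?HN//; lra.
  by rewrite -mulrA ler_pM ?K ?HM//; lra.
by rewrite normrM expr2 mulrACA ler_pM ?HE ?HF.
Qed.

Lemma C11Z c f f' : C11 f f' -> C11 (fun t => c * f t) (fun t => c * f' t).
Proof.
move=> H; have := C11M (C11_cst c) H.
by congr (C11 _ _); apply/funext => t; rewrite mul0r add0r.
Qed.

Lemma C11_ext f f' g g' : C11 f f' -> f =1 g -> f' =1 g' -> C11 g g'.
Proof. by move=> H /funext <- /funext <-. Qed.

Lemma C11N f f' : C11 f f' -> C11 (fun t => - f t) (fun t => - f' t).
Proof.
by move=> /(C11Z (-1)); move/C11_ext; apply=> t; rewrite mulN1r.
Qed.

Lemma C11B f f' g g' : C11 f f' -> C11 g g' ->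
  C11 (fun t => f t - g t) (fun t => f' t - g' t).
Proof. by move=> Hf Hg; apply: C11D => //; apply: C11N. Qed.

Lemma C11_expR f f' : C11 f f' ->
  C11 (fun t => expR (f t)) (fun t => f' t * expR (f t)).
Proof.
move=> [lf lf' H]; split; first exact: lip_expR.
  by apply: lipM => //; exact: lip_expR.
move=> A; have [C [C0 {}H]] := H A.
have [M [M0 HM]] := lip_bounded A lf; have [E [E0 HE]] := lf A.
exists (expR M * C + expR M * E ^+ 2); split=> [|a b a0 ab bA].
  by rewrite addr_ge0// mulr_ge0// ?expR_ge0 ?exprn_ge0.
have aA : - A <= a by lra.
have {}H := H a b a0 ab bA; have {}HE := HE a b aA ab bA.
have ha : f a <= M by apply: le_trans (ler_norm _) (HM _ _ _); lra.
have hb : f b <= M by apply: le_trans (ler_norm _) (HM _ _ _); lra.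
rewrite (_ : _ - _ = expR (f a) * (f b - f a - (b - a) * f' a) +
  (expR (f b) - expR (f a) - (f b - f a) * expR (f a))); last by ring.
rewrite [leRHS]mulrDl (le_trans (ler_normD _ _))// lerD//.
  rewrite normrM (ger0_norm (expR_ge0 _)) -mulrA.
  by apply: ler_pM => //; rewrite ?expR_ge0 ?ler_expR.
(* By convexity the remainder lies between 0 and [(y - x) * (expR y - expR x)], whatever the order
   of [x] and [y]. *)
have quad (x y : R) : x <= M -> y <= M ->
    `|expR y - expR x - (y - x) * expR x| <= expR M * (y - x) ^+ 2.
  move=> xM yM; have ey := expR_gt0 y; have ex := expR_gt0 x.
  have e1 := expR_ge1Dx (y - x); have e2 := expR_ge1Dx (x - y).
  have E1 : expR y = expR x * expR (y - x) by rewrite -expRD; congr expR; ring.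
  have E2 : expR x = expR y * expR (x - y) by rewrite -expRD; congr expR; ring.
  have lo : (y - x) * expR x <= expR y - expR x by rewrite E1; nra.
  have hi : expR y - expR x <= (y - x) * expR y by rewrite {1}E2; nra.
  rewrite ger0_norm ?subr_ge0//.
  have [xy|/ltW yx] := leP x y.
    have := expR_le_local xy yM; nra.
  have := expR_le_local yx xM; nra.
apply: (le_trans (quad _ _ ha hb)); rewrite -mulrA; apply: ler_wpM2l.
  exact: expR_ge0.
rewrite -exprMn -(real_normK (num_real (f b - f a))).
by rewrite lerXn2r// nnegrE ?mulr_ge0// subr_ge0.
Qed.

Lemma C11_itg f : lip f -> C11 (fun t => itg f 0 t) f.
Proof.
move=> lf.
have quad A : exists C : R, 0 <= C /\ forall a b : R, 0 <= a -> a <= b -> b <= A ->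
    `|itg f 0 b - itg f 0 a - (b - a) * f a| <= C * (b - a) ^+ 2.
  have [C [C0 HC]] := lf A; exists C; split=> // a b a0 ab bA.
  rewrite (itg_split lf a0 ab) (addrC (itg f 0 a)) addrK mulrC -itg_cst//.
  rewrite -itgB//; last exact: lip_cst.
  rewrite expr2 mulrA; apply: itg_norm_le => //.
    by apply: lipB => //; exact: lip_cst.
  move=> x ax xb; apply: le_trans (HC _ _ _ _ _) _ => //; try lra.
  by rewrite ler_wpM2l// lerD2r.
split=> //; apply: lip_half => [t t0|A]; first by rewrite !itg_nil.
have [M [M0 HM]] := lip_bounded A lf; exists M; split=> // a b a0 ab bA.
rewrite (itg_split lf a0 ab) (addrC (itg f 0 a)) addrK.
by apply: itg_norm_le => // x ax xb; apply: HM; lra.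
Qed.

(** Cutting an interval at its midpoint halves a quadratic error, since
    [2 * (d / 2) ^+ 2 = d ^+ 2 / 2]; iterated bisection makes the error over [[a, b]] vanish. This
    plays the part of the mean value theorem for [C11]. *)
Lemma ge_of_quad f (C a b : R) : a <= b ->
  (forall x y : R, a <= x -> x <= y -> y <= b -> - (C * (y - x) ^+ 2) <= f y - f x) ->
  f a <= f b.
Proof.
move=> ab H.
have H2 n (x y : R) : a <= x -> x <= y -> y <= b ->
    - (C * (y - x) ^+ 2 / 2 ^+ n) <= f y - f x.
  elim: n x y => [|n IH] x y ax xy yb; first by rewrite expr0 divr1 H.
  have h1 := IH x ((x + y) / 2) ltac:(lra) ltac:(lra) ltac:(lra).
  have h2 := IH ((x + y) / 2) y ltac:(lra) ltac:(lra) ltac:(lra).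
  have -> : f y - f x = (f ((x + y) / 2) - f x) + (f y - f ((x + y) / 2)) by ring.
  apply: le_trans (lerD h1 h2); rewrite le_eqVlt; apply/orP; left; apply/eqP.
  have k0 : (2 : R) ^+ n != 0 by rewrite expf_neq0.
  have -> : (x + y) / 2 - x = (y - x) / 2 by lra.
  have -> : y - (x + y) / 2 = (y - x) / 2 by lra.
  rewrite (exprS _ n) invfM; move: (2 ^+ n)^-1 => k; move: (y - x) => d.
  by rewrite exprMn; move: (d ^+ 2) => e; lra.
rewrite -subr_ge0; apply/ler_addgt0Pr => e e0.
have [C0|C0] := leP C 0.
  have := H a b (lexx _) ab (lexx _); have : 0 <= (b - a) ^+ 2 by rewrite sqr_ge0.
  nra.
set D := C * (b - a) ^+ 2.
have D0 : 0 <= D by rewrite mulr_ge0 ?sqr_ge0// ltW.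
pose n := Num.bound (D / e).
have hn : D / e < n%:R.
  have := archi_boundP (divr_ge0 D0 (ltW e0)); done.
have n2 : (n%:R : R) <= 2 ^+ n by rewrite -natrX ler_nat ltnW// ltn_expl.
have p2 : (0 : R) < 2 ^+ n by rewrite exprn_gt0.
have := H2 n a b (lexx _) ab (lexx _); rewrite -/D.
suff : D / 2 ^+ n <= e by lra.
rewrite ler_pdivrMr// mulrC -ler_pdivrMr//.
by rewrite (le_trans (ltW hn)).
Qed.

Lemma eq_of_quad f (C a b : R) : a <= b ->
  (forall x y : R, a <= x -> x <= y -> y <= b -> `|f y - f x| <= C * (y - x) ^+ 2) ->
  f a = f b.
Proof.
move=> ab H; apply/le_anti/andP; split.
  apply: (@ge_of_quad _ C) => // x y ax xy yb.
  by have := H x y ax xy yb; rewrite ler_norml => /andP[].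
rewrite -lerN2; apply: (@ge_of_quad (fun x => - f x) C) => // x y ax xy yb.
have := H x y ax xy yb; rewrite ler_norml => /andP[_]; lra.
Qed.

Lemma C11_ndec f f' (a b : R) : C11 f f' -> 0 <= a -> a <= b ->
  (forall x : R, a <= x -> x <= b -> 0 <= f' x) -> f a <= f b.
Proof.
move=> [lf lf' /(_ b)[C [C0 HC]]] a0 ab f'0.
apply: (@ge_of_quad _ C) => // x y ax xy yb.
have := HC x y ltac:(lra) xy yb; rewrite ler_norml => /andP[h _].
have : 0 <= (y - x) * f' x by rewrite mulr_ge0 ?subr_ge0// f'0//; lra.
lra.
Qed.

(** The difference of [f] and the primitive of [f'] has quadratic increments, hence is constant. *)
Lemma C11_ftc f f' (a b : R) : C11 f f' -> 0 <= a -> a <= b ->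
  itg f' a b = f b - f a.
Proof.
move=> Hf a0 ab; have [lf lf' _] := Hf.
have [_ _ /(_ b)[C [C0 HC]]] := C11B Hf (C11_itg lf').
have := @eq_of_quad (fun t => f t - itg f' 0 t) C a b ab.
rewrite (itg_split lf' a0 ab).
suff H : forall x y : R, a <= x -> x <= y -> y <= b ->
    `|f y - itg f' 0 y - (f x - itg f' 0 x)| <= C * (y - x) ^+ 2.
  move/(_ H); lra.
move=> x y ax xy yb.
by have := HC x y (le_trans a0 ax) xy yb; rewrite subrr mulr0 subr0.
Qed.

Lemma C11_derivative_le f f' g g' (a b : R) : C11 f f' -> C11 g g' -> 0 <= a -> a <= b ->
  (forall x : R, a <= x -> x <= b -> f' x <= g' x) -> f b - f a <= g b - g a.
Proof.
move=> Hf Hg a0 ab fg; have := @C11_ndec _ _ a b (C11B Hg Hf) a0 ab.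
suff H : forall x : R, a <= x -> x <= b -> 0 <= g' x - f' x by move/(_ H); lra.
by move=> x ax xb; rewrite subr_ge0 fg.
Qed.

(** The substitution [s |-> t - s]: as [x] runs from [A] to [t], the sum [g x] of the part already
    substituted and of the part still to be has quadratic increments, hence is constant. *)
Lemma itg_rev_tail f (A t : R) : 0 <= A -> A <= t -> lip f ->
  itg (fun s => f (t - s)) A t = itg f 0 (t - A).
Proof.
move=> A0 At lf; have lr := lip_rev t lf.
have [C [C0 HC]] := lf t.
pose g x := itg (fun s => f (t - s)) A x + itg f 0 (t - x).
have := @eq_of_quad g (C + C) A t At.
rewrite /g subrr (@itg_nil _ _ 0 0)// (@itg_nil _ _ A A)// add0r addr0.
move=> /(_ _)/esym; apply.
move=> x y Ax xy yt; have x0 := le_trans A0 Ax.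
rewrite (itg_split lr Ax xy).
rewrite (@itg_split _ f (t - y) 0 (t - x) lf); [|lra|lra].
rewrite (_ : _ - _ = (itg (fun s => f (t - s)) x y - f (t - x) * (y - x)) -
   (itg f (t - y) (t - x) - f (t - x) * (t - x - (t - y)))); last by ring.
rewrite -itg_cst// -[X in _ - (_ - X)]itg_cst; last by lra.
rewrite -!itgB//; try exact: lip_cst.
rewrite [leRHS]mulrDl (le_trans (ler_normB _ _))//; apply: lerD.
  rewrite expr2 mulrA; apply: itg_norm_le => //.
    by apply: lipB => //; exact: lip_cst.
  move=> s xs sy; rewrite distrC; apply: le_trans (HC _ _ _ _ _) _; try lra.
  by rewrite ler_wpM2l//; lra.
rewrite expr2 mulrA {2}(_ : y - x = t - x - (t - y)); last by ring.
apply: itg_norm_le; [by apply: lipB => //; exact: lip_cst|lra|].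
move=> s xs sy; rewrite distrC; apply: le_trans (HC _ _ _ _ _) _; try lra.
by rewrite ler_wpM2l//; lra.
Qed.

Lemma itg_rev f (t : R) : 0 <= t -> lip f -> itg (fun s => f (t - s)) 0 t = itg f 0 t.
Proof. by move=> t0 lf; rewrite itg_rev_tail// subr0. Qed.

Definition conv f g (t : R) := itg (fun y => f y * g (t - y)) 0 t.

Lemma lipZ f (c : R) : lip f -> lip (fun y => c * f y).
Proof. by move=> lf; apply: lipM => //; exact: lip_cst. Qed.

Lemma lip_conv_int f g (t : R) : lip f -> lip g -> lip (fun y => f y * g (t - y)).
Proof. by move=> lf lg; apply: lipM => //; exact: lip_rev. Qed.

Lemma conv_nil f g (t : R) : t <= 0 -> conv f g t = 0.
Proof. by move=> t0; rewrite /conv itg_nil. Qed.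

Lemma conv_diff f g (a b : R) : lip f -> lip g -> 0 <= a -> a <= b ->
  conv f g b - conv f g a = itg (fun y => f y * (g (b - y) - g (a - y))) 0 a +
     itg (fun y => f y * g (b - y)) a b.
Proof.
move=> lf lg a0 ab; rewrite /conv (itg_split (lip_conv_int b lf lg) a0 ab).
rewrite addrAC -itgB; [|exact: lip_conv_int|exact: lip_conv_int].
by congr (_ + _); apply: eq_itg => x _ _; rewrite mulrBr.
Qed.

Lemma lip_conv f g : lip f -> lip g -> lip (conv f g).
Proof.
move=> lf lg; apply: lip_half => [t t0|A]; first by rewrite !conv_nil.
have [M [M0 HM]] := lip_bounded A lf; have [N [N0 HN]] := lip_bounded A lg.
have [C [C0 HC]] := lg A.
exists (M * C * `|A| + M * N); split=> [|a b a0 ab bA].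
  by rewrite addr_ge0// !mulr_ge0.
rewrite conv_diff// [leRHS]mulrDl (le_trans (ler_normD _ _))// lerD//.
  have hA : a <= `|A| by apply: le_trans (ler_norm A); lra.
  rewrite mulrAC; apply: le_trans (_ : _ <= M * C * (b - a) * (a - 0)) _; last first.
    by rewrite subr0 ler_wpM2l// !mulr_ge0// subr_ge0.
  apply: itg_norm_le => //.
    by apply: lipM => //; apply: lipB; exact: lip_rev.
  move=> x x0 xa; rewrite normrM -mulrA ler_pM//; first by apply: HM; lra.
  have := HC (a - x) (b - x); rewrite (_ : b - x - (a - x) = b - a); last by ring.
  by apply; lra.
apply: itg_norm_le => //; first exact: lip_conv_int.
by move=> x ax xb; rewrite normrM ler_pM// ?HM ?HN//; lra.
Qed.

(** Only [g] is differentiated, so [f] may be merely Lipschitz. Over [[0, a]] the error is that of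
    [g]; over [[a, b]] the integrand is within [O(b - a)] of [f a * g 0]. *)
Lemma C11_conv f g g' : lip f -> C11 g g' ->
  C11 (conv f g) (fun t => g 0 * f t + conv f g' t).
Proof.
move=> lf [lg lg' H]; split; first exact: lip_conv.
  by apply: lipD; [apply: lipM => //; exact: lip_cst|exact: lip_conv].
move=> A; have [C [C0 {}H]] := H A.
have [M [M0 HM]] := lip_bounded A lf; have [N [N0 HN]] := lip_bounded A lg.
have [D [D0 HD]] := lg A; have [E [E0 HE]] := lf A.
exists (M * C * `|A| + (M * D + E * N)); split=> [|a b a0 ab bA].
  by rewrite addr_ge0// ?addr_ge0 ?mulr_ge0.
have ba : 0 <= b - a by rewrite subr_ge0.
rewrite conv_diff//.
have -> : (b - a) * (g 0 * f a + conv f g' a) =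
    itg (fun y => (b - a) * (f y * g' (a - y))) 0 a + itg (fun y => f a * g 0) a b.
  rewrite itg_cst// itgZ; last exact: lip_conv_int.
  by rewrite /conv; ring.
rewrite opprD addrACA -!itgB; last 4 first.
- by apply: lip_conv_int.
- exact: lip_cst.
- by apply: lipM => //; apply: lipB; exact: lip_rev.
- by apply: lipM; [exact: lip_cst|exact: lip_conv_int].
rewrite [leRHS]mulrDl (le_trans (ler_normD _ _))// lerD//.
  have hA : a <= `|A| by apply: le_trans (ler_norm A); lra.
  rewrite mulrAC; apply: le_trans (_ : _ <= M * C * (b - a) ^+ 2 * (a - 0)) _; last first.
    by rewrite subr0 ler_wpM2l// !mulr_ge0// sqr_ge0.
  apply: itg_norm_le => //.
    apply: lipB; first by apply: lipM => //; apply: lipB; exact: lip_rev.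
    by apply: lipM; [exact: lip_cst|exact: lip_conv_int].
  move=> x x0 xa.
  rewrite (_ : _ - _ = f x * (g (b - x) - g (a - x) - (b - a) * g' (a - x))); last by ring.
  rewrite normrM -mulrA ler_pM//; first by apply: HM; lra.
  have := H (a - x) (b - x); rewrite (_ : b - x - (a - x) = b - a); last by ring.
  by apply; lra.
rewrite expr2 mulrA; apply: itg_norm_le => //.
  by apply: lipB; [exact: lip_conv_int|exact: lip_cst].
move=> x ax xb.
rewrite (_ : _ - _ = f x * (g (b - x) - g 0) + (f x - f a) * g 0); last by ring.
rewrite [leRHS]mulrDl (le_trans (ler_normD _ _))// !normrM lerD//.
  rewrite -mulrA ler_pM//; first by apply: HM; lra.
  apply: le_trans (HD _ _ _ _ _) _; try lra.
  by rewrite ler_wpM2l//; lra.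
rewrite mulrAC ler_pM//.
  apply: le_trans (HE _ _ _ _ _) _; try lra.
  by rewrite ler_wpM2l//; lra.
by apply: HN; lra.
Qed.

End ContinuouslyDifferentiable.

(** * The renewal equation for the lifetime *)

Section Existence.
Context {R : realType}.
Implicit Types (Q q f g : R -> R).

Lemma cvg_norm_le (x : nat -> R) (l c : R) : x @ \oo --> l ->
  (\forall n \near \oo, `|x n| <= c) -> `|l| <= c.
Proof.
move=> xl xc; have h : (fun n => `|x n|) @ \oo --> `|l| by exact: cvg_norm.
by rewrite -(cvg_lim _ h)//; apply: limr_le => //; apply/cvg_ex; exists `|l|.
Qed.

Lemma cvg_geometric_increments (x : nat -> R) (c : R) : 0 <= c ->
  (forall n, `|x n.+1 - x n| <= c / 2 ^+ n) ->
  exists l : R, x @ \oo --> l /\ forall n, `|l - x n| <= 2 * c / 2 ^+ n.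
Proof.
move=> c0 H.
have p2 n : (0 : R) < 2 ^+ n by rewrite exprn_gt0.
have inc n m : `|x (n + m)%N - x n| <= 2 * c / 2 ^+ n - 2 * c / 2 ^+ (n + m).
  elim: m => [|m IH]; first by rewrite addn0 !subrr normr0.
  rewrite addnS -[x _.+1](subrK (x (n + m)%N)) -addrA (le_trans (ler_normD _ _))//.
  apply: le_trans (lerD (H _) IH) _.
  rewrite (exprS 2 (n + m)) invfM; move: (2 ^+ (n + m))^-1 => k.
  lra.
have inc' n m : `|x (n + m)%N - x n| <= 2 * c / 2 ^+ n.
  apply: le_trans (inc n m) _; rewrite lerBlDr lerDl.
  by rewrite divr_ge0// ?mulr_ge0// ltW.
have xcvg : cvgn (series (telescope x)).
  apply: normed_cvg.
  apply: (@series_le_cvg _ _ (geometric c 2^-1)) => n //=.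
  - by rewrite mulr_ge0.
  - by rewrite exprVn; exact: H.
  - by apply: is_cvg_geometric_series; rewrite ger0_norm; lra.
have [l xl] : exists l : R, x @ \oo --> l.
  exists (x 0%N + limn (series (telescope x))).
  have E : x = fun n => x 0%N + series (telescope x) n.
    by apply/funext => n; exact: eq_sum_telescope.
  have : (fun n => x 0%N + series (telescope x) n) @ \oo -->
    x 0%N + limn (series (telescope x)) by apply: cvgD => //; exact: cvg_cst.
  by rewrite -E.
exists l; split=> // n.
apply: (@cvg_norm_le (fun m => x m - x n)).
  by apply: cvgB => //; exact: cvg_cst.
by exists n => // m /= nm; have := inc' n (m - n)%N; rewrite subnKC.
Qed.

Lemma itg_expR_le (a t : R) : 0 < a -> 0 <= t ->
  itg (fun s => expR (a * s)) 0 t <= expR (a * t) / a.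
Proof.
move=> a0 t0.
have H : C11 (fun s : R => expR (a * s) / a) (fun s => expR (a * s)).
  have id1 : C11 (fun s : R => s) (fun=> 1).
    split; [exact: lip_id|exact: lip_cst|move=> A; exists 0; split=> // x y _ _ _].
    by rewrite mulr1 subrr normr0 mul0r.
  have := C11Z a^-1 (C11_expR (C11Z a id1)); move/C11_ext; apply=> s.
    by rewrite mulrC.
  by field; rewrite gt_eqF.
rewrite (C11_ftc H) ?lexx// lerBlDr lerDl divr_ge0 ?expR_ge0//; lra.
Qed.

Lemma itg_mono f (a b : R) : lip f -> (forall x : R, 0 <= f x) -> a <= b ->
  itg f 0 a <= itg f 0 b.
Proof.
move=> lf f0 ab.
have [a0|a0] := leP 0 a.
  by rewrite (itg_split lf a0 ab) lerDl itg_ge0.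
by rewrite (@itg_nil _ _ 0 a) ?itg_ge0// ltW.
Qed.

Lemma itg_norm_le_weight f g (a b : R) : lip f -> lip g ->
  (forall x : R, a <= x -> x <= b -> `|f x| <= g x) -> `|itg f a b| <= itg g a b.
Proof.
move=> lf lg fg; have lN := lipN lg.
have NN : - itg g a b = itg (fun x => - g x) a b.
  by rewrite -mulN1r -itgZ//; apply: eq_itg => x _ _; rewrite mulN1r.
rewrite ler_norml NN !le_itg// => x ax xb.
  exact: ler_normlW (fg x ax xb).
by have := fg x ax xb; rewrite ler_norml => /andP[].
Qed.

Lemma clip_contr (x y : R) :
  `|Num.max 0 (Num.min 1 x) - Num.max 0 (Num.min 1 y)| <= `|x - y|.
Proof.
have key (u v : R) : u <= v ->
    `|Num.max 0 (Num.min 1 u) - Num.max 0 (Num.min 1 v)| <= `|u - v|.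
  move=> uv; rewrite distrC (distrC u) (ger0_norm (_ : 0 <= v - u)) ?subr_ge0//.
  rewrite ler_norml !maxEle !minEle.
  case: (leP 1 u) => h1; case: (leP 1 v) => h2; rewrite ?ler01;
    case: (leP 0 u) => h3; case: (leP 0 v) => h4; apply/andP; split; lra.
by have [/key//|/ltW/key] := leP x y; rewrite distrC (distrC y).
Qed.

Lemma le_sub1_conv (U V X Y Z : R) : X <= 0 -> Y <= Z -> U - V = X + Y ->
  1 - V - Z <= 1 - U.
Proof. by lra. Qed.

Lemma sub1B (x y : R) : 1 - x - (1 - y) = - (x - y).
Proof. by ring. Qed.

Variables (lambda mu : R).
Hypotheses (l0 : 0 < lambda) (m0 : 0 < mu).

Let l1 : 0 <= lambda := ltW l0.
Let m1 : 0 <= mu := ltW m0.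

(** The intensity of mu-events at age [t]: [mu] times the probability that a Poisson number of
    children, of mean [lambda * itg q 0 t], is 0. *)
Definition event_rate q (t : R) : R := mu * expR (- (lambda * itg q 0 t)).

Let F q (t : R) : R := 1 - conv q (event_rate q) t.
(** The estimates on [F] hold for functions with values in [[0, 1]], which the iterates of [F] need
    not be. Truncation is itself a contraction, and it will turn out to be inactive at the fixed
    point. *)
Let clip q (t : R) : R := Num.max 0 (Num.min 1 (q t)).

Let clip01 q t : 0 <= clip q t <= 1.
Proof.
by rewrite /clip le_max lexx/= ge_max ler01 ge_min lexx.
Qed.

Let lip_clip q : lip q -> lip (clip q).
Proof. by move=> lq; apply: lip_comp_contr lq clip_contr. Qed.

Lemma lip_itg f : lip f -> lip (fun t => itg f 0 t).
Proof. by move=> lf; have [] := C11_itg lf. Qed.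

Lemma C11_event_rate q : lip q ->
  C11 (event_rate q) (fun t => - lambda * (q t * event_rate q t)).
Proof.
move=> lq; have := C11Z mu (C11_expR (C11N (C11Z lambda (C11_itg lq)))).
by move/C11_ext; apply=> // t; rewrite /event_rate; ring.
Qed.

Lemma lip_event_rate q : lip q -> lip (event_rate q).
Proof. by move=> /C11_event_rate[]. Qed.

Lemma event_rate_gt0 q t : 0 < event_rate q t.
Proof. by rewrite mulr_gt0// expR_gt0. Qed.

Lemma event_rate_ninc q (s t : R) : lip q -> (forall x : R, 0 <= q x) -> s <= t ->
  event_rate q t <= event_rate q s.
Proof.
move=> lq q0 st; apply: (ler_wpM2l m1).
by rewrite ler_expR lerN2; apply: (ler_wpM2l l1); exact: itg_mono.
Qed.

Lemma event_rate_le q t : lip q -> (forall x : R, 0 <= q x) -> event_rate q t <= mu.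
Proof.
move=> lq q0; rewrite -[leRHS]mulr1 ler_wpM2l// // -[leRHS]expR0 ler_expR.
by rewrite oppr_le0 mulr_ge0// // itg_ge0.
Qed.

Lemma event_rate_dist q1 q2 (t K : R) : lip q1 -> lip q2 ->
  (forall x : R, 0 <= q1 x) -> (forall x : R, 0 <= q2 x) ->
  `|itg q1 0 t - itg q2 0 t| <= K ->
  `|event_rate q1 t - event_rate q2 t| <= mu * lambda * K.
Proof.
move=> lq1 lq2 q10 q20 H; rewrite -mulrBr normrM (ger0_norm (ltW m0)) -mulrA.
rewrite ler_wpM2l// //; apply: (@le_trans _ _ (lambda * `|itg q1 0 t - itg q2 0 t|)); last first.
  by rewrite ler_wpM2l// ltW.
have i1 : 0 <= itg q1 0 t by exact: itg_ge0.
have i2 : 0 <= itg q2 0 t by exact: itg_ge0.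
move: (itg q1 0 t) (itg q2 0 t) i1 i2 => x y x0 y0 {H}.
have key u v : 0 <= u -> u <= v ->
    `|expR (- (lambda * u)) - expR (- (lambda * v))| <= lambda * `|u - v|.
  move=> u0 uv; rewrite (distrC u) (ger0_norm (_ : 0 <= v - u)) ?subr_ge0//.
  rewrite ger0_norm; last by rewrite subr_ge0 ler_expR lerN2 ler_wpM2l// ltW.
  have := @expR_le_local _ (- (lambda * v)) (- (lambda * u)) 0.
  rewrite lerN2 oppr_le0 expR0 ler_wpM2l // mulr_ge0 //.
  by move=> /(_ isT isT); lra.
by have [/key|/ltW/key] := leP x y; last rewrite distrC (distrC y); exact.
Qed.

(** Exponent of the weighted norm [sup |q s| * exp(- a * s)]. In this norm [F] contracts by the
    factor [mu / a + (mu / a) * (lambda / a)], and the present [a] makes each term at most 1/4. *)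
Let a := 4 * mu + lambda.
Let a0 : 0 < a. Proof. rewrite /a; have := l0; have := m0; lra. Qed.

Let F_contr q1 q2 (K : R) : lip q1 -> lip q2 ->
  (forall x : R, 0 <= q1 x <= 1) -> (forall x : R, 0 <= q2 x <= 1) -> 0 <= K ->
  (forall s : R, 0 <= s -> `|q1 s - q2 s| <= K * expR (a * s)) ->
  forall t : R, 0 <= t -> `|F q1 t - F q2 t| <= K / 2 * expR (a * t).
Proof.
move=> lq1 lq2 q11 q21 K0 H t t0.
have q10 x : 0 <= q1 x by have /andP[] := q11 x.
have q20 x : 0 <= q2 x by have /andP[] := q21 x.
have lb1 := lip_event_rate lq1; have lb2 := lip_event_rate lq2.
have le (c : R) : lip (fun y : R => c * expR (a * y)).
  apply: lipM; first exact: lip_cst.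
  by apply: lip_expR; apply: lipM; [exact: lip_cst|exact: lip_id].
have lr (c : R) : lip (fun y : R => c * expR (a * (t - y))).
  by have := lip_rev t (le c).
have itgK (x : R) : 0 <= x -> `|itg q1 0 x - itg q2 0 x| <= K * (expR (a * x) / a).
  move=> x0; rewrite -itgB//; apply: le_trans (itg_norm_le_weight _ (le K) _) _.
  - exact: lipB.
  - by move=> y y0 _; exact: H.
  have le1 : lip (fun y : R => expR (a * y)).
    by apply: lip_expR; apply: lipM; [exact: lip_cst|exact: lip_id].
  by rewrite itgZ// ler_wpM2l// itg_expR_le.
rewrite /F sub1B.
rewrite normrN /conv -itgB; [|exact: lip_conv_int|exact: lip_conv_int].
pose g y := K * mu * expR (a * y) + K * mu * lambda / a * expR (a * (t - y)).
have lg : lip g by apply: lipD; [exact: le|exact: lr].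
apply: le_trans (itg_norm_le_weight _ lg _) _.
- by apply: lipB; exact: lip_conv_int.
- move=> y y0 yt.
  have E (x1 x2 y1 y2 : R) : x1 * y1 - x2 * y2 = (x1 - x2) * y1 + x2 * (y1 - y2).
    by ring.
  rewrite E {E}.
  rewrite (le_trans (ler_normD _ _))// lerD// normrM.
    rewrite mulrAC ler_pM// ?H//.
    by rewrite ger0_norm ?event_rate_le// ltW// event_rate_gt0.
  have /andP[q2y0 q2y1] := q21 y; rewrite ger0_norm//.
  apply: (@le_trans _ _ (1 * (mu * lambda * (K * (expR (a * (t - y)) / a))))).
    by rewrite ler_pM//; apply: event_rate_dist => //; apply: itgK; rewrite subr_ge0.
  by rewrite le_eqVlt; apply/orP; left; apply/eqP; ring.
rewrite /g itgD//.
rewrite (itg_rev t0 (le (K * mu * lambda / a))) !itgZ; last 2 first.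
- by apply: lip_expR; apply: lipM; [exact: lip_cst|exact: lip_id].
- by apply: lip_expR; apply: lipM; [exact: lip_cst|exact: lip_id].
have := itg_expR_le a0 t0; set I := itg _ _ _; set E := expR _ => HI.
have E0 : 0 < E by exact: expR_gt0.
rewrite -mulrDl; apply: (@le_trans _ _ ((K * mu + K * mu * lambda / a) * (E / a))).
  by apply: ler_wpM2l HI; rewrite addr_ge0// ?mulr_ge0// ?invr_ge0 ltW.
rewrite mulrA (mulrAC _ E) ler_wpM2r// ?(ltW E0)//.
have h1 : mu / a <= 4^-1 by rewrite ler_pdivrMr// /a; have := l0; lra.
have h2 : lambda / a <= 1 by rewrite ler_pdivrMr// /a; have := m0; lra.
have h3 : 0 <= lambda / a by rewrite divr_ge0// ltW.
have h4 : 0 <= mu / a by rewrite divr_ge0// ltW.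
rewrite (_ : _ / a = K * (mu / a + (mu / a) * (lambda / a))); last by ring.
rewrite ler_wpM2l//; have : mu / a * (lambda / a) <= 4^-1 * 1 by rewrite ler_pM.
lra.
Qed.

Let qn n := iter n (fun q => F (clip q)) (fun=> 1).

Let lip_F q : lip q -> lip (F q).
Proof.
move=> lq; apply: lipB; first exact: lip_cst.
by apply: lip_conv => //; exact: lip_event_rate.
Qed.

Let lip_qn n : lip (qn n).
Proof. by elim: n => [|n IH]; [exact: lip_cst|apply: lip_F; exact: lip_clip]. Qed.

Let qn_nonpos n (t : R) : t <= 0 -> qn n t = 1.
Proof. by case: n => [//|n] t0; rewrite /qn iterS /F conv_nil// subr0. Qed.

Let qn_incr n (t : R) : 0 <= t -> `|qn n.+1 t - qn n t| <= expR (a * t) / 2 ^+ n.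
Proof.
elim: n t => [|n IH] t t0.
  rewrite /qn /= /F expr0 divr1 addrAC subrr add0r normrN.
  have lc : lip (clip (fun=> 1)) by apply: lip_clip; exact: lip_cst.
  have c0 (x : R) : 0 <= clip (fun=> 1) x by have /andP[] := clip01 (fun=> 1) x.
  apply: le_trans (itg_norm_le (M := mu) _ t0 _) _.
  - by apply: lip_conv_int => //; exact: lip_event_rate.
  - move=> y y0 yt; rewrite normrM -[leRHS]mul1r ler_pM//.
      by have /andP[? ?] := clip01 (fun=> 1) y; rewrite ger0_norm.
    by rewrite ger0_norm ?event_rate_le// ltW// event_rate_gt0.
  rewrite subr0; apply: le_trans (expR_ge1Dx _).
  rewrite /a; have : 0 <= mu * t by rewrite mulr_ge0// ltW.
  have : 0 <= lambda * t by rewrite mulr_ge0// ltW.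
  nra.
rewrite /qn !iterS -/(qn n) -/(qn n.+1).
have := @F_contr (clip (qn n.+1)) (clip (qn n)) (2 ^+ n)^-1.
have -> : expR (a * t) / 2 ^+ n.+1 = 2 ^- n / 2 * expR (a * t).
  by rewrite (exprS 2 n) invfM mulrC (mulrC 2^-1).
apply => //.
- exact: lip_clip.
- exact: lip_clip.
- by move=> s s0; rewrite (le_trans (clip_contr _ _))// mulrC IH.
Qed.

(** As [C] does not depend on [n], the pointwise limit of the iterates is locally Lipschitz
    again. *)
Let qn_lip_unif A : exists C : R, 0 <= C /\ forall n (s t : R), 0 <= s -> s <= t -> t <= A ->
  `|qn n t - qn n s| <= C * (t - s).
Proof.
exists (mu * lambda * `|A| + mu); split.
  by rewrite addr_ge0// ?mulr_ge0// ltW.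
move=> [|n] s t s0 st tA.
  rewrite subrr normr0 mulr_ge0 ?subr_ge0// addr_ge0// ?mulr_ge0// ltW//.
rewrite /qn iterS -/(qn n).
have lc : lip (clip (qn n)) by exact: lip_clip.
have c0 (x : R) : 0 <= clip (qn n) x by have /andP[] := clip01 (qn n) x.
have lb := lip_event_rate lc.
rewrite /F sub1B.
rewrite normrN conv_diff// [leRHS]mulrDl (le_trans (ler_normD _ _))// lerD//.
  have hA : s <= `|A| by apply: le_trans (ler_norm A); lra.
  apply: (@le_trans _ _ (mu * lambda * (t - s) * (s - 0))); last first.
    rewrite subr0 (mulrAC _ `|A|) ler_wpM2l// ?mulr_ge0// ?subr_ge0  //.
  apply: itg_norm_le => //.
    by apply: lipM => //; apply: lipB; exact: lip_rev.
  move=> y y0 ys; rewrite normrM -[leRHS]mul1r ler_pM//.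
    by have /andP[? ?] := clip01 (qn n) y; rewrite ger0_norm.
  have [lE lE' _] := C11_event_rate lc.
  rewrite -(C11_ftc (C11_event_rate lc)); [|lra|lra].
  rewrite (_ : t - s = (t - y) - (s - y)); last by ring.
  apply: itg_norm_le => //; first by lra.
  move=> x x1 x2; rewrite mulNr normrN normrM (ger0_norm (ltW l0)) mulrC.
  rewrite ler_wpM2r// // normrM -[leRHS]mul1r ler_pM//.
    by have /andP[? ?] := clip01 (qn n) x; rewrite ger0_norm.
  by rewrite ger0_norm ?event_rate_le// ltW// event_rate_gt0.
apply: itg_norm_le => //; first exact: lip_conv_int.
move=> y y1 y2; rewrite normrM -[leRHS]mul1r ler_pM//.
  by have /andP[? ?] := clip01 (qn n) y; rewrite ger0_norm.
by rewrite ger0_norm ?event_rate_le// ltW// event_rate_gt0.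
Qed.

Let fixed_point : exists q, [/\ lip q, forall t : R, t <= 0 -> q t = 1 &
  forall t, q t = F (clip q) t].
Proof.
have cv t : exists l : R, (fun n => qn n t) @ \oo --> l /\
    forall n, `|l - qn n t| <= 2 * expR (a * t) / 2 ^+ n.
  have [t0|t0] := leP 0 t.
    by apply: cvg_geometric_increments => [|n]; [exact: expR_ge0|exact: qn_incr].
  exists 1; split.
    rewrite (_ : (fun n => _) = fun=> 1); first exact: cvg_cst.
    by apply/funext => n; rewrite qn_nonpos// ltW.
  move=> n; rewrite qn_nonpos ?(ltW t0)// subrr normr0.
  by rewrite divr_ge0// ?mulr_ge0// ?expR_ge0.
have [q Hq] := choice cv; exists q.
have q_nonpos (t : R) : t <= 0 -> q t = 1.
  move=> t0; have [/cvg_lim H _] := Hq t.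
  rewrite -(H _)//; apply/cvg_lim => //.
  rewrite (_ : (fun n => _) = fun=> 1); first exact: cvg_cst.
  by apply/funext => n; rewrite qn_nonpos.
have lq : lip q.
  apply: lip_half => [t t0|A]; first by rewrite !q_nonpos.
  have [C [C0 HC]] := qn_lip_unif A; exists C; split=> // s t s0 st tA.
  apply: (@cvg_norm_le (fun n => qn n t - qn n s)).
    by apply: cvgB; [case: (Hq t)|case: (Hq s)].
  by apply: nearW => n; exact: HC.
split=> // t.
have [t0|t0] := leP 0 t; last first.
  by rewrite q_nonpos ?(ltW t0)// /F conv_nil ?subr0// ltW.
have H n : `|F (clip q) t - qn n.+1 t| <= 2 * expR (a * t) / 2 ^+ n.
  have := @F_contr (clip q) (clip (qn n)) (2 / 2 ^+ n).
  move=> /(_ (lip_clip lq) (lip_clip (lip_qn n)) (clip01 _) (clip01 _)).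
  have k0 : (0 : R) < 2 ^+ n by rewrite exprn_gt0.
  have h2 : (0 : R) <= 2 / 2 ^+ n by rewrite divr_ge0// ltW.
  move=> /(_ h2) /(_ _ t t0) h; apply: le_trans (h _) _.
    move=> s s0; apply: le_trans (clip_contr _ _) _.
    by have [_ /(_ n)] := Hq s; rewrite mulrAC.
  rewrite -mulrA mulrC mulrA (mulrC _ 2) -!mulrA ler_wpM2l//.
  have : 0 <= expR (a * t) / 2 ^+ n by rewrite divr_ge0 ?expR_ge0// ltW.
  by move: (expR (a * t) / 2 ^+ n) => x x0; lra.
have [cq _] := Hq t.
have F1 : (fun n => qn n.+1 t) @ \oo --> F (clip q) t.
  apply/cvgrPdist_le => e e0.
  have c0 : (fun n => 2 * expR (a * t) / 2 ^+ n) @ \oo --> (0 : R).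
    rewrite (_ : (fun n => _) = geometric (2 * expR (a * t)) 2^-1).
      by apply: cvg_geometric; rewrite ger0_norm; lra.
    by apply/funext => n; rewrite /= exprVn.
  move/cvgrPdist_le : c0 => /(_ e e0); apply: filterS => n.
  rewrite sub0r normrN => h; apply: le_trans (H n) _.
  exact: le_trans (ler_norm _) h.
have F2 : (fun n => qn n.+1 t) @ \oo --> q t.
  by have := cq; rewrite -(cvg_shiftS (fun n => qn n t)).
by rewrite -(cvg_lim _ F1)// -(cvg_lim _ F2).
Qed.

(* [q t] will be the probability that a vertex lives longer than [t]. *)
Lemma survival_exists : exists q, [/\ lip q, forall t : R, t <= 0 -> q t = 1,
  forall t, 0 < q t <= 1 & forall t, q t = 1 - conv q (event_rate q) t].
Proof.
have [q [lq qneg qF]] := fixed_point; set Q := clip q.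
have lQ : lip Q := lip_clip lq.
have Q0 t : 0 <= Q t by have /andP[] := clip01 q t.
have Q1 t : Q t <= 1 by have /andP[] := clip01 q t.
have b0 t := event_rate_gt0 Q t.
have q1 t : q t <= 1.
  rewrite qF /F gerBl; apply: itg_ge0 => y _ _.
  by rewrite mulr_ge0// ltW.
(* Since [event_rate Q] is nonincreasing, passing from [s] to [t] can only lower the part of the
   convolution over [[0, s]], and the part over [[s, t]] is at most [mu * itg Q s t]. *)
have qdec (s t : R) : 0 <= s -> s <= t -> q s - mu * itg Q s t <= q t.
  move=> s0 st; rewrite (qF t) (qF s) /F -/Q.
  have E := conv_diff lQ (lip_event_rate lQ) s0 st.
  have h1 : itg (fun y => Q y * (event_rate Q (t - y) - event_rate Q (s - y))) 0 s <= 0.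
    apply: (le_trans (le_itg_cst (M := 0) _ s0 _)); last by rewrite mul0r.
      by apply: lipM => //; apply: lipB; apply: lip_rev; exact: lip_event_rate.
    move=> y y0 ys; apply: mulr_ge0_le0 => //; rewrite subr_le0.
    by apply: event_rate_ninc => //; rewrite lerD2r.
  have h2 : itg (fun y => Q y * event_rate Q (t - y)) s t <= mu * itg Q s t.
    rewrite -itgZ//; apply: le_itg.
    - by apply: lip_conv_int => //; exact: lip_event_rate.
    - by apply: lipM => //; exact: lip_cst.
    - by move=> y _ _; rewrite mulrC ler_wpM2r// event_rate_le.
  exact: le_sub1_conv h1 h2 E.
have QE t : Q t = Num.max 0 (q t).
  by rewrite /Q /clip (min_idPr (q1 t)).
have Qq t : 0 < Q t -> q t = Q t.
  rewrite QE lt_max ltxx/= => h; rewrite max_r// ltW//.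
(* Where [Q] is positive the truncation is inactive, so positivity everywhere yields the equation
   without truncation. *)
suff Qpos t : 0 < Q t.
  exists Q; split=> [|t t0|t|t].
  - exact: lQ.
  - by rewrite -(qneg t t0); exact/esym/Qq.
  - by apply/andP; split; [exact: Qpos|exact: Q1].
  - by rewrite -[LHS](Qq t (Qpos t)); exact: qF.
have [t0|t0] := leP t 0; first by rewrite QE qneg// lt_max ltr01 orbT.
rewrite lt0r Q0 andbT; apply/eqP => Qt0.
(* If [Q t = 0] then [S s = itg Q s t] satisfies [- S' <= mu * S], hence it
   vanishes on [0, t], although [Q 0 = 1]. *)
have Qdec s : 0 <= s -> s <= t -> Q s <= mu * itg Q s t.
  move=> s0 st; have I0 : 0 <= mu * itg Q s t by rewrite mulr_ge0 ?itg_ge0 .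
  rewrite [leLHS]QE ge_max I0/=; have h := qdec s t s0 st.
  have qt0 : q t <= 0 by rewrite -Qt0 QE le_max lexx orbT.
  by rewrite -subr_le0 (le_trans h).
have id1 : C11 (fun s : R => s) (fun=> 1).
  split; [exact: lip_id|exact: lip_cst|move=> A; exists 0; split=> // x y _ _ _].
  by rewrite mulr1 subrr normr0 mul0r.
have HS : C11 (fun s => expR (mu * s) * (itg Q 0 t - itg Q 0 s))
   (fun s => mu * 1 * expR (mu * s) * (itg Q 0 t - itg Q 0 s) +
      expR (mu * s) * (0 - Q s)).
  apply: C11M; first by apply: C11_expR; apply: C11Z.
  by apply: C11B; [exact: C11_cst|exact: C11_itg].
have := C11_ndec HS (lexx 0) (ltW t0).
rewrite subrr mulr0 mulr0 expR0 mul1r (@itg_nil _ _ 0 0)// subr0.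
have -> : (itg Q 0 t <= 0) = false; last first.
  move=> H; suff K : forall x : R, 0 <= x -> x <= t ->
    0 <= mu * 1 * expR (mu * x) * (itg Q 0 t - itg Q 0 x) + expR (mu * x) * (0 - Q x).
    by have := H K.
  move=> s s0 st.
  rewrite mulr1 (mulrC mu (expR _)) -mulrA -mulrDr mulr_ge0 ?expR_ge0// sub0r subr_ge0.
  by rewrite (itg_split lQ s0 st) (addrC (itg Q 0 s)) addrK Qdec.
apply/negbTE; rewrite -ltNge.
have Q00 : Q 0 = 1 by rewrite QE qneg// max_r.
have := Qdec 0 (lexx _) (ltW t0); rewrite Q00 => h.
by rewrite -(pmulr_rgt0 _ m0) (lt_le_trans _ h).
Qed.

End Existence.

(** * Asymptotics of the renewal equation *)

Section Asymptotics.
Context {R : realType}.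
Implicit Types f g : R -> R.

Lemma C11_id1 : C11 (fun t : R => t) (fun=> 1).
Proof.
split; [exact: lip_id|exact: lip_cst|move=> A; exists 0; split=> // x y _ _ _].
by rewrite mulr1 subrr normr0 mul0r.
Qed.

Lemma lip_inv f : lip f -> (forall t, 1 <= f t) -> lip (fun t => (f t)^-1).
Proof.
move=> lf f1 A; have [C [C0 HC]] := lf A; exists C; split=> // a b Aa ab bA.
have fa0 : 0 < f a by rewrite (lt_le_trans ltr01).
have fb0 : 0 < f b by rewrite (lt_le_trans ltr01).
have -> : (f b)^-1 - (f a)^-1 = - ((f b - f a) / (f a * f b)).
  by field; rewrite !gt_eqF.
rewrite normrN normrM [X in _ * X]ger0_norm; last by rewrite invr_ge0 ltW// mulr_gt0.
rewrite -[leRHS]mulr1 ler_pM ?HC//; first by rewrite invr_ge0 ltW// mulr_gt0.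
by rewrite invf_le1 ?mulr_gt0// -[leLHS]mulr1 ler_pM.
Qed.

Lemma C11_inv f f' : C11 f f' -> (forall t, 1 <= f t) ->
  C11 (fun t => (f t)^-1) (fun t => - (f' t * ((f t)^-1 * (f t)^-1))).
Proof.
move=> [lf lf' H] f1; have li := lip_inv lf f1; split => //.
  by apply: lipN; apply: lipM => //; apply: lipM.
move=> A; have [C [C0 {}H]] := H A; have [D [D0 {}K]] := lf A.
exists (C + D * D); split=> [|a b a0 ab bA]; first by rewrite addr_ge0// mulr_ge0.
have {}H := H a b a0 ab bA; have {}K := K a b ltac:(lra) ab bA.
have fa0 : 0 < f a by rewrite (lt_le_trans ltr01).
have fb0 : 0 < f b by rewrite (lt_le_trans ltr01).
have -> : (f b)^-1 - (f a)^-1 - (b - a) * - (f' a * ((f a)^-1 * (f a)^-1)) =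
    - ((f b - f a - (b - a) * f' a) * ((f a)^-1 * (f a)^-1)) +
    (f b - f a) * (f b - f a) * ((f a)^-1 * (f a)^-1 * (f b)^-1).
  by field; rewrite !gt_eqF.
have ia0 : 0 <= (f a)^-1 by rewrite invr_ge0 ltW.
have ib0 : 0 <= (f b)^-1 by rewrite invr_ge0 ltW.
have ia1 : (f a)^-1 <= 1 by rewrite invf_le1.
have ib1 : (f b)^-1 <= 1 by rewrite invf_le1.
rewrite [leRHS]mulrDl (le_trans (ler_normD _ _))// lerD//.
  rewrite normrN normrM -[leRHS]mulr1 ler_pM// ger0_norm ?mulr_ge0//.
  by rewrite -[leRHS]mulr1 ler_pM.
rewrite normrM -[leRHS]mulr1 ler_pM//; last first.
  rewrite ger0_norm ?mulr_ge0// -[leRHS]mulr1 ler_pM ?mulr_ge0//.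
  by rewrite -[leRHS]mulr1 ler_pM.
by rewrite normrM expr2 mulrACA ler_pM.
Qed.

(** Monotonicity is left out on purpose: it is derived later from the probabilistic meaning of a
    function with these properties, and is a separate hypothesis in this section. *)
Definition survival (lambda mu : R) (q : R -> R) :=
  [/\ lip q, forall t : R, t <= 0 -> q t = 1, forall t, 0 < q t <= 1 &
      forall t, q t = 1 - conv q (event_rate lambda mu q) t].

Variables (lambda mu : R) (q : R -> R).
Hypotheses (l0 : 0 < lambda) (m0 : 0 < mu) (Hq : survival lambda mu q).
Hypothesis qmono : forall s t : R, s <= t -> q t <= q s.

Let lq : lip q. Proof. by case: Hq. Qed.
Let q0 t : 0 < q t. Proof. by case: Hq => _ _ /(_ t)/andP[]. Qed.
Let q0' t : 0 <= q t. Proof. exact: ltW. Qed.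
Let q1 t : q t <= 1. Proof. by case: Hq => _ _ /(_ t)/andP[]. Qed.
Let qE t : 1 - q t = conv q (event_rate lambda mu q) t.
Proof. by case: Hq => _ _ _ ->; rewrite opprB addrC subrK. Qed.

(** In probabilistic terms, [M t] is the mean of the lifetime truncated at [t], [lambda * M t] the
    mean number of children at age [t], and [U t] below the mean number of mu-events up to age
    [t]. *)
Let M t := itg q 0 t.
Let b := event_rate lambda mu q.
Let U t := itg b 0 t.
(* The probability that a vertex is never deleted. *)
Let c := inf (range q).

Let lb : lip b. Proof. exact: lip_event_rate. Qed.
Let b0 t : 0 < b t. Proof. exact: event_rate_gt0. Qed.
Let b0' t : 0 <= b t. Proof. exact: ltW. Qed.
Let bdec (s t : R) : s <= t -> b t <= b s.
Proof. by move=> st; apply: event_rate_ninc. Qed.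
Let CM : C11 M q. Proof. exact: C11_itg. Qed.
Let CU : C11 U b. Proof. exact: C11_itg. Qed.
Let lM : lip M. Proof. by case: CM. Qed.
Let lU : lip U. Proof. by case: CU. Qed.
Let Mmono (s t : R) : s <= t -> M s <= M t.
Proof. by move=> st; apply: itg_mono. Qed.
Let Umono (s t : R) : s <= t -> U s <= U t.
Proof. by move=> st; apply: itg_mono. Qed.
Let M0 t : 0 <= M t. Proof. exact: itg_ge0. Qed.
Let U0 t : 0 <= U t. Proof. exact: itg_ge0. Qed.

Let c_le t : c <= q t.
Proof. by apply: ge_inf; [exists 0 => _ [s _ <-]|exists t]. Qed.
Let c0 : 0 <= c.
Proof. by apply: lb_le_inf; [exists (q 0), 0|move=> _ [s _ <-]]. Qed.
Let c1 : c <= 1. Proof. exact: le_trans (c_le 0) (q1 0). Qed.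

Lemma survival_cvg : q t @[t --> +oo] --> c.
Proof.
have /cvgN : (fun t => - q t) t @[t --> +oo] --> sup (range (fun t => - q t)).
  apply: nondecreasing_cvgr; first by move=> s t st; rewrite lerN2 qmono.
  by exists 0 => _ [s _ <-]; rewrite oppr_le0.
have -> : - sup (range (fun t => - q t)) = c.
  rewrite /c /inf; congr (- sup _); apply/seteqP; split => x /=.
    by move=> [t _ <-]; exists (q t) => //; exists t.
  by move=> [_ [t _ <-] <-]; exists t.
by apply: cvg_trans; apply: near_eq_cvg; near=> t; rewrite /= opprK.
Unshelve. all: by end_near. Qed.

(** Here and in the next four bounds a factor of the convolution is frozen: [b (t - y)] is at least
    [b t], at most [b (t - A)] for [y <= A], and at most [mu] throughout; [q y] is at least [c], and
    at most [q A] for [y >= A]. *)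
Let event_lower (t : R) : 0 <= t -> b t * M t <= 1 - q t.
Proof.
move=> t0; rewrite qE -itgZ; last exact: lq.
apply: le_itg; [exact: (lipZ _ lq)|exact: (lip_conv_int _ lq lb)|].
move=> y y0 yt; rewrite mulrC; apply: (ler_wpM2l (q0' y)).
by apply: bdec; rewrite gerBl.
Qed.

Let conv_lower (t : R) : 0 <= t -> c * U t <= 1 - q t.
Proof.
move=> t0; rewrite qE /U -(itg_rev t0 lb) -itgZ; last exact: (lip_rev t lb).
apply: le_itg; [exact: (lipZ _ (lip_rev t lb))|exact: (lip_conv_int _ lq lb)|].
by move=> y y0 yt; apply: (ler_wpM2r (b0' _)).
Qed.

Let conv_split (A t : R) : 0 <= A -> A <= t ->
  1 - q t <= b (t - A) * M A + itg (fun y => q y * b (t - y)) A t.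
Proof.
move=> A0 At; rewrite qE /conv (itg_split (lip_conv_int _ lq lb) A0 At).
rewrite lerD2r -itgZ; last exact: lq.
apply: le_itg; [exact: (lip_conv_int _ lq lb)|exact: (lipZ _ lq)|].
move=> y y0 yA; rewrite mulrC; apply: (ler_wpM2r (q0' y)).
by apply: bdec; rewrite lerD2l lerN2.
Qed.

Let event_upper (A t : R) : 0 <= A -> A <= t ->
  1 - q t <= b (t - A) * M A + q A * U (t - A).
Proof.
move=> A0 At; apply: (le_trans (conv_split A0 At)); rewrite lerD2l.
rewrite /U -(itg_rev_tail A0 At lb) -itgZ; last exact: (lip_rev t lb).
apply: le_itg; [exact: (lip_conv_int _ lq lb)|exact: (lipZ _ (lip_rev t lb))|].
by move=> y yA yt; apply: (ler_wpM2r (b0' _)); exact: qmono.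
Qed.

Let event_upper' (A t : R) : 0 <= A -> A <= t ->
  1 - q t <= b (t - A) * M A + mu * (M t - M A).
Proof.
move=> A0 At; apply: (le_trans (conv_split A0 At)); rewrite lerD2l.
rewrite /M (itg_split lq A0 At) (addrC (itg q 0 A)) addrK -itgZ; last exact: lq.
apply: le_itg; [exact: (lip_conv_int _ lq lb)|exact: (lipZ _ lq)|].
move=> y yA yt; rewrite mulrC; apply: (ler_wpM2r (q0' y)).
exact: event_rate_le.
Qed.

(** Primitive of [1 = q + conv q b]: as [U 0 = 0], the derivative of [conv q U] is [conv q b]. *)
Let renewal (t : R) : 0 <= t -> t = M t + conv q U t.
Proof.
move=> t0; have := C11_ftc (C11D CM (C11_conv lq CU)) (lexx 0) t0.
have -> : M 0 = 0 by exact: itg_nil.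
have -> : U 0 = 0 by exact: itg_nil.
rewrite (conv_nil _ _ (lexx 0)) addr0 subr0 => <-.
rewrite -[LHS]subr0 -[LHS]mul1r -itg_cst//; apply: eq_itg => y _ _.
by rewrite mul0r add0r -qE addrC subrK.
Qed.

Let id_le (t : R) : 0 <= t -> t <= M t * (1 + U t).
Proof.
move=> t0; rewrite {1}(renewal t0) mulrDr mulr1 lerD2l mulrC -itgZ; last exact: lq.
apply: le_itg; [exact: (lip_conv_int _ lq lU)|exact: (lipZ _ lq)|].
move=> y y0 yt; rewrite mulrC; apply: (ler_wpM2r (q0' y)).
by apply: Umono; rewrite gerBl.
Qed.

Let bE t : b t = mu * expR (- (lambda * M t)). Proof. by []. Qed.

Let b_expR_le (t : R) : 0 <= t -> b t * M t = lambda^-1 * (mu * (lambda * M t * expR (- (lambda * M t)))).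
Proof. by move=> t0; rewrite bE; field; rewrite gt_eqF. Qed.

Lemma expRN_sq_le (x : R) : 0 < x -> expR (- x) <= 4 / x ^+ 2.
Proof.
move=> x0; have := expR_ge1Dx (x / 2) => h.
rewrite expRN -invf_div lef_pV2 ?posrE ?expR_gt0 ?divr_gt0 ?exprn_gt0//.
have -> : expR x = expR (x / 2) * expR (x / 2) by rewrite -expRD; congr expR; lra.
have -> : x ^+ 2 / 4 = (x / 2) * (x / 2) by field.
by apply: ler_pM; lra.
Qed.

Lemma xexpRN_le (x : R) : x * expR (- x) <= (expR 1)^-1.
Proof.
have := expR_ge1Dx (x - 1); rewrite addrC subrK expRD !expRN => h.
by rewrite -ler_pdivlMr ?invr_gt0 ?expR_gt0// invrK mulrC.
Qed.

Lemma xexpR_mono (x y : R) : 0 < x -> 0 < y -> x * expR x <= y * expR y -> x <= y.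
Proof.
move=> x0 y0; rewrite leNgt => h; rewrite leNgt; apply/negP => yx; move/negP : h.
apply; apply: (@lt_trans _ _ (x * expR y)).
  by rewrite ltr_pM2r ?expR_gt0.
by rewrite ltr_pM2l// ltr_expR.
Qed.

Lemma positive_root_exists (rho : R) : 0 < rho ->
  exists x, unique (positive_root rho) x.
Proof.
move=> r0.
have h0 : 0 <= rho^-1 by rewrite invr_ge0 ltW.
have [|||x _ xE] := @IVT R (fun x => x * expR x) 0 (rho^-1) (rho^-1) => //.
- apply: continuous_subspaceT => z; apply: cvgM; first exact: cvg_id.
  exact: continuous_expR.
- rewrite mul0r min_l ?max_r ?h0/= ?mulr_ge0 ?expR_ge0//.
  by rewrite -[leLHS]mulr1 ler_wpM2l// -expR0 ler_expR.
have x0 : 0 < x.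
  rewrite ltNge; apply/negP => x0; have : x * expR x <= 0 by rewrite mulr_le0_ge0 ?expR_ge0.
  by rewrite xE leNgt invr_gt0 r0.
exists x; split; first by split.
move=> y [y0 yE]; apply/le_anti/andP; split; apply: xexpR_mono => //; rewrite xE yE//.
Qed.

Section MeanFinite.
Variable B : R.
Hypothesis MB : forall t, M t <= B.

Let m := sup (range M).

Let M_le_m t : M t <= m.
Proof. by apply: ub_le_sup; [exists B => _ [s _ <-]|exists t]. Qed.

Let Mcvg : M t @[t --> +oo] --> m.
Proof.
apply: nondecreasing_cvgr; first by move=> s t; exact: Mmono.
by exists B => _ [s _ <-].
Qed.

(** The bound [c * t <= M t <= B] at [t = (B + 1) / e] gives [c <= e]. *)
Let ceq0 : c = 0.
Proof.
apply/le_anti; rewrite c0 andbT; apply/ler_addgt0Pr => e e0; rewrite add0r.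
have B0 : 0 <= B := le_trans (M0 0) (MB 0).
have : c * ((B + 1) / e) <= B.
  have h : 0 <= (B + 1) / e by rewrite divr_ge0 ?addr_ge0// ltW.
  apply: le_trans (MB ((B + 1) / e)); rewrite -[X in _ * X]subr0.
  exact: ge_itg_cst.
rewrite mulrA ler_pdivrMr// leNgt => /negP h; rewrite leNgt; apply/negP => ec; apply: h.
apply: (@lt_le_trans _ _ (e * (B + 1))); last by rewrite ler_wpM2r// ?addr_ge0// ltW.
by rewrite mulrDr mulr1 mulrC ltrDl.
Qed.

Let bcvg : b t @[t --> +oo] --> mu * expR (- (lambda * m)).
Proof.
apply: cvgM; first exact: cvg_cst.
have H : - (lambda * M t) @[t --> +oo] --> - (lambda * m).
  by apply: cvgN; apply: cvgM => //; exact: cvg_cst.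
exact: (cvg_comp _ _ H (@continuous_expR R _)).
Qed.

(** The bounds [b t * M t <= 1 - q t] and, by splitting [[0, t + t]] at [t],
    [1 - q t <= b t * M t + mu * (m - M t)] close up as [M t] tends to [m]. Hence the limit of
    [b t * M t] is 1. *)
Lemma mean_root : lambda * m * expR (- (lambda * m)) = lambda / mu.
Proof.
have qc : q t @[t --> +oo] --> (0 : R) by rewrite -ceq0; exact: survival_cvg.
suff H : mu * expR (- (lambda * m)) * m = 1.
  have mu0 : mu != 0 by rewrite gt_eqF.
  by rewrite -[RHS]mulr1 -H; field.
have pcvg : 1 - q t @[t --> +oo] --> (1 - 0 : R) by apply: cvgB => //; exact: cvg_cst.
have bM : b t * M t @[t --> +oo] --> mu * expR (- (lambda * m)) * m by exact: cvgM.
rewrite subr0 in pcvg; apply/le_anti/andP; split.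
  apply: (ler_cvg_to bM pcvg); near=> t.
  by apply: event_lower; near: t; apply: nbhs_pinfty_ge.
have bM2 : b t * M t + mu * (m - M t) @[t --> +oo] -->
    mu * expR (- (lambda * m)) * m + mu * (m - m).
  apply: cvgD => //; apply: cvgM; first exact: cvg_cst.
  by apply: cvgB => //; exact: cvg_cst.
rewrite subrr mulr0 addr0 in bM2; apply: (ler_cvg_to pcvg bM2); near=> t.
have t0 : 0 <= t by near: t; apply: nbhs_pinfty_ge.
have tt : t <= t + t by rewrite lerDl.
apply: (@le_trans _ _ (1 - q (t + t))); first by rewrite lerD2l lerN2 qmono.
apply: (le_trans (event_upper' t0 tt)); rewrite addrK lerD2l.
by apply: (ler_wpM2l (ltW m0)); rewrite lerD2r.
Unshelve. all: by end_near. Qed.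

Lemma mean_finite : exists m', [/\ M t @[t --> +oo] --> m', c = 0,
  forall t, M t <= m', forall B', (forall t, M t <= B') -> m' <= B' &
  lambda * m' * expR (- (lambda * m')) = lambda / mu].
Proof.
exists m; split => //; last exact: mean_root.
by move=> B' H; apply: ge_sup; [exists (M 0), 0|move=> _ [t _ <-]].
Qed.

End MeanFinite.

Let rho := lambda / mu.
Let rho0 : 0 < rho. Proof. exact: divr_gt0. Qed.

(** Otherwise [lambda * M] takes the value [s] at some [y] by continuity; there [b y * M y = 1],
    against [b y * M y <= 1 - q y < 1]. *)
Let M_lt_root (s : R) : s * expR (- s) = rho -> forall t, lambda * M t <= s.
Proof.
move=> sE t.
have s0 : 0 < s.
  rewrite ltNge; apply/negP => s0.
  have : s * expR (- s) <= 0 by rewrite mulr_le0_ge0 ?expR_ge0.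
  by rewrite sE leNgt rho0.
rewrite leNgt; apply/negP => st.
have t0 : 0 <= t.
  by rewrite leNgt; apply/negP => /ltW t0; move: st; rewrite /M itg_nil// mulr0 ltNge ltW.
have [|||y] := @IVT R (fun x => lambda * M x) 0 t s => //.
- apply: continuous_subspaceT; apply: lip_continuous; exact: (lipZ _ lM).
- rewrite /M itg_nil// mulr0 -/(M t).
  by rewrite min_l ?max_r ?(ltW s0) ?(ltW st)//= mulr_ge0 ?M0 ?ltW.
rewrite in_itv/= => /andP[y0 yt] yE.
have := event_lower y0; rewrite b_expR_le// yE sE /rho.
have -> : lambda^-1 * (mu * (lambda / mu)) = 1 by field; rewrite !gt_eqF.
by rewrite lerBrDr gerDl leNgt q0.
Qed.

(** The number [lambda * m] is a root and, being the supremum of the [lambda * M t], is at most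
    every other root; one root lies in [[0, 1]] because [x * exp(- x)] reaches [1/e] at 1. *)
Lemma ergodic_survival : rho <= (expR 1)^-1 ->
  exists r, [/\ smallest_root rho r, r <= 1, M t @[t --> +oo] --> r / lambda,
    forall t, M t <= r / lambda & c = 0].
Proof.
move=> rho_le.
have [|||s sI sE] := @IVT R (fun x => x * expR (- x)) 0 1 rho => //.
- apply: continuous_subspaceT => z; apply: cvgM; first exact: cvg_id.
  apply: continuous_comp; first by apply: continuousN; exact: cvg_id.
  exact: continuous_expR.
- rewrite mul0r mul1r expRN min_l ?max_r ?invr_ge0 ?expR_ge0//.
  by rewrite (ltW rho0).
have B t : M t <= s / lambda by rewrite ler_pdivlMr// mulrC M_lt_root.
have [m [Mm cz Mm' msup mE]] := mean_finite B.
have E : lambda * m / lambda = m by rewrite mulrAC mulfV ?mul1r// gt_eqF.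
have small s' : s' * expR (- s') = rho -> lambda * m <= s'.
  move=> s'E; rewrite mulrC -ler_pdivlMr//; apply: msup => t.
  by rewrite ler_pdivlMr// mulrC M_lt_root.
exists (lambda * m); rewrite E; split=> //.
by apply: le_trans (small s sE) _; move: sI; rewrite in_itv/= => /andP[].
Qed.

Let bM_le t : 0 < M t -> b t * M t <= 4 * mu / lambda ^+ 2 / M t.
Proof.
move=> Mt; have lM0 : 0 < lambda * M t by exact: mulr_gt0.
rewrite bE -mulrA; apply: (@le_trans _ _ (mu * (4 / (lambda * M t) ^+ 2 * M t))).
  by apply: (ler_wpM2l (ltW m0)); apply: (ler_wpM2r (ltW Mt)); exact: expRN_sq_le.
by rewrite le_eqVlt; apply/orP; left; apply/eqP; field; rewrite !gt_eqF.
Qed.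

Section MeanInfinite.
Hypothesis Minf : forall B, exists2 t, 0 <= t & B <= M t.

Let Mcvg : M t @[t --> +oo] --> +oo.
Proof.
apply/cvgryPge => B; have [t t0 Bt] := Minf B.
near=> s; apply: (le_trans Bt); apply: Mmono.
by near: s; apply: nbhs_pinfty_ge; rewrite num_real.
Unshelve. all: by end_near. Qed.

Lemma event_mean_cvg0 : b t * M t @[t --> +oo] --> (0 : R).
Proof.
have H : 4 * mu / lambda ^+ 2 * (M t)^-1 @[t --> +oo] --> 4 * mu / lambda ^+ 2 * 0.
  apply: cvgM; first exact: cvg_cst.
  by apply/gtr0_cvgV0 => //; near=> t; near: t; move/cvgryPgt : Mcvg; exact.
rewrite mulr0 in H.
apply: (squeeze_cvgr _ (cvg_cst 0) H); near=> t.
rewrite mulr_ge0//=; apply: bM_le.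
by near: t; move/cvgryPgt : Mcvg; exact.
Unshelve. all: by end_near. Qed.

(* With [V = 1 + U], the bounds [t <= M t * V t] and
   [expR (- x) <= 4 / x ^+ 2] give [V' <= K V^2 / (1 + t)^2], so that
   [1 / V - K / (1 + t)] is nondecreasing. *)
Let U_bounded : exists B, forall t, U t <= B.
Proof.
(* The factor 16 combines the 4 of [expR (- x) <= 4 / x ^+ 2] with the square of
   [(1 + t) / V t <= 2 * M t], valid for [t >= 1]. *)
pose K := 16 * mu / lambda ^+ 2.
have K0 : 0 < K by rewrite !divr_gt0 ?mulr_gt0 ?exprn_gt0.
have CV := C11D (C11_cst 1) CU.
have V1 t : 1 <= 1 + U t by rewrite lerDl.
(* This is [1 + t], in a form that stays at least 1 for negative [t], as [C11_inv] demands. *)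
have CX := C11D (C11_cst 1) (C11_itg (lip_cst (1 : R))).
have X1 (t : R) : 1 <= 1 + itg (fun=> 1 : R) 0 t.
  by rewrite lerDl itg_ge0.
have Cphi := C11B (C11_inv CV V1) (C11Z K (C11_inv CX X1)).
have dphi t : 1 <= t -> 0 <= - ((0 + b t) * ((1 + U t)^-1 * (1 + U t)^-1)) -
   K * - ((0 + 1) * ((1 + itg (fun=> 1) 0 t)^-1 * (1 + itg (fun=> 1) 0 t)^-1)).
  move=> t1; have t0 : 0 <= t by exact: le_trans t1.
  rewrite itg_cst// subr0 !add0r !mul1r mulrN opprK addrC subr_ge0.
  have Mt : 0 < M t.
    have := id_le t0; have := M0 t; rewrite le_eqVlt => /predU1P[<-|//].
    by rewrite mul0r leNgt (lt_le_trans ltr01 t1).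
  have h1 := id_le t0.
  have V0 : 0 < 1 + U t by exact: lt_le_trans (V1 t).
  have lM0 : 0 < lambda * M t by exact: mulr_gt0.
  have h2 : b t <= mu * (4 / (lambda * M t) ^+ 2).
    by rewrite bE; apply: (ler_wpM2l (ltW m0)); exact: expRN_sq_le.
  have h3 : (1 + t) / (1 + U t) <= 2 * M t.
    rewrite ler_pdivrMr//; move: h1; move: (M t * _) (mulrA 2 (M t) (1 + U t)) => x <- h1.
    by apply: (@le_trans _ _ (2 * t)); [rewrite mulr_natl mulr2n lerD2r|rewrite ler_wpM2l].
  have T0 : 0 < 1 + t by rewrite addr_gt0// (lt_le_trans ltr01).
  apply: (@le_trans _ _ (mu * (4 / (lambda * M t) ^+ 2) * ((1 + U t)^-1 * (1 + U t)^-1))).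
    by apply: ler_wpM2r h2; rewrite mulr_ge0// invr_ge0 ltW.
  have -> : K * ((1 + t)^-1 * (1 + t)^-1) =
      mu * (4 / (lambda * M t) ^+ 2) * ((2 * M t / (1 + t)) * (2 * M t / (1 + t))).
    by rewrite /K; field; rewrite !gt_eqF.
  apply: ler_wpM2l; first by rewrite mulr_ge0 ?(ltW m0)// divr_ge0// exprn_ge0// ltW.
  have h4 : (1 + U t)^-1 <= 2 * M t / (1 + t).
    by rewrite ler_pdivlMr// mulrC.
  by apply: ler_pM => //; rewrite invr_ge0 ltW.
(* The monotone quantity bounds [U] only once it is positive. After such an [A] the slope of [U] is
   at most [(4 * K)^-1], which gives [1 + U T <= T / (2 * K)] at the [T] below, hence positivity at
   [T]. *)
have [A [A0 bA]] : exists A, 0 <= A /\ b A <= (4 * K)^-1.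
  have K4 : 0 < (4 * K)^-1 by rewrite invr_gt0 mulr_gt0.
  suff : \forall t \near +oo, 0 <= t /\ b t <= (4 * K)^-1 by move/filter_ex.
  near=> t; split; first by near: t; apply: nbhs_pinfty_ge; rewrite num_real.
  have M1 : 1 <= M t by near: t; move/cvgryPge : Mcvg; exact.
  have bM : `|0 - b t * M t| <= (4 * K)^-1.
    by near: t; move/cvgrPdist_le : event_mean_cvg0; exact.
  rewrite sub0r normrN (ger0_norm (mulr_ge0 (b0' t) (M0 t))) in bM.
  by apply: le_trans bM; rewrite -[leLHS]mulr1; exact: (ler_wpM2l (b0' t)).
pose T := 1 + 4 * K * (1 + mu * A) + A.
have K4 : 0 < 4 * K by rewrite mulr_gt0.
have mA : 0 <= mu * A by rewrite mulr_ge0// ltW.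
have hT : 0 <= 4 * K * (1 + mu * A) by rewrite mulr_ge0 ?(ltW K4)// addr_ge0.
have T1 : 1 <= T by rewrite /T -addrA lerDl addr_ge0.
have AT : A <= T by rewrite /T lerDr addr_ge0.
have T0 : 0 < T by exact: lt_le_trans ltr01 T1.
have VT : 1 + U T <= T / (2 * K).
  have U1 : U T <= mu * A + (4 * K)^-1 * (T - A).
    rewrite /U (itg_split lb A0 AT) lerD//.
      rewrite -[X in mu * X]subr0; by apply: (le_itg_cst lb A0) => x _ _; exact: event_rate_le.
    by apply: (le_itg_cst lb AT) => x Ax _; exact: (le_trans (bdec Ax) bA).
  have h : 1 + mu * A <= (4 * K)^-1 * T.
    by rewrite (mulrC (4 * K)^-1) ler_pdivlMr// (mulrC (1 + _)) /T addrAC lerDr addr_ge0.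
  have -> : T / (2 * K) = (4 * K)^-1 * T + (4 * K)^-1 * T.
    by field; rewrite gt_eqF.
  have h2 : (4 * K)^-1 * (T - A) <= (4 * K)^-1 * T.
    by rewrite ler_pM2l ?invr_gt0// gerBl.
  apply: (le_trans (lerD (lexx 1) U1)); rewrite addrA; exact: lerD.
clearbody T K.
pose d := (1 + U T)^-1 - K * (1 + itg (fun=> 1) 0 T)^-1.
have d0 : 0 < d.
  rewrite /d itg_cst ?(ltW T0)// mul1r subr0 subr_gt0.
  have V0 : 0 < 1 + U T by exact: lt_le_trans (V1 T).
  apply: (@lt_le_trans _ _ (T / (2 * K))^-1); last by rewrite lef_pV2// posrE divr_gt0// mulr_gt0.
  rewrite invf_div; apply: (@lt_le_trans _ _ (K / T)).
    by rewrite ltr_pM2l// ltf_pV2 ?posrE ?addr_gt0// ltrDr.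
  by rewrite ler_pM2r ?invr_gt0// mulr_natl mulr2n lerDr ltW.
have Vd t : T <= t -> U t <= d^-1.
  move=> Tt; have V0 : 0 < 1 + U t by exact: lt_le_trans (V1 t).
  apply: (@le_trans _ _ (1 + U t)); first by rewrite lerDr.
  rewrite -[leLHS]invrK lef_pV2 ?posrE ?invr_gt0//.
  have := @C11_ndec _ _ _ T t Cphi (ltW T0) Tt => h.
  apply: (@le_trans _ _ ((1 + U t)^-1 - K * (1 + itg (fun=> 1) 0 t)^-1)).
    apply: h => x Tx _; apply: dphi; exact: le_trans Tx.
  by rewrite gerBl mulr_ge0 ?(ltW K0)// invr_ge0 (le_trans ler01 (X1 t)).
exists d^-1 => t; have [/Vd//|/ltW tT] := leP T t.
exact: (le_trans (Umono tT) (Vd T (lexx T))).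
Unshelve. all: by end_near. Qed.

(** If [q] tended to 0, the right-hand side of [1 - q (t + t) <= b t * M t + q t * U t] would tend
    to 0 as well, [U] being bounded. *)
Lemma infinite_mean_survives : 0 < c.
Proof.
rewrite lt0r c0 andbT; apply/eqP => cz.
have qc : q t @[t --> +oo] --> (0 : R) by rewrite -cz; exact: survival_cvg.
have [B UB] := U_bounded.
have B0 : 0 <= B := le_trans (U0 0) (UB 0).
have lhs : 1 - q t @[t --> +oo] --> (1 - 0 : R) by apply: cvgB => //; exact: cvg_cst.
have rhs : b t * M t + q t * B @[t --> +oo] --> (0 + 0 * B : R).
  apply: cvgD; first exact: event_mean_cvg0.
  by apply: cvgM; [exact: qc|exact: cvg_cst].
rewrite subr0 in lhs; rewrite mul0r addr0 in rhs.
suff : (1 : R) <= 0 by rewrite leNgt ltr01.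
apply: (ler_cvg_to lhs rhs); near=> t.
have t0 : 0 <= t by near: t; apply: nbhs_pinfty_ge; rewrite num_real.
have tt : t <= t + t by rewrite lerDl.
apply: (@le_trans _ _ (1 - q (t + t))); first by rewrite lerD2l lerN2 qmono.
apply: (le_trans (event_upper t0 tt)); rewrite addrK lerD2l.
exact: (ler_wpM2l (q0' t)).
Unshelve. all: by end_near. Qed.

End MeanInfinite.

(** A bounded [M] would make [rho] a value of [x * exp(- x)], whose maximum is [1/e]. *)
Lemma transient_survival : (expR 1)^-1 < rho -> 0 < c.
Proof.
move=> rho_gt; have [[B MB]|H] := pselect (exists B, forall t, M t <= B).
  have [m [_ _ _ _ mE]] := mean_finite MB.
  by move: rho_gt; rewrite /rho -mE ltNge xexpRN_le.
apply: infinite_mean_survives => B; apply: contrapT => K; apply: H; exists B => t.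
rewrite leNgt; apply/negP => Bt; apply: K; exists (Num.max 0 t); first by rewrite le_max lexx.
by apply: le_trans (ltW Bt) _; apply: Mmono; rewrite le_max lexx orbT.
Qed.

Section Defective.
Hypothesis cpos : 0 < c.

Let Mlow t : 0 <= t -> c * t <= M t.
Proof.
by move=> t0; rewrite -[X in _ * X]subr0; apply: ge_itg_cst.
Qed.

Let Minf B : exists2 t, 0 <= t & B <= M t.
Proof.
exists (`|B| / c); first by rewrite divr_ge0// ltW.
apply: le_trans (Mlow _); last by rewrite divr_ge0// ltW.
by rewrite mulrC divfK ?gt_eqF// ler_norm.
Qed.

Let U_le t : U t <= (1 - c) / c.
Proof.
have [t0|/ltW t0] := leP 0 t; last first.
  by rewrite /U itg_nil// divr_ge0// subr_ge0.
rewrite ler_pdivlMr// mulrC; apply: (le_trans (conv_lower t0)).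
by rewrite lerD2l lerN2.
Qed.

(** The mean number of mu-events when each of them is followed by another with probability [1 - c].
    The missing inequality [1 - c <= c * sup U] is the limit of [event_upper] at [t] and [t + t],
    where [b t * M t] vanishes. *)
Let Ucvg : U t @[t --> +oo] --> (1 - c) / c.
Proof.
have Us : U t @[t --> +oo] --> sup (range U).
  apply: nondecreasing_cvgr; first by move=> s t; exact: Umono.
  by exists ((1 - c) / c) => _ [s _ <-].
suff -> : (1 - c) / c = sup (range U) by [].
apply/le_anti/andP; split; last first.
  by apply: ge_sup; [exists (U 0), 0|move=> _ [t _ <-]].
have lhs : 1 - q t @[t --> +oo] --> 1 - c.
  by apply: cvgB; [exact: cvg_cst|exact: survival_cvg].
have rhs : b t * M t + q t * sup (range U) @[t --> +oo] --> 0 + c * sup (range U).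
  apply: cvgD; first exact: (event_mean_cvg0 Minf).
  by apply: cvgM; [exact: survival_cvg|exact: cvg_cst].
rewrite ler_pdivrMr// mulrC -[leRHS]add0r.
apply: (ler_cvg_to lhs rhs); near=> t.
have t0 : 0 <= t by near: t; apply: nbhs_pinfty_ge; rewrite num_real.
have tt : t <= t + t by rewrite lerDl.
apply: (@le_trans _ _ (1 - q (t + t))); first by rewrite lerD2l lerN2 qmono.
apply: (le_trans (event_upper t0 tt)); rewrite addrK lerD2l.
apply: (ler_wpM2l (q0' t)); apply: ub_le_sup; last by exists t.
by exists ((1 - c) / c) => _ [s _ <-].
Unshelve. all: by end_near. Qed.

Let lc0 : 0 < lambda * c. Proof. exact: mulr_gt0. Qed.

Let C11_exp_rate (K : R) : C11 (fun t : R => - (K / (lambda * c)) * expR (- (lambda * c) * t))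
   (fun t => K * expR (- (lambda * c) * t)).
Proof.
have := C11Z (- (K / (lambda * c))) (C11_expR (C11Z (- (lambda * c)) C11_id1)).
move/C11_ext; apply=> // t; rewrite mulr1; field; rewrite !gt_eqF//.
Qed.

(** From [M t >= c * t] follows [b t <= mu * exp(- lambda * c * t)], whose integral
    [mu / (lambda * c)] thus bounds [(1 - c) / c]. *)
Lemma defect_upper : rho * (1 - c) <= 1.
Proof.
have H t : 0 <= t -> U t <= mu / (lambda * c).
  move=> t0; have h := C11_derivative_le CU (C11_exp_rate mu) (lexx 0) t0.
  apply: (@le_trans _ _ (U t - U 0)); first by rewrite /U (@itg_nil _ _ 0 0)// subr0.
  apply: (le_trans (h _)) => [x x0 xt|].
    rewrite bE; apply: (ler_wpM2l (ltW m0)); rewrite ler_expR mulNr lerN2 -mulrA.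
    by apply: (ler_wpM2l (ltW l0)); exact: Mlow.
  rewrite mulr0 expR0 mulr1 opprK mulNr addrC gerBl.
  by rewrite mulr_ge0 ?expR_ge0// divr_ge0// ltW.
have : (1 - c) / c <= mu / (lambda * c).
  apply: (ler_cvg_to Ucvg (cvg_cst _)); near=> t; apply: H.
  by near: t; apply: nbhs_pinfty_ge; rewrite num_real.
rewrite invfM mulrA ler_pM2r ?invr_gt0// /rho ler_pdivlMr// => h.
by rewrite mulrAC ler_pdivrMr// mul1r mulrC.
Unshelve. all: by end_near. Qed.

(** As [b' = - lambda * q * b] and [q >= c], the function [U + b / (lambda * c)] is
    nonincreasing. *)
Let U_tail t : 0 <= t -> (1 - c) / c - U t <= b t / (lambda * c).
Proof.
move=> t0; rewrite lerBlDl.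
have Cg := C11N (C11D CU (C11Z (lambda * c)^-1 (C11_event_rate lambda mu lq))).
apply: (ler_cvg_to Ucvg (cvg_cst _)); near=> s.
have ts : t <= s by near: s; apply: nbhs_pinfty_ge; rewrite num_real.
have := @C11_ndec _ _ _ t s Cg t0 ts; rewrite lerN2 -/b => h.
apply: (@le_trans _ _ (U s + (lambda * c)^-1 * b s)).
  by rewrite lerDl mulr_ge0// invr_ge0 ltW.
rewrite (mulrC (b t)); apply: h => x tx xs.
rewrite -/b oppr_ge0 (_ : _ + _ = b x * (1 - q x / c)).
  by rewrite mulr_ge0_le0// subr_le0 ler_pdivlMr// mul1r.
by field; rewrite !gt_eqF.
Unshelve. all: by end_near. Qed.

(** Inserting [U_tail] into [t = M t + conv q U t] leaves the convolution of [q] and [b], that is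
    [1 - q t], which is at most [1 - c]; it remains to solve for [M t]. *)
Let M_upper t : 0 <= t -> lambda * M t <= lambda * c * t + (1 - c).
Proof.
move=> t0; have := renewal t0.
have h : (1 - c) / c * M t - (lambda * c)^-1 * (1 - q t) <= conv q U t.
  rewrite qE -/b /M -itgZ; last exact: lq.
  rewrite -itgZ; last exact: (lip_conv_int _ lq lb).
  rewrite -itgB; [|exact: (lipZ _ lq)|exact: (lipZ _ (lip_conv_int _ lq lb))].
  apply: le_itg; [|exact: (lip_conv_int _ lq lU)|].
    by apply: lipB; [exact: (lipZ _ lq)|exact: (lipZ _ (lip_conv_int _ lq lb))].
  move=> y y0 yt; rewrite (mulrC ((1 - c) / c)) (mulrCA _ (q y)) -mulrBr; apply: (ler_wpM2l (q0' y)).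
  by rewrite lerBlDr -lerBlDl [leRHS]mulrC; apply: U_tail; rewrite subr_ge0.
move=> tE; have : (lambda * c) * (M t + ((1 - c) / c * M t - (lambda * c)^-1 * (1 - q t))) <=
    lambda * c * t by rewrite ler_pM2l// [leRHS]tE lerD2l.
have -> : lambda * c * (M t + ((1 - c) / c * M t - (lambda * c)^-1 * (1 - q t))) =
    lambda * M t - (1 - q t) by field; rewrite !gt_eqF.
rewrite lerBlDr => /le_trans; apply; rewrite lerD2l lerD2l lerN2; exact: c_le.
Qed.

(** Mirror image of [defect_upper]: now [b t >= K * exp(- lambda * c * t)], so that
    [K / (lambda * c) <= (1 - c) / c]. *)
Lemma defect_lower : expR (- (1 - c)) <= rho * (1 - c).
Proof.
pose K := mu * expR (- (1 - c)).
have H t : 0 <= t -> K / (lambda * c) - K / (lambda * c) * expR (- (lambda * c) * t) <= U t.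
  move=> t0; have h := C11_derivative_le (C11_exp_rate K) CU (lexx 0) t0.
  apply: (@le_trans _ _ (U t - U 0)); last by rewrite /U (@itg_nil _ _ 0 0)// subr0.
  apply: (le_trans _ (h _)) => [|x x0 xt].
    by rewrite mulr0 expR0 mulr1 opprK !mulNr [leRHS]addrC.
  rewrite bE /K -mulrA -expRD; apply: (ler_wpM2l (ltW m0)); rewrite ler_expR mulNr -opprD lerN2.
  by rewrite addrC; exact: M_upper.
have lhs : K / (lambda * c) - K / (lambda * c) * expR (- (lambda * c) * t) @[t --> +oo] -->
    K / (lambda * c) - K / (lambda * c) * 0.
  apply: cvgB; first exact: cvg_cst.
  apply: cvgM; first exact: cvg_cst.
  have F : lambda * c * t @[t --> +oo] --> +oo.
    apply/cvgryPge => A; near=> t.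
    have : A / (lambda * c) <= t by near: t; apply: nbhs_pinfty_ge; rewrite num_real.
    by rewrite ler_pdivrMr// (mulrC t).
  have := cvg_comp _ _ F (@cvgr_expR R); apply: cvg_trans; apply: near_eq_cvg.
  by near=> t; rewrite /= mulNr.
have : K / (lambda * c) <= (1 - c) / c.
  rewrite mulr0 subr0 in lhs; apply: (ler_cvg_to lhs Ucvg); near=> t; apply: H.
  by near: t; apply: nbhs_pinfty_ge; rewrite num_real.
rewrite invfM mulrA ler_pM2r ?invr_gt0// /rho ler_pdivrMr// => h.
by rewrite mulrAC ler_pdivlMr// mulrC mulrC (mulrC _ lambda) (mulrC _ mu) in h *.
Unshelve. all: by end_near. Qed.

End Defective.

(** With [l = 1 - c], [defect_lower] reads [l * exp l >= rho^-1 = x * exp x]; moreover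
    [exp(- l) >= 1 - l >= 1 - rho^-1] gives a rate for [rho * l --> 1]. The bound by [x] is
    restricted to [rho >= 1/e] because [x > 1] for smaller [rho]. *)
Lemma defect_bounds : [/\ (forall x, positive_root rho x -> (expR 1)^-1 <= rho -> x <= 1 - c),
  1 - c <= Num.min 1 rho^-1 & 1 < rho -> `|rho * (1 - c) - 1| <= rho^-1].
Proof.
have [cz|cpos] := leP c 0.
  have {cz}cz : c = 0 by apply/le_anti; rewrite cz c0.
  have rho_le : rho <= (expR 1)^-1.
    by rewrite leNgt; apply/negP => /transient_survival; rewrite cz ltxx.
  have e1 : (expR 1)^-1 <= 1 :> R by rewrite invf_le1 ?expR_gt0// -[leLHS]expR0 ler_expR.
  have rho1 : rho <= 1 := le_trans rho_le e1.
  rewrite cz subr0; split.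
  - move=> x [x0 xE] erho; apply: xexpR_mono => //; rewrite xE mul1r.
    by rewrite -[leRHS]invrK lef_pV2// posrE invr_gt0 expR_gt0.
  - by rewrite le_min lexx/= invf_ge1.
  - by rewrite ltNge rho1.
have up := defect_upper cpos; have lo := defect_lower cpos.
have l1 : 0 < 1 - c.
  by rewrite -(pmulr_rgt0 _ rho0); apply: lt_le_trans lo; exact: expR_gt0.
have up' : 1 - c <= rho^-1 by rewrite -[leRHS]mul1r ler_pdivlMr// mulrC.
split.
- move=> x [x0 xE] _; apply: xexpR_mono => //; rewrite xE -[leLHS]mul1r ler_pdivrMr//.
  by rewrite mulrAC -ler_pdivrMr ?expR_gt0// mul1r -expRN mulrC.
- by rewrite le_min up' andbT gerBl.
- move=> rho1; rewrite distrC ger0_norm ?subr_ge0//.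
  rewrite lerBlDl -lerBlDr; apply: le_trans lo.
  apply: le_trans (expR_ge1Dx _); rewrite lerD2l lerN2; exact: up'.
Qed.

End Asymptotics.

(** * Trees *)

Section Trees.
Local Open Scope fset_scope.
Implicit Types (T : tree) (u v w c : vertex).

Lemma root_in_tree T : [::] \in vertices T.
Proof. by case: T => A /= /andP[]. Qed.

Lemma behead_in_tree T v : v \in vertices T -> behead v \in vertices T.
Proof. by case: T => A /= /andP[_ /allP]; apply. Qed.

Lemma parent_in_tree T i v : i :: v \in vertices T -> v \in vertices T.
Proof. by move/behead_in_tree. Qed.

(** As vertices are read from the bottom up, [suffix c v] means that [c] is [v] or an ancestor of
    [v]. *)
Lemma suffix_in_tree T c v : suffix c v -> v \in vertices T -> c \in vertices T.
Proof.
by move=> /suffixP[s ->]; elim: s => [//|i s IH] /parent_in_tree.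
Qed.

Lemma is_childP v u : reflect (exists i, u = i :: v) (is_child v u).
Proof.
case: u => [|i u] /=; first by constructor => -[].
by apply: (iffP eqP) => [->|[j [_ ->]]//]; exists i.
Qed.

Definition children T v := [seq u <- enum_fset T | is_child v u].

Lemma mem_children T v c : (c \in children T v) = is_child v c && (c \in vertices T).
Proof. by rewrite mem_filter. Qed.

Lemma uniq_children T v : uniq (children T v).
Proof. by rewrite filter_uniq// fset_uniq. Qed.

Lemma n_childrenE T v : n_children T v = size (children T v).
Proof. by rewrite /n_children size_filter. Qed.

Lemma is_leafP T v : reflect (v \in vertices T /\ forall i, i :: v \notin vertices T)
  (is_leaf T v).
Proof.
apply: (iffP andP) => -[vT H]; split => //.
  move=> i; apply/negP => ivT; move: H; rewrite n_childrenE size_eq0 => /eqP H.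
  have : i :: v \in children T v by rewrite mem_children /= eqxx.
  by rewrite H.
rewrite n_childrenE size_eq0; case E : (children T v) => [//|c s].
have : c \in children T v by rewrite E mem_head.
by rewrite mem_children => /andP[/is_childP[i ->]]; rewrite (negbTE (H i)).
Qed.

Lemma newborn_child T v : is_child v (newborn T v).
Proof. by rewrite /newborn /= eqxx. Qed.

Lemma newbornP T v : exists j, [/\ newborn T v = j :: v, j :: v \notin vertices T &
  forall i, (i < j)%N -> i :: v \in vertices T].
Proof.
pose P i := (i :: v) \notin vertices T; set n := #|` vertices T|.+1.
have hP : has P (iota 0 n).
  apply: contraT => /hasPn H.
  have : (size (map (fun i => i :: v) (iota 0 n)) <= size (enum_fset T))%N.
    apply: uniq_leq_size.
      by rewrite map_inj_uniq ?iota_uniq// => i j [].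
    by move=> _ /mapP[i /H iT ->]; move: iT; rewrite /P negbK.
  by rewrite size_map size_iota /n cardfE ltnn.
have jn : (find P (iota 0 n) < n)%N by rewrite -[X in (_ < X)%N](size_iota 0 n) -has_find.
exists (find P (iota 0 n)); split => //.
  by have := nth_find 0%N hP; rewrite nth_iota.
move=> i ij; have := before_find 0%N ij; rewrite nth_iota ?(ltn_trans ij)// add0n.
by move/negbFE.
Qed.

Lemma newborn_notin T v : newborn T v \notin vertices T.
Proof. by have [j [->]] := newbornP T v. Qed.

Lemma is_tree_add T v : v \in vertices T -> is_tree (newborn T v |` vertices T).
Proof.
move=> vT; rewrite /is_tree in_fset1U root_in_tree orbT /=; apply/allP => u.
rewrite in_fset1U => /predU1P[->|uT]; rewrite in_fset1U; apply/orP; right => //.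
exact: behead_in_tree.
Qed.

Lemma is_tree_rem T v : v != [::] -> is_leaf T v -> is_tree (vertices T `\ v).
Proof.
move=> v0 /is_leafP[vT H]; rewrite /is_tree in_fsetD1 eq_sym v0 root_in_tree /=.
apply/allP => u; rewrite in_fsetD1 => /andP[uv uT]; rewrite in_fsetD1 behead_in_tree// andbT.
apply/eqP => bu; case: u uv uT bu => [|i u] uv uT /= bu.
  by rewrite bu eqxx in v0.
by move: uT; rewrite bu (negbTE (H i)).
Qed.

(** Both moves are total functions: [insubd] falls back on [T] when the new set of vertices is not a
    tree. *)
Definition add_child T v : tree := insubd T (newborn T v |` vertices T).
Definition remove T v : tree := insubd T (vertices T `\ v).

Lemma add_childE T v : v \in vertices T ->
  vertices (add_child T v) = newborn T v |` vertices T.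
Proof. by move=> vT; rewrite /add_child val_insubd is_tree_add. Qed.

Lemma removeE T v : v != [::] -> is_leaf T v -> vertices (remove T v) = vertices T `\ v.
Proof. by move=> v0 lv; rewrite /remove val_insubd is_tree_rem. Qed.

Lemma in_add_child T v u : v \in vertices T ->
  (u \in vertices (add_child T v)) = (u == newborn T v) || (u \in vertices T).
Proof. by move=> /add_childE ->; rewrite in_fset1U. Qed.

Lemma in_remove T v u : v != [::] -> is_leaf T v ->
  (u \in vertices (remove T v)) = (u != v) && (u \in vertices T).
Proof. by move=> v0 lv; rewrite removeE// in_fsetD1. Qed.

Lemma tree_eqP T T' : vertices T = vertices T' -> T = T'.
Proof. exact: val_inj. Qed.

Lemma card_add_child T v : v \in vertices T ->
  #|` vertices (add_child T v)| = #|` vertices T|.+1.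
Proof. by move=> vT; rewrite add_childE// cardfsU1 newborn_notin. Qed.

Lemma card_remove T v : (#|` vertices (remove T v)| <= #|` vertices T|)%N.
Proof.
rewrite /remove val_insubd; case: ifP => // _; exact: fsubset_leq_card (fsubsetDl _ _).
Qed.

Lemma leaf_newborn T v : v \in vertices T -> is_leaf (add_child T v) (newborn T v).
Proof.
move=> vT; apply/is_leafP; split; first by rewrite in_add_child// eqxx.
move=> i; rewrite in_add_child// negb_or; apply/andP; split.
  by apply/eqP => /(congr1 size)/= /eqP; rewrite eqn_leq ltnn.
by apply: contra (newborn_notin T v) => /parent_in_tree.
Qed.

Lemma suffix_child c u v : is_child u v -> suffix c v = (c == v) || suffix c u.
Proof.
move=> /is_childP[i ->]; apply/idP/orP => [/suffixP[[|j s] /= E]|[/eqP->|/suffixP[s ->]]].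
- by left; rewrite E.
- by right; case: E => _ ->; exact: suffix_suffix.
- exact: suffix_refl.
- by apply/suffixP; exists (i :: s).
Qed.

Lemma eq_suffix_size c c' u : suffix c u -> suffix c' u -> size c = size c' -> c = c'.
Proof. by rewrite !suffixE => /eqP H /eqP H' E; rewrite -H -H' E. Qed.

Lemma eq_suffix_sibling v c c' u : is_child v c -> is_child v c' ->
  suffix c u -> suffix c' u -> c = c'.
Proof.
by move=> /is_childP[i ->] /is_childP[j ->] h1 h2; exact: eq_suffix_size h1 h2 _.
Qed.

(** At most one child of [v] has [u] in its subtree, so that a transition at [u] alters at most one
    factor of a product over the children of [v]. *)
Lemma ancestor_child v u : exists c0, forall c, is_child v c -> c != c0 -> ~~ suffix c u.
Proof.
have [[c0 vc0 cu]|H] := pselect (exists2 c, is_child v c & suffix c u).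
  by exists c0 => c vc; apply: contra => h; rewrite (eq_suffix_sibling vc vc0 h cu).
by exists v => c vc _; apply/negP => h; apply: H; exists c.
Qed.

Lemma perm_children T T' v : (forall i, (i :: v \in vertices T) = (i :: v \in vertices T')) ->
  perm_eq (children T v) (children T' v).
Proof.
move=> H; apply: uniq_perm; rewrite ?uniq_children// => c.
by rewrite !mem_children; case: (is_childP v c) => //= -[i ->]; rewrite H.
Qed.

Lemma perm_children_add T v : v \in vertices T ->
  perm_eq (children (add_child T v) v) (newborn T v :: children T v).
Proof.
move=> vT; apply: uniq_perm; rewrite ?uniq_children//=.
  by rewrite uniq_children andbT mem_children negb_and newborn_notin orbT.
move=> c; rewrite in_cons !mem_children in_add_child// andb_orr; congr (_ || _).
by rewrite andbC; case: eqP => //= ->; rewrite newborn_child.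
Qed.

Lemma children_leaf T v : is_leaf T v -> children T v = [::].
Proof. by move=> /andP[_ /eqP]; rewrite n_childrenE => /size0nil. Qed.

Definition height T := \max_(c <- enum_fset T) size c.

Lemma size_le_height T c : c \in vertices T -> (size c <= height T)%N.
Proof. by move=> cT; rewrite /height (big_rem c)//= leq_maxl. Qed.

Section Accessibility.
Variable K : tree -> Prop.
Hypothesis Kadd : forall T v, K T -> v \in vertices T -> K (add_child T v).
Hypothesis Krem : forall T v, K T -> v != [::] -> is_leaf T v -> K (remove T v).

(* A label [i] that is not the least free one is reached by filling the
   smaller labels first, and deleting them afterwards. *)
Lemma accessible_child T i v : K T -> v \in vertices T -> i :: v \notin vertices T ->
  exists2 T', K T' & vertices T' = (i :: v) |` vertices T.
Proof.
have [n] := ubnP (i - head 0 (newborn T v))%N.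
elim: n T => // n IH T hn KT vT iT; have [j [E jT jlow]] := newbornP T v.
have KT1 := Kadd KT vT; have V1 := add_childE vT; rewrite E /= in hn V1.
have ji : (j <= i)%N by rewrite leqNgt; apply/negP => /jlow; rewrite (negbTE iT).
case: (ltngtP j i) ji => // [ltji|eqij] _; last first.
  by exists (add_child T v); rewrite // V1 eqij.
have vT1 : v \in vertices (add_child T v) by rewrite in_add_child// vT orbT.
have iT1 : i :: v \notin vertices (add_child T v).
  rewrite in_add_child// E (negbTE iT) orbF; apply/eqP => -[ij].
  by rewrite ij ltnn in ltji.
have [j1 [E1 j1T _]] := newbornP (add_child T v) v.
have lt_j : (j < j1)%N.
  rewrite ltnNge; apply: contra j1T; rewrite leq_eqVlt in_add_child// E => /orP[/eqP->|/jlow ->].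
    by rewrite eqxx.
  by rewrite orbT.
have [|T2 KT2 V2] := IH _ _ KT1 vT1 iT1.
  by rewrite E1 /=; lia.
have jleaf : is_leaf T2 (j :: v).
  apply/is_leafP; rewrite V2 V1; split; first by rewrite !in_fset1U eqxx orbT.
  move=> k; rewrite !in_fset1U !negb_or; apply/and3P; split.
  - by apply/eqP => -[_ /(congr1 size)/eqP] /=; rewrite eqn_leq ltnn.
  - by apply/eqP => -[_ /(congr1 size)/eqP] /=; rewrite eqn_leq ltnn.
  - by apply: contra jT => /parent_in_tree.
exists (remove T2 (j :: v)); first exact: Krem.
rewrite removeE// V2 V1; apply/fsetP => u; rewrite in_fsetD1 !in_fset1U.
case: (u =P j :: v) => //= ->; rewrite (negbTE jT) orbF.
by apply/esym/eqP => -[ij]; rewrite ij ltnn in ltji.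
Qed.

(** Irreducibility, for a property that propagates along transitions. By induction on the number of
    vertices, a deepest vertex, which is a leaf, is removed and then put back under its own
    label. *)
Lemma tree_accessible : K root_tree -> forall T, K T.
Proof.
move=> K0 T; have [n] := ubnP #|` vertices T|; elim: n T => // n IH T hn.
have [v vT vmax] : exists2 v, v \in vertices T & forall u, u \in vertices T -> (size u <= size v)%N.
  have : exists k, has (fun u => size u == k) (enum_fset T).
    by exists 0%N; apply/hasP; exists [::] => //; exact: root_in_tree.
  move=> ex; have ub k : has (fun u => size u == k) (enum_fset T) -> (k <= height T)%N.
    by move=> /hasP[u uT /eqP <-]; exact: size_le_height.
  case: (ex_maxnP ex ub) => k /hasP[v vT /eqP <-] H; exists v => // u uT.
  by apply: H; apply/hasP; exists u.
have vleaf : is_leaf T v.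
  apply/is_leafP; split=> // i; apply/negP => /vmax /=.
  by rewrite ltnn.
have [v0|v0] := eqVneq v [::].
  suff -> : T = root_tree by [].
  apply: tree_eqP; apply/fsetP => u; rewrite in_fset1.
  apply/idP/eqP => [/vmax|->]; last exact: root_in_tree.
  by rewrite v0 leqn0 => /nilP.
have cT : #|` vertices (remove T v)| .+1 = #|` vertices T|.
  by rewrite removeE// (cardfsD1 v (vertices T)) vT.
have KT' : K (remove T v) by apply: IH; rewrite -ltnS cT.
case: v vT {vmax} vleaf v0 cT KT' => [//|i v] vT vleaf v0 cT KT'.
have [||T' KT2 VT'] := accessible_child (i := i) (v := v) KT'.
- rewrite in_remove// (parent_in_tree vT) andbT.
  by apply/eqP => /(congr1 size)/eqP /=; rewrite eqn_leq ltnn andbF.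
- by rewrite in_remove// eqxx.
suff <- : T' = T by [].
by apply: tree_eqP; rewrite VT' removeE// fsetD1K.
Qed.

End Accessibility.

End Trees.

(** * Backward equations *)

Section BackwardEquations.
Context {R : realType}.
Variables (lambda mu : R) (q : R -> R).
Hypotheses (l0 : 0 < lambda) (m0 : 0 < mu) (Hq : survival lambda mu q).
Implicit Types (T : tree) (u v c : vertex).

Let lq : lip q. Proof. by case: Hq. Qed.
Let q0 t : 0 < q t. Proof. by case: Hq => _ _ /(_ t)/andP[]. Qed.
Let q0' t : 0 <= q t. Proof. exact: ltW. Qed.
Let q1 t : q t <= 1. Proof. by case: Hq => _ _ /(_ t)/andP[]. Qed.
Let qE t : 1 - q t = conv q (event_rate lambda mu q) t.
Proof. by case: Hq => _ _ _ ->; rewrite opprB addrC subrK. Qed.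
(** The fuel [n] exceeds the depth of the tree below [v]. Absent vertices count as deleted, with
    value 1; the same default is harmless when the fuel is exhausted, since [dead] only gets there
    at vertices outside the tree. *)
Fixpoint dead_rec (n : nat) (T : tree) (v : vertex) (t : R) : R :=
  if n is n'.+1 then
    if v \in vertices T then
      conv q (fun s => mu * (expR (- (lambda * itg q 0 s)) *
                             \prod_(c <- children T v) dead_rec n' T c s)) t
    else 1
  else 1.

(* [dead T v t] is the probability that [v] is deleted within time [t],
   starting from [T]; [gf z T v t] is the probability generating function, at
   [z], of the number of children of [v] at time [t] if [v] is never deleted.
   Between two mu-events the latter has no memory, so that [dead T v] is
   obtained by a decomposition at the last mu-event before [t]. *)
Definition dead T v t := dead_rec ((height T).+1 - size v) T v t.

Definition gf (z : R) T v (t : R) : R := expR (- ((1 - z) * (lambda * itg q 0 t))) *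
  \prod_(c <- children T v) (z + (1 - z) * dead T c t).

Lemma dead_in T v : v \in vertices T ->
  dead T v = conv q (fun s => mu * gf 0 T v s).
Proof.
move=> vT; apply/funext => t; rewrite /dead.
have vh := size_le_height vT; rewrite subSn//= vT; congr conv; apply/funext => s.
rewrite /gf subr0 mul1r; congr (_ * (_ * _)); apply: eq_big_seq => c.
rewrite mem_children => /andP[/is_childP[i ->] _].
by rewrite add0r mul1r /dead /= subSS.
Qed.

Lemma dead_out T v t : v \notin vertices T -> dead T v t = 1.
Proof. by move=> vT; rewrite /dead; case: (_ - _)%N => //= n; rewrite (negbTE vT). Qed.

Let lip_pois (k : R) : lip (fun s => expR (- (k * (lambda * itg q 0 s)))).
Proof. exact: lip_expR (lipN (lipZ _ (lipZ _ (lip_itg lq)))). Qed.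

Let lip_pois1 : lip (fun s => expR (- (lambda * itg q 0 s))).
Proof. exact: lip_expR (lipN (lipZ _ (lip_itg lq))). Qed.

Lemma lip_dead_rec n T v : lip (dead_rec n T v).
Proof.
elim: n v => [|n IH] v /=; first exact: lip_cst.
case: (v \in vertices T); last exact: lip_cst.
by apply: lip_conv => //; apply: lipZ; apply: lipM => //; exact: lip_prod.
Qed.

Lemma lip_dead T v : lip (dead T v).
Proof. exact: lip_dead_rec. Qed.

Lemma lip_gf z T v : lip (gf z T v).
Proof.
apply: lipM; first exact: lip_pois.
by apply: lip_prod => c; apply: lipD; [exact: lip_cst|exact: lipZ (lip_dead _ _)].
Qed.

Lemma prod_01 (I : eqType) (s : seq I) (F : I -> R) :
  (forall i, i \in s -> 0 <= F i <= 1) -> 0 <= \prod_(i <- s) F i <= 1.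
Proof.
elim: s => [|i s IH] H; first by rewrite big_nil ler01 lexx.
rewrite big_cons; have /andP[a b] := H i (mem_head _ _).
have /andP[a' b'] := IH (fun j js => H j (@mem_behead _ (i :: s) j js)).
by rewrite mulr_ge0//= mulr_ile1.
Qed.

Lemma dead_01 T v t : 0 <= dead T v t <= 1.
Proof.
rewrite /dead; move: (_ - _)%N => n; elim: n v t => [|n IH] v t /=; first by rewrite ler01 lexx.
case: ifP => _; last by rewrite ler01 lexx.
have H s : 0 <= \prod_(c <- children T v) dead_rec n T c s <= 1 by apply: prod_01.
have lF : lip (fun s => mu * (expR (- (lambda * itg q 0 s)) *
                             \prod_(c <- children T v) dead_rec n T c s)).
  apply: lipZ; apply: lipM => //; apply: lip_prod => c; exact: lip_dead_rec.
apply/andP; split.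
  apply: itg_ge0 => y _ _; have /andP[h _] := H (t - y).
  by rewrite !mulr_ge0 ?expR_ge0// ltW.
apply: (@le_trans _ _ (1 - q t)); last by rewrite gerBl.
rewrite qE; apply: le_itg; [exact: (lip_conv_int _ lq lF)|exact: (lip_conv_int _ lq (lip_event_rate _ _ lq))|].
move=> y _ _; apply: (ler_wpM2l (q0' y)); apply: (ler_wpM2l (ltW m0)).
have /andP[_ h] := H (t - y).
by rewrite -[leRHS]mulr1; apply: ler_wpM2l h; exact: expR_ge0.
Qed.

Lemma gf_01 z T v t : 0 <= z <= 1 -> 0 <= gf z T v t <= 1.
Proof.
move=> /andP[z0 z1]; have z1' : 0 <= 1 - z by rewrite subr_ge0.
have /andP[h h'] : 0 <= \prod_(c <- children T v) (z + (1 - z) * dead T c t) <= 1.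
  apply: prod_01 => c _; have /andP[d0 d1] := dead_01 T c t.
  rewrite addr_ge0 ?mulr_ge0//= -lerBrDl -[leRHS]mulr1.
  exact: ler_wpM2l.
have e0 : 0 <= (1 - z) * (lambda * itg q 0 t).
  by rewrite !mulr_ge0// ?(ltW l0)// itg_ge0.
by rewrite /gf mulr_ge0 ?expR_ge0//= mulr_ile1 ?expR_ge0// -[leRHS]expR0 ler_expR oppr_le0.
Qed.

Lemma dead_nonpos T v t : v \in vertices T -> t <= 0 -> dead T v t = 0.
Proof. by move=> vT t0; rewrite dead_in// conv_nil. Qed.

Lemma gf_leaf z T v t : is_leaf T v -> gf z T v t = expR (- ((1 - z) * (lambda * itg q 0 t))).
Proof. by move=> lv; rewrite /gf children_leaf// big_nil mulr1. Qed.

Lemma dead_leaf T v t : is_leaf T v -> dead T v t = 1 - q t.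
Proof.
move=> lv; have /is_leafP[vT _] := lv; rewrite dead_in// qE; congr conv.
by apply/funext => s; rewrite gf_leaf// subr0 mul1r.
Qed.

Lemma gf_at0 z T v : gf z T v 0 = z ^+ (n_children T v).
Proof.
rewrite /gf itg_nil// !mulr0 oppr0 expR0 mul1r n_childrenE.
rewrite (eq_big_seq (fun=> z)); first by rewrite big_const_seq count_predT -Monoid.iteropE.
by move=> c; rewrite mem_children => /andP[_ cT]; rewrite dead_nonpos// mulr0 addr0.
Qed.

(** This stands in for the independence of disjoint subtrees: transitions outside the subtree of [v]
    leave [dead T v] unchanged. *)
Lemma dead_local T T' v :
  (forall u, suffix v u -> (u \in vertices T) = (u \in vertices T')) -> dead T v = dead T' v.
Proof.
have [n] := ubnP ((height T).+1 - size v)%N; elim: n v => // n IH v hn H.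
have [vT|vT] := boolP (v \in vertices T); last first.
  by apply/funext => t; rewrite !dead_out// -H// suffix_refl.
have vT' : v \in vertices T' by rewrite -H// suffix_refl.
have Hc i : (i :: v \in vertices T) = (i :: v \in vertices T').
  by apply: H; apply/suffixP; exists [:: i].
rewrite !dead_in//; congr conv; apply/funext => s; congr (_ * (_ * _)).
rewrite -(perm_big _ (perm_children Hc)); apply: eq_big_seq => c.
rewrite mem_children => /andP[/is_childP[i ->] cT]; rewrite IH//.
  by have := size_le_height vT; move: hn; rewrite /=; lia.
by move=> u /suffixP[x ->]; apply: H; rewrite -cat_rcons suffix_suffix.
Qed.

Lemma C11_prod (I : eqType) (s : seq I) (F F' : I -> R -> R) : uniq s ->
  (forall i, i \in s -> C11 (F i) (F' i)) ->
  C11 (fun t => \prod_(i <- s) F i t)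
      (fun t => \sum_(i <- s) F' i t * \prod_(j <- s | j != i) F j t).
Proof.
elim: s => [|i s IH] /=.
  by move=> _ _; apply: C11_ext (C11_cst 1) _ _ => t; rewrite big_nil.
move=> /andP[iNs us] H; have {}IH := IH us (fun j js => H j (@mem_behead _ (i :: s) j js)).
apply: C11_ext (C11M (H i (mem_head _ _)) IH) _ _ => t; first by rewrite big_cons.
rewrite big_cons big_cons eqxx /=; congr (_ * _ + _).
  rewrite big_seq_cond [RHS]big_seq_cond; apply: eq_bigl => j.
  by case: (boolP (j \in s)) => //= js; apply/esym; apply: contraNneq iNs => <-.
rewrite mulr_sumr; apply: eq_big_seq => j js; rewrite mulrCA big_cons.
by rewrite (_ : i != j)//; apply: contraNneq iNs => ->.
Qed.

(** This first-order expansion is exact because at most one factor changes; through it the generator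
    acts on products as a derivation. *)
Lemma prod_change (I : eqType) (s : seq I) (A B : I -> R) : uniq s ->
  (exists i0, forall i, i \in s -> i != i0 -> A i = B i) ->
  \prod_(i <- s) B i - \prod_(i <- s) A i =
  \sum_(i <- s) (B i - A i) * \prod_(j <- s | j != i) A j.
Proof.
move=> us [i0 H]; have [si0|si0] := boolP (i0 \in s); last first.
  rewrite (eq_big_seq A); last by move=> i si; rewrite H//; apply: contraNneq si0 => <-.
  rewrite subrr big_seq big1// => i si; rewrite H ?subrr ?mul0r//.
  by apply: contraNneq si0 => <-.
rewrite (bigD1_seq i0)//= (bigD1_seq i0 si0 us)//= [in RHS](bigD1_seq i0)//=.
have -> : \sum_(i <- s | i != i0) (B i - A i) * \prod_(j <- s | j != i) A j = 0.
  by rewrite big_seq_cond big1// => i /andP[si ii0]; rewrite H ?subrr ?mul0r.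
rewrite addr0 mulrBl; congr (_ * _ - _); rewrite big_seq_cond [RHS]big_seq_cond.
by apply: eq_bigr => i /andP[si ii0]; rewrite H.
Qed.

(** The generator of the chain in which [w] is never deleted, indexed by moves instead of target
    trees. *)
Definition gen (w : vertex) (f : tree -> R) (T : tree) : R :=
  lambda * (\sum_(u <- enum_fset T) (f (add_child T u) - f T)) +
  mu * (\sum_(u <- enum_fset T | deletable w T u) (f (remove T u) - f T)).

Lemma dead_add T u c : u \in vertices T -> c \in vertices T -> ~~ suffix c u ->
  dead (add_child T u) c = dead T c.
Proof.
move=> uT cT cu; apply/esym; apply: dead_local => x cx; rewrite in_add_child//.
case: eqP => // xE; move: cx; rewrite xE (suffix_child _ (newborn_child T u)) (negbTE cu) orbF.
by move=> /eqP cE; move: cT; rewrite cE (negbTE (newborn_notin T u)).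
Qed.

Lemma dead_remove T u c : u != [::] -> is_leaf T u -> ~~ suffix c u ->
  dead (remove T u) c = dead T c.
Proof.
move=> u0 lu cu; apply/esym; apply: dead_local => x cx; rewrite in_remove//.
by case: eqP => // xE; rewrite -xE cx in cu.
Qed.

Lemma child_not_suffix v c : is_child v c -> ~~ suffix c v.
Proof.
move=> /is_childP[i ->]; apply/negP => /size_suffix /=.
by rewrite ltnn.
Qed.

Let rest z T v c t := \prod_(c' <- children T v | c' != c) (z + (1 - z) * dead T c' t).
Let pois z t := expR (- ((1 - z) * (lambda * itg q 0 t))).

Let gf_change z T T' v t :
  (exists c0, forall c, c \in children T v -> c != c0 -> dead T' c = dead T c) ->
  pois z t * \prod_(c <- children T v) (z + (1 - z) * dead T' c t) - gf z T v t =
  pois z t * \sum_(c <- children T v) ((1 - z) * (dead T' c t - dead T c t)) * rest z T v c t.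
Proof.
move=> [c0 H]; rewrite /gf -mulrBr; congr (_ * _); rewrite prod_change ?uniq_children//.
  by apply: eq_bigr => c _; congr (_ * _); ring.
by exists c0 => c cT cc0; rewrite H.
Qed.

(** A birth at [v] itself adds a leaf, whose factor [z + (1 - z) * (1 - q t) = 1 - (1 - z) * q t]
    gives the first term; any other birth acts through the subtree of a child. *)
Let gf_add z T v u t : v \in vertices T -> u \in vertices T ->
  gf z (add_child T u) v t - gf z T v t =
  (if u == v then - (1 - z) * (q t * gf z T v t) else 0) +
  pois z t * \sum_(c <- children T v)
     ((1 - z) * (dead (add_child T u) c t - dead T c t)) * rest z T v c t.
Proof.
move=> vT uT; case: eqP => [->|/eqP uv].
  rewrite [X in pois z t * X](_ : _ = 0).
    rewrite mulr0 addr0 {1}/gf (perm_big _ (perm_children_add vT)) big_cons /=.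
    rewrite dead_leaf; last exact: leaf_newborn.
    rewrite (eq_big_seq (fun c => z + (1 - z) * dead T c t)); last first.
      move=> c; rewrite mem_children => /andP[vc cT].
      by rewrite dead_add// child_not_suffix.
    by rewrite /gf; ring.
  rewrite big1_seq// => c /= ; rewrite mem_children => /andP[vc cT].
  by rewrite dead_add ?subrr ?mulr0 ?mul0r// child_not_suffix.
rewrite add0r -gf_change; last first.
  have [c0 H] := ancestor_child v u; exists c0 => c.
  rewrite mem_children => /andP[vc cT] cc0; apply: dead_add => //; exact: H.
congr (_ * _ - _); apply: perm_big; apply: perm_children => i; rewrite in_add_child//.
case: eqP => //= E; have /is_childP[j] := newborn_child T u; rewrite -E => -[_ vu].
by rewrite vu eqxx in uv.
Qed.

(** A deleted child leaves the product, which amounts to the factor [z + (1 - z) * 1 = 1]: hence the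
    value 1 of [dead] at absent vertices. *)
Let gf_remove z T v u t : v \in vertices T -> deletable v T u ->
  gf z (remove T u) v t - gf z T v t = pois z t * \sum_(c <- children T v)
     ((1 - z) * (dead (remove T u) c t - dead T c t)) * rest z T v c t.
Proof.
move=> vT /and3P[u0 uv lu]; rewrite -gf_change; last first.
  have [c0 H] := ancestor_child v u; exists c0 => c.
  rewrite mem_children => /andP[vc cT] cc0; apply: dead_remove => //; exact: H.
congr (_ * _ - _).
have [uc|uc] := boolP (u \in children T v).
  rewrite (big_rem u uc)/= dead_out; last by rewrite in_remove// eqxx.
  rewrite (_ : z + (1 - z) * 1 = 1) ?mul1r; last by ring.
  apply: perm_big; apply: uniq_perm.
  - exact: uniq_children.
  - by rewrite rem_uniq// uniq_children.
  - move=> c; rewrite mem_children in_remove// mem_rem_uniq ?uniq_children//.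
    by rewrite inE /= mem_children; case: eqP; rewrite ?andbF//= => _; rewrite andbC.
apply: perm_big; apply: perm_children => i; rewrite in_remove//.
by case: eqP => //= E; move: uc; rewrite -E mem_children /= eqxx /= => /negbTE ->.
Qed.

Lemma big_pred1_uniq (I : eqType) (s : seq I) (F : I -> R) (i : I) :
  uniq s -> i \in s -> \sum_(j <- s | j == i) F j = F i.
Proof. by move=> us si; rewrite -big_filter filter_pred1_uniq// big_seq1. Qed.

Lemma sum_neq_cond (I : eqType) (s : seq I) (P : pred I) (F : I -> R) (i : I) :
  uniq s -> i \in s ->
  \sum_(j <- s | P j) F j = (if P i then F i else 0) + \sum_(j <- s | P j && (j != i)) F j.
Proof.
move=> us si; rewrite (bigID (pred1 i)) /=; congr (_ + _).
rewrite (eq_bigl (fun j => P i && (j == i))); last first.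
  by move=> j; case: eqP => [->|]; rewrite ?andbF.
by case: (P i); rewrite /= ?big_pred0_eq// big_pred1_uniq.
Qed.

(** Protecting [v] from deletion changes nothing, as [v] has the child [c]. Lifting the protection
    of [c] allows its deletion when it is a leaf, at rate [mu] and with jump
    [1 - dead T c t = q t]. *)
Let child_generator T v c t : c \in children T v ->
  gen c (fun S => dead S c t) T + (if is_leaf T c then mu * q t else 0) =
  gen v (fun S => dead S c t) T.
Proof.
rewrite mem_children => /andP[vc cT]; rewrite /gen -addrA; congr (_ + _).
pose P u := (u != [::]) && is_leaf T u.
have c0 : c != [::] by case/is_childP : vc => i ->.
have -> : \sum_(u <- enum_fset T | deletable v T u) (dead (remove T u) c t - dead T c t) =
    \sum_(u <- enum_fset T | P u) (dead (remove T u) c t - dead T c t).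
  apply: eq_bigl => u; rewrite /deletable /P; case: (u =P v) => //= ->; rewrite andbF.
  apply/esym/negbTE; rewrite negb_and; apply/orP; right; apply/is_leafP => -[_ H].
  by move: cT; case/is_childP : vc => i ->; apply/negP.
rewrite (sum_neq_cond P _ (fset_uniq _) cT) mulrDr addrC; congr (_ + _).
  rewrite /P c0 /=; case: ifP => lc; last by rewrite mulr0.
  rewrite dead_out ?in_remove ?eqxx// dead_leaf//; congr (_ * _); ring.
by congr (_ * _); apply: eq_bigl => u; rewrite /deletable /P andbAC andbA.
Qed.

(** The derivative of the Poisson factor accounts for the births at [v], that of the product for the
    transitions inside the subtrees of the children. *)
Lemma C11_gf_step z T v : v \in vertices T ->
  (forall c, c \in children T v ->
    C11 (dead T c) (fun t => gen c (fun S => dead S c t) T +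
      (if is_leaf T c then mu * q t else 0))) ->
  C11 (gf z T v) (fun t => gen v (fun S => gf z S v t) T).
Proof.
move=> vT H.
have CE : C11 (pois z) (fun t => - ((1 - z) * (lambda * q t)) * pois z t).
  exact: C11_expR (C11N (C11Z _ (C11Z _ (C11_itg lq)))).
have CP := C11_prod (uniq_children T v)
  (fun c cT => C11D (C11_cst z) (C11Z (1 - z) (H c cT))).
apply: C11_ext (C11M CE CP) _ _ => t //; rewrite [in RHS]/gen.
rewrite [X in pois z t * X](eq_big_seq
  (fun c => (1 - z) * gen v (fun S => dead S c t) T * rest z T v c t)); last first.
  by move=> c cT /=; rewrite add0r (child_generator t cT).
have -> : \sum_(u <- enum_fset T) (gf z (add_child T u) v t - gf z T v t) =
  \sum_(u <- enum_fset T) ((if u == v then - (1 - z) * (q t * gf z T v t) else 0) +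
    pois z t * \sum_(c <- children T v)
     ((1 - z) * (dead (add_child T u) c t - dead T c t)) * rest z T v c t).
  by apply: eq_big_seq => u uT; exact: gf_add.
rewrite [X in mu * X](eq_bigr _ (fun u Pu => gf_remove z t vT Pu)).
rewrite big_split /= -big_mkcond /= big_pred1_uniq ?fset_uniq//.
rewrite mulrDr -addrA; congr (_ + _).
  by rewrite /gf -/(pois z t); ring.
rewrite -!mulr_sumr !(mulrCA _ (pois z t)) -mulrDr; congr (_ * _).
rewrite [X in lambda * X]exchange_big /= [X in mu * X]exchange_big /=.
rewrite [X in _ = X + _]mulr_sumr [X in _ = _ + X]mulr_sumr -big_split /=.
apply: eq_bigr => c _; rewrite /gen -!mulr_suml -!mulr_sumr; ring.
Qed.

Lemma convZ f g (k t : R) : lip f -> lip g ->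
  conv f (fun y => k * g y) t = k * conv f g t.
Proof.
move=> lf lg; rewrite /conv -itgZ; last exact: lip_conv_int.
by apply: eq_itg => y _ _; rewrite mulrCA.
Qed.

Lemma conv_sum (I : Type) (s : seq I) (P : pred I) f (F : I -> R -> R) (t : R) :
  lip f -> (forall i, lip (F i)) ->
  conv f (fun y => \sum_(i <- s | P i) F i y) t = \sum_(i <- s | P i) conv f (F i) t.
Proof.
move=> lf lF; elim: s => [|i s IH].
  rewrite big_nil -[RHS](mul0r (conv f (fun=> 1) t)) -convZ//; last exact: lip_cst.
  by apply: eq_itg => y _ _; rewrite big_nil mul0r.
rewrite big_cons -IH; case: ifP => Pi.
  rewrite /conv -itgD; [|exact: (lip_conv_int _ lf (lF i))|
    exact: (lip_conv_int _ lf (lip_sum _ _ lF))].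
  by apply: eq_itg => y _ _; rewrite big_cons Pi mulrDr.
by apply: eq_itg => y _ _; rewrite big_cons Pi.
Qed.

(** In [dead T v = conv q (mu * gf 0 T v)] the convolution commutes with the generator, under which
    [v] always stays in the tree. The boundary term [mu * gf 0 T v 0 * q t] is nonzero only for a
    leaf, by [0 ^+ n_children]. *)
Lemma C11_dead_step T v : v \in vertices T ->
  C11 (gf 0 T v) (fun t => gen v (fun S => gf 0 S v t) T) ->
  C11 (dead T v) (fun t => gen v (fun S => dead S v t) T +
      (if is_leaf T v then mu * q t else 0)).
Proof.
move=> vT H; rewrite {1}(dead_in vT).
apply: C11_ext (C11_conv lq (C11Z mu H)) _ _ => // t.
rewrite addrC; congr (_ + _); last first.
  rewrite gf_at0 n_childrenE; case: ifP => [lv|].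
    by rewrite children_leaf// expr0 mulr1.
  rewrite /is_leaf vT /= n_childrenE => h; rewrite expr0n h mulr0 mul0r//.
have lgfs S : lip (gf 0 S v) by exact: lip_gf.
have lB S : lip (fun y => gf 0 S v y - gf 0 T v y) by apply: lipB.
have cvB S : v \in vertices S ->
    conv q (fun y => mu * (gf 0 S v y - gf 0 T v y)) t = dead S v t - dead T v t.
  move=> vS; rewrite !dead_in// /conv -itgB; last 2 first.
  - exact: (lip_conv_int _ lq (lipZ mu (lgfs S))).
  - exact: (lip_conv_int _ lq (lipZ mu (lgfs T))).
  by apply: eq_itg => y _ _; ring.
have -> : conv q (fun t => mu * gen v (fun S => gf 0 S v t) T) t =
    conv q (fun y => lambda * (\sum_(u <- enum_fset T) mu * (gf 0 (add_child T u) v y - gf 0 T v y)) +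
      mu * (\sum_(u <- enum_fset T | deletable v T u) mu * (gf 0 (remove T u) v y - gf 0 T v y))) t.
  by apply: eq_itg => y _ _; rewrite /gen -!mulr_sumr; ring.
have lS (s : seq vertex) (P : pred vertex) (f : vertex -> tree) :
    lip (fun y => \sum_(u <- s | P u) mu * (gf 0 (f u) v y - gf 0 T v y)).
  exact: lip_sum (fun u => lipZ mu (lB (f u))).
have convD f g : lip f -> lip g -> conv q (fun y => f y + g y) t = conv q f t + conv q g t.
  move=> lf lg; rewrite /conv -itgD; [|exact: (lip_conv_int _ lq lf)|exact: (lip_conv_int _ lq lg)].
  by apply: eq_itg => y _ _; rewrite mulrDr.
rewrite convD; [|exact: lipZ|exact: lipZ]; rewrite !convZ// !conv_sum//; last 2 first.
- by move=> u; exact: lipZ.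
- by move=> u; exact: lipZ.
rewrite /gen; congr (_ * _ + _ * _).
  by apply: eq_big_seq => u uT; rewrite cvB// in_add_child// vT orbT.
apply: eq_bigr => u /and3P[u0 uv lu]; rewrite cvB// in_remove// vT andbT.
by rewrite eq_sym.
Qed.

Lemma C11_dead T v : v \in vertices T ->
  C11 (dead T v) (fun t => gen v (fun S => dead S v t) T +
      (if is_leaf T v then mu * q t else 0)).
Proof.
have [n] := ubnP ((height T).+1 - size v)%N; elim: n v => // n IH v hn vT.
apply: C11_dead_step => //; apply: C11_gf_step => // c.
rewrite mem_children => /andP[/is_childP[i ->] cT]; apply: IH => //=.
by have := size_le_height vT; move: hn; lia.
Qed.

Lemma C11_gf z T v : v \in vertices T ->
  C11 (gf z T v) (fun t => gen v (fun S => gf z S v t) T).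
Proof.
move=> vT; apply: C11_gf_step => // c; rewrite mem_children => /andP[_ cT].
exact: C11_dead.
Qed.

(** In the chain itself [v] may be deleted, with jump [1 - dead T v t = q t] when it is a leaf; this
    absorbs the extra term of [C11_dead]. *)
Lemma C11_dead_chain T v : v != [::] -> v \in vertices T ->
  C11 (dead T v) (fun t => gen [::] (fun S => dead S v t) T).
Proof.
move=> v0 vT; apply: C11_ext (C11_dead vT) _ _ => // t.
rewrite /gen -addrA; congr (_ + _).
rewrite [in RHS](sum_neq_cond _ _ (fset_uniq _) vT) mulrDr addrC; congr (_ + _).
  rewrite /deletable v0 /=; case: ifP => lv; last by rewrite mulr0.
  rewrite dead_out ?in_remove ?eqxx// dead_leaf//; congr (_ * _); ring.
congr (_ * _); apply: eq_bigl => u; rewrite /deletable.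
by case: (u == [::]); case: (u == v); case: is_leaf.
Qed.

End BackwardEquations.

(** * Densities, independence and exponential holding times *)

Section MeasureLemmas.
Local Open Scope ereal_scope.
Context {R : realType}.
Import HBNNSimple.

Lemma ge0_integral_density d (T : measurableType d) (m nu : {measure set T -> \bar R})
    (p : T -> R) (h : T -> \bar R) :
  measurable_fun setT p -> (forall x, (0 <= p x)%R) ->
  (forall E, measurable E -> nu E = \int[m]_(x in E) (p x)%:E) ->
  measurable_fun setT h -> (forall x, 0 <= h x) ->
  \int[nu]_x h x = \int[m]_x (h x * (p x)%:E).
Proof.
move=> /measurable_EFinP mp p0 nuE mh h0; pose h_ := nnsfun_approx measurableT mh.
have simple (g : {nnsfun T >-> R}) :
    \int[nu]_x (g x)%:E = \int[m]_x ((g x)%:E * (p x)%:E).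
  under [LHS]eq_integral do rewrite fimfunE -fsumEFin//.
  rewrite [LHS]ge0_integral_fsum//; last 2 first.
    - by move=> r; exact/measurable_EFinP/measurableT_comp.
    - by move=> n x _; rewrite EFinM nnfun_muleindic_ge0.
  under [RHS]eq_integral.
    move=> x _; rewrite fimfunE -fsumEFin// muleC ge0_mule_fsumr; last first.
      by move=> r; rewrite EFinM nnfun_muleindic_ge0.
    over.
  rewrite [RHS]ge0_integral_fsum//; last 2 first.
    - move=> r; apply: emeasurable_funM => //; apply/measurable_EFinP.
      by apply: measurable_funM => //; exact: measurable_indic.
    - move=> n x _; apply: mule_ge0; first by rewrite lee_fin.
      by rewrite EFinM nnfun_muleindic_ge0.
  apply: eq_fsbigr => r rg.
  have r0 : (0 <= r)%R.
    by move: rg; rewrite in_setE => -[x _ <-].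
  have mr : measurable (g @^-1` [set r]) by exact: measurable_sfunP.
  under [LHS]eq_integral do rewrite EFinM.
  rewrite ge0_integralZl//; last by apply/measurable_EFinP; exact: measurable_indic.
  under [RHS]eq_integral do rewrite EFinM muleCA.
  have mi : measurable_fun setT (fun x => (p x)%:E * (\1_(g @^-1` [set r]) x)%:E).
    by apply: emeasurable_funM => //; apply/measurable_EFinP; exact: measurable_indic.
  rewrite ge0_integralZl//; last by move=> x _; rewrite mule_ge0// lee_fin.
  rewrite integral_indic// setIT nuE//; congr (_ * _).
  rewrite integral_mkcond; apply: eq_integral => x _.
  by rewrite patchE indicE; case: ifPn => xr; rewrite ?mule1 ?mule0.
transitivity (limn (fun n => \int[nu]_x (h_ n x)%:E)).
  rewrite -monotone_convergence//=.
  - by apply: eq_integral => x _; apply/esym/cvg_lim => //; exact: cvg_nnsfun_approx.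
  - by move=> n; exact/measurable_EFinP.
  - by move=> n x _; rewrite lee_fin.
  - by move=> x _ a b ab; rewrite lee_fin//; exact/lefP/nd_nnsfun_approx.
under eq_fun do rewrite simple.
rewrite -monotone_convergence//=.
- apply: eq_integral => x _; apply/cvg_lim => //; apply: cvgeZr => //.
  exact: cvg_nnsfun_approx.
- by move=> n; apply: emeasurable_funM => //; exact/measurable_EFinP.
- by move=> n x _; rewrite mule_ge0// lee_fin.
- by move=> x _ a b ab; rewrite lee_wpmul2r// lee_fin//; exact/lefP/nd_nnsfun_approx.
Qed.

Section Independence.
Context d (T : measurableType d) (P : probability T R).
Context d1 d2 (T1 : measurableType d1) (T2 : measurableType d2).
Variables (A B : set T) (K : T -> T1) (H : T -> T2) (k : {nonneg R}).
Hypotheses (mA : measurable A) (mB : measurable B).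
Hypotheses (mK : measurable_fun setT K) (mH : measurable_fun setT H).

(** In the application [A] is an event of the past, [B] its part on which a given transition takes
    place, and [k] the probability of that transition. The law of [(K, H)] on [B] and [k] times the
    product of the law of [K] on [A] with [nu] agree on rectangles. *)
Lemma integral_indep (nu : probability T2 R) (g : T1 * T2 -> \bar R) :
  (forall U V, measurable U -> measurable V ->
    P (B `&` (K @^-1` U `&` H @^-1` V)) = k%:num%:E * P (A `&` K @^-1` U) * nu V) ->
  measurable_fun setT g -> (forall x, 0 <= g x) ->
  \int[P]_(x in B) g (K x, H x) = k%:num%:E * \int[P]_(x in A) \int[nu]_y g (K x, y).
Proof.
move=> E mg g0.
have mKH : measurable_fun setT (fun x => (K x, H x)) by exact: measurable_fun_pair.
have mK' : measurable_fun setT (fun z : T * T2 => (K z.1, z.2)).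
  by apply: measurable_fun_pair => //; exact: measurableT_comp.
pose PB := mrestr P mB; pose PA := mscale k (mrestr P mA).
pose m1 := pushforward PB (fun x => (K x, H x)).
pose m2 := pushforward (PA \x nu) (fun z : T * T2 => (K z.1, z.2)).
have int_restr C (mC : measurable C) (f : T -> \bar R) : measurable_fun setT f ->
    (forall x, 0 <= f x) -> \int[mrestr P mC]_x f x = \int[P]_(x in C) f x.
  move=> mf f0; rewrite (@ge0_integral_density _ _ P _ (\1_C))//.
  - rewrite [RHS]integral_mkcond; apply: eq_integral => x _.
    by rewrite patchE indicE; case: ifPn => xC; rewrite ?mule1 ?mule0.
  - by move=> D mD; rewrite integral_indic// /mrestr setIC.
have m12 S : measurable S -> m1 S = m2 S.
  apply: (measure_unique [set U `*` V | U in measurable & V in measurable] (fun=> setT)).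
  - exact: measurable_prod_measurableType.
  - move=> _ _ [U1 mU1 [V1 mV1 <-]] [U2 mU2 [V2 mV2 <-]].
    rewrite -setXI; exists (U1 `&` U2); first exact: measurableI.
    by exists (V1 `&` V2) => //; exact: measurableI.
  - by move=> _; exists setT => //; exists setT => //; rewrite setXTT.
  - by rewrite bigcup_const//; exists 0%N.
  - move=> _ [U mU [V mV <-]].
    have mKU : measurable (K @^-1` U) by rewrite -[X in measurable X]setTI; exact: mK.
    have KUV : (fun z : T * T2 => (K z.1, z.2)) @^-1` (U `*` V) = (K @^-1` U) `*` V.
      by apply/seteqP; split => -[].
    transitivity ((PA \x nu) ((K @^-1` U) `*` V)); last by rewrite -KUV.
    rewrite product_measure1E// /PA /mscale /mrestr /=.
    rewrite -[mscale _ _ _]/(k%:num%:E * P (K @^-1` U `&` A)) (setIC (K @^-1` U)) -E// setIC.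
    congr (P (_ `&` _)).
  - move=> _; apply: (@le_lt_trans _ _ 1); last exact: ltry.
    by rewrite -[leLHS]/(P (setT `&` B)) setTI; exact: probability_le1.
have gKH : measurable_fun setT (fun x => g (K x, H x)) by exact: measurableT_comp.
rewrite -int_restr//; transitivity (\int[m1]_z g z).
  by rewrite /m1 ge0_integral_pushforward//= => z _; exact: g0.
have -> : \int[m1]_z g z = \int[m2]_z g z.
  by apply: eq_measure_integral => S mS _; exact: m12.
have mgK : measurable_fun setT (fun z : T * T2 => g (K z.1, z.2)) by exact: measurableT_comp.
have mF : measurable_fun setT (fun x => \int[nu]_y g (K x, y)).
  by apply: (measurable_fun_fubini_tonelli_F (fun z : T * T2 => g (K z.1, z.2))).
rewrite /m2 ge0_integral_pushforward//= preimage_setT.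
rewrite (fubini_tonelli1 (fun z => g (K z.1, z.2)))// /fubini_F /=.
rewrite ge0_integral_mscale//; last by move=> x _; exact: integral_ge0.
by rewrite int_restr// => x; exact: integral_ge0.
Qed.

End Independence.

Lemma measurable_fun_integral2 (g : R * R -> \bar R) :
  measurable_fun setT g -> (forall z, 0 <= g z) ->
  measurable_fun setT (fun k => \int[lebesgue_measure]_y g (k, y)).
Proof.
move=> mg g0.
have mg' : measurable_fun setT (g : R * measurableTypeR R -> \bar R) by exact: mg.
exact: (@measurable_fun_fubini_tonelli_F _ _ R (measurableTypeR R) R lebesgue_measure g mg' g0).
Qed.

Lemma exponential_prob_ray (c r : R) : (0 < c)%R -> (0 <= r)%R ->
  exponential_prob c `]r, +oo[ = (expR (- (c * r)))%:E.
Proof.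
move=> c0 r0.
pose nu := exponential_distribution_exponential_prob__canonical__probability_measure_Probability c0.
have -> : exponential_prob c `]r, +oo[ = 1 - exponential_prob c `]-oo, r].
  by rewrite -[exponential_prob c]/(nu : set R -> \bar R) -(probability_setC nu)// setCitvl.
have cut : exponential_prob c `]-oo, r] = exponential_prob c `[0%R, r].
  rewrite /exponential_prob integral_mkcond [RHS]integral_mkcond; apply: eq_integral => y _.
  rewrite !patchE !mem_setE !in_itv /=; case: (leP 0%R y) => //= y0.
  by rewrite lt0_exponential_pdf//; case: ifP.
rewrite cut; move: r0; rewrite le_eqVlt => /predU1P[<-|r0].
  rewrite set_itv1 /exponential_prob integral_set1 mulr0 oppr0 expR0 sube0//.
rewrite exponential_prob_itv0c// oppeB// addeA subee// add0e mulNr//.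
Qed.

(** Only rays []r, +oo[] with [r >= 0] are assumed, as in [chain_law]. Rays from a negative point
    weigh as much as the one from 0, since [H] is positive and the exponential law is carried by the
    positive half-line; together they determine the law. *)
Lemma integral_indep_exponential d (T : measurableType d) (P : probability T R)
    (A B : set T) (K H : T -> R) (k c : R) (g : R * R -> \bar R) :
  measurable A -> measurable B -> measurable_fun setT K -> measurable_fun setT H ->
  (forall x, (0 < H x)%R) -> (0 <= k)%R -> (0 < c)%R ->
  (forall U r, measurable U -> (0 <= r)%R ->
     P (B `&` (K @^-1` U `&` [set x | (r < H x)%R])) =
     (k * expR (- (c * r)))%:E * P (A `&` K @^-1` U)) ->
  measurable_fun setT g -> (forall x, 0 <= g x) ->
  \int[P]_(x in B) g (K x, H x) = k%:E * \int[P]_(x in A)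
    \int[lebesgue_measure]_y (g (K x, y) * (exponential_pdf c y)%:E).
Proof.
move=> mA mB mK mH H0 k0 c0 E mg g0.
pose nu := exponential_distribution_exponential_prob__canonical__probability_measure_Probability c0.
have prodE U V : measurable U -> measurable V ->
    P (B `&` (K @^-1` U `&` H @^-1` V)) = (NngNum k0)%:num%:E * P (A `&` K @^-1` U) * nu V.
  move=> mU mV /=.
  have mKU : measurable (K @^-1` U) by rewrite -[X in measurable X]setTI; exact: mK.
  have mBU : measurable (B `&` K @^-1` U) by exact: measurableI.
  pose kU := NngNum (mulr_ge0 k0 (fine_ge0 (measure_ge0 P (A `&` K @^-1` U)))).
  have mH' : measurable_fun setT (H : T -> measurableTypeR R) by exact: mH.
  pose m1 := measure_function_pushforward__canonical__measure_function_Measure (mrestr P mBU) mH'.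
  pose m2 := measure_function_mscale__canonical__measure_function_Measure kU nu.
  have m1E V' : m1 V' = P (B `&` (K @^-1` U `&` H @^-1` V')) by rewrite setIA setIC.
  have m2E V' : m2 V' = k%:E * P (A `&` K @^-1` U) * nu V'.
    rewrite -[m2 V']/((kU%:num)%:E * nu V') EFinM fineK// fin_num_measure//.
    exact: measurableI.
  rewrite -m1E -m2E.
  refine (@measure_unique _ R (measurableTypeR R) (@RGenOInfty.G R)
    (fun n => `](- n%:R)%R, +oo[%classic) _ _ _ _ m1 m2 _ _ V mV).
  - exact: RGenOInfty.measurableE.
  - move=> _ _ [x ->] [y ->]; exists (Num.max x y).
    by apply/seteqP; split => z /=; rewrite !in_itv /= !andbT gt_max => /andP.
  - by move=> n; exists (- n%:R)%R.
  - apply/seteqP; split => // x _; exists (Num.bound `|x|) => //=.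
    rewrite in_itv /= andbT ltrNl; apply: le_lt_trans (archi_boundP (normr_ge0 _)).
    by rewrite -normrN ler_norm.
  - move=> _ [x ->].
    have mr r : (0 <= r)%R -> m1 `]r, +oo[%classic = m2 `]r, +oo[%classic.
      move=> r0; rewrite m1E m2E -[nu _]/(exponential_prob c _) exponential_prob_ray//.
      rewrite (_ : H @^-1` _ = [set x | (r < H x)%R]); last first.
        by apply/seteqP; split => z /=; rewrite in_itv /= andbT.
      by rewrite E// EFinM muleAC.
    case: (leP 0 x)%R => [|x0]; first exact: mr.
    have -> : m1 `]x, +oo[%classic = m1 `]0%R, +oo[%classic.
      rewrite !m1E; congr (P (_ `&` (_ `&` _))).
      by apply/seteqP; split => z /=; rewrite !in_itv /= !andbT H0// (lt_trans x0).
    rewrite mr// !m2E; congr (_ * _).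
    apply/eqP; rewrite eq_le; apply/andP; split.
      by apply: le_measure; rewrite ?in_setE//; apply: subset_itvr; rewrite bnd_simp ltW.
    have -> : nu `]0%R, +oo[%classic = 1.
      by rewrite -[LHS]/(exponential_prob c _) exponential_prob_ray// mulr0 oppr0 expR0.
    exact: probability_le1.
  - move=> n; apply: (@le_lt_trans _ _ 1); last exact: ltry.
    rewrite m1E; apply: probability_le1; rewrite setIA; apply: measurableI => //.
    by rewrite -[X in measurable X]setTI; exact: mH.
transitivity (k%:E * \int[P]_(x in A) \int[nu]_y g (K x, y)).
  exact: (@integral_indep _ _ P _ _ _ (measurableTypeR R) A B K H (NngNum k0) mA mB mK mH nu g).
congr (_ * _); apply: eq_integral => x _.
apply: ge0_integral_density => //; first exact: measurable_exponential_pdf.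
- by move=> y; exact: exponential_pdf_ge0 (ltW c0) _.
- by apply: measurableT_comp => //; exact: measurable_fun_pair.
Qed.

End MeasureLemmas.

(** * The jump chain *)

Section Chain.
Context {R : realType}.
Variables (lambda mu : R) (w : vertex) (G : tree_chain lambda mu w).
Hypotheses (l0 : 0 < lambda) (m0 : 0 < mu).
Variable T0 : tree.
Local Notation Om := (chain_space G).
Local Notation P := (chain_prob G T0).
Local Notation X := (@jumpc R lambda mu w G).
Local Notation H := (@hold R lambda mu w G).
Local Notation c_ := (exit_rate lambda mu w).

(** The moves out of [T] with their rates, which turn sums over all target trees into finite
    sums. *)
Definition succs (T : tree) : seq (R * tree) :=
  [seq (lambda, add_child T u) | u <- enum_fset T] ++
  [seq (mu, remove T u) | u <- enum_fset T & deletable w T u].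

Lemma succs_ge0 T p : p \in succs T -> 0 <= p.1.
Proof. by rewrite mem_cat => /orP[] /mapP[u _ ->] /=; exact: ltW. Qed.

Lemma exit_rateE T : c_ T = \sum_(p <- succs T) p.1.
Proof.
rewrite big_cat /= !big_map big_filter /exit_rate /=.
by rewrite !big_const_seq /= !iter_addr_0 !mulr_natr count_predT.
Qed.

Lemma rateE T T' : rate lambda mu w T T' = \sum_(p <- succs T) p.1 * (T' == p.2)%:R.
Proof.
rewrite /rate big_cat /= !big_map big_filter /= !mulr_sumr; congr (_ + _).
  by apply: eq_big_seq => u uT; rewrite -add_childE.
by apply: eq_bigr => u /and3P[u0 _ lu]; rewrite -removeE.
Qed.

Lemma genE f T : gen lambda mu w f T = \sum_(p <- succs T) p.1 * (f p.2 - f T).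
Proof.
by rewrite /gen big_cat /= !big_map big_filter /= !mulr_sumr.
Qed.

Lemma exit_rate_ge T : lambda <= c_ T.
Proof.
rewrite /exit_rate -[leLHS]addr0 lerD//; last by rewrite mulr_ge0// ltW.
by rewrite ler_peMr ?ler1n ?(perm_size (perm_to_rem (root_in_tree T)))// ltW.
Qed.

Lemma exit_rate_gt0 T : 0 < c_ T.
Proof. exact: lt_le_trans (exit_rate_ge T). Qed.

Lemma exit_rate_le T : c_ T <= (lambda + mu) * #|` T|%:R.
Proof.
rewrite /exit_rate mulrDl lerD// ler_pM2l// ler_nat.
exact: count_size.
Qed.

(** Note the shift: the trees up to the [n]-th are fixed, but only the [n] holding times before it
    are constrained, so that [H n] is still free given the past. *)
Definition cylinder n (t : nat -> tree) (s : nat -> R) : set Om :=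
  [set om | (forall k, (k <= n)%N -> X k om = t k) /\
            (forall k, (k < n)%N -> s k < H k om)].

Definition cylinders n : set (set Om) :=
  [set D | D = set0 \/ exists t s, (forall k, 0 <= s k) /\ D = cylinder n t s].

Definition past n := g_sigma_algebraType (cylinders n).

Lemma measurable_cylinder n t s : measurable (cylinder n t s).
Proof.
rewrite (_ : cylinder n t s = \bigcap_(k in `I_n.+1) [set om | X k om = t k] `&`
   \bigcap_(k in `I_n) (H k) @^-1` `]s k, +oo[%classic); last first.
  apply/seteqP; split => om [h1 h2]; split => k /= kn.
  - exact: h1.
  - by rewrite in_itv /= andbT; exact: h2.
  - exact: h1.
  - by have := h2 k kn; rewrite /= in_itv /= andbT.
apply: measurableI; apply: fin_bigcap_measurable => // k _.
  exact: jumpc_measurable.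
by rewrite -[X in measurable X]setTI; exact: hold_measurable.
Qed.

Lemma cylinders_measurable n : cylinders n `<=` measurable.
Proof. by move=> D [->|[t [s [_ ->]]]] //; exact: measurable_cylinder. Qed.

Lemma past_measurable n (D : set Om) : @measurable _ (past n) D -> measurable D.
Proof.
apply: smallest_sub; [exact: sigma_algebra_measurable|exact: cylinders_measurable].
Qed.

Lemma cylinder_past n t s : (forall k, 0 <= s k) -> @measurable _ (past n) (cylinder n t s).
Proof. by move=> s0; apply: sub_gen_smallest; right; exists t, s. Qed.

Lemma setI_cylinders n : setI_closed (cylinders n).
Proof.
move=> C D [->|[t [s [s0 ->]]]]; first by rewrite set0I; left.
move=> [->|[t' [s' [s0' ->]]]]; first by rewrite setI0; left.
have [tt'|] := pselect (forall k, (k <= n)%N -> t k = t' k); last first.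
  move=> tt'; left; rewrite -subset0 => om [[h _] [h' _]]; apply: tt' => k kn.
  by rewrite -h// -h'.
right; exists t, (fun k => Num.max (s k) (s' k)); split.
  by move=> k; rewrite le_max s0.
apply/seteqP; split => om /=.
  by move=> [[h1 h2] [h3 h4]]; split => // k kn; rewrite gt_max h2// h4.
move=> [h1 h2]; split; split => // k kn.
- by have := h2 k kn; rewrite gt_max => /andP[].
- by rewrite -tt'// h1.
- by have := h2 k kn; rewrite gt_max => /andP[].
Qed.

(** An enumeration of finite paths. It makes countably many cylinders cover the space, and reduces
    measurability with respect to the past to cylinders. *)
Definition path_code (i : nat) : nat -> tree := 
  nth root_tree (odflt [::] (@choice.unpickle (seq tree) i)).

Lemma cylinder_cover n : \bigcup_i cylinder n (path_code i) (fun=> 0) = setT.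
Proof.
apply/seteqP; split => // om _.
exists (choice.pickle (mkseq (fun k => X k om) n.+1)) => //; split => k kn; last exact: hold_gt0.
by rewrite /path_code choice.pickleK nth_mkseq.
Qed.

Lemma past_path n (Q : (nat -> tree) -> Prop) :
  (forall t t', (forall k, (k <= n)%N -> t k = t' k) -> Q t -> Q t') ->
  @measurable _ (past n) [set om | Q (fun k => X k om)].
Proof.
move=> HQ.
rewrite (_ : [set om | _] = \bigcup_(i in [set i | Q (path_code i)])
    cylinder n (path_code i) (fun=> 0)).
  by apply: bigcup_measurable => i _; exact: cylinder_past.
apply/seteqP; split => om /=.
  have : (\bigcup_i cylinder n (path_code i) (fun=> 0)) om by rewrite cylinder_cover.
  move=> [i _ [h1 h2]] Qom; exists i; last by split.
  exact: HQ Qom.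
by move=> [i Qi [h1 h2]]; apply: HQ Qi => k kn; rewrite h1.
Qed.

Lemma past_hold n k : (k < n)%N -> measurable_fun (setT : set (past n)) (H k : past n -> R).
Proof.
move=> kn; apply: (measurability (@RGenOInfty.G R)); first exact: RGenOInfty.measurableE.
move=> _ [_ [x ->] <-]; rewrite setTI.
rewrite (_ : _ @^-1` _ = \bigcup_i cylinder n (path_code i)
    (fun j => if j == k then Num.max x 0 else 0)).
  apply: bigcupT_measurable => i; apply: cylinder_past => j.
  by case: ifP => // _; rewrite le_max lexx orbT.
apply/seteqP; split => om /=.
  rewrite in_itv /= andbT => xH.
  have : (\bigcup_i cylinder n (path_code i) (fun=> 0)) om by rewrite cylinder_cover.
  move=> [i _ [h1 h2]]; exists i => //; split => // j jn.
  by case: eqP => [->|_]; [rewrite gt_max xH hold_gt0|exact: hold_gt0].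
by move=> [i _ [_ /(_ k kn)]]; rewrite eqxx gt_max in_itv /= andbT => /andP[].
Qed.

Lemma past_succ n (D : set Om) : @measurable _ (past n) D -> @measurable _ (past n.+1) D.
Proof.
apply: smallest_sub => /=; first exact: (@sigma_algebra_measurable _ (past n.+1)).
move=> _ [->|[t [s [s0 ->]]]]; first exact: (@measurable0 _ (past n.+1)).
rewrite (_ : cylinder n t s = \bigcup_i (cylinder n.+1 (fun k => if (k <= n)%N then t k
    else path_code i k) (fun k => if (k < n)%N then s k else 0))).
  by apply: bigcupT_measurable => i; apply: cylinder_past => j; case: ifP.
apply/seteqP; split => om /=.
  move=> [h1 h2].
  have : (\bigcup_i cylinder n.+1 (path_code i) (fun=> 0)) om by rewrite cylinder_cover.
  move=> [i _ [h3 h4]]; exists i => //; split => k kn.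
    by case: ifP => kn'; [exact: h1|exact: h3].
  by case: ifP => kn'; [exact: h2|exact: hold_gt0].
move=> [i _ [h1 h2]]; split => k kn.
  by rewrite h1 ?(leq_trans kn)// kn.
by have := h2 k (leq_trans kn (leqnSn _)); rewrite kn.
Qed.

(** Both sides are finite measures in [E]. They agree on cylinders by [chain_law], and cylinders
    form a generating class of the past closed under intersection. *)
Lemma markov n (E : set Om) x x' (r : R) : @measurable _ (past n) E -> 0 <= r ->
  (P (E `&` [set om | X n om = x] `&` [set om | X n.+1 om = x'] `&` [set om | (r < H n om)%R]) =
  (rate lambda mu w x x' / c_ x * expR (- (c_ x * r)))%:E *
    P (E `&` [set om | X n om = x]))%E.
Proof.
move=> mE r0.
have k0 : 0 <= rate lambda mu w x x' / c_ x * expR (- (c_ x * r)).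
  rewrite mulr_ge0 ?expR_ge0// divr_ge0 ?(ltW (exit_rate_gt0 x))// rateE.
  by rewrite big_seq sumr_ge0// => p /succs_ge0 p0; rewrite mulr_ge0.
have mX m y : measurable [set om | X m om = y] by exact: jumpc_measurable.
have mD : measurable ([set om | X n om = x] `&` [set om | X n.+1 om = x'] `&`
    [set om | r < H n om]).
  apply: measurableI; first exact: measurableI.
  rewrite (_ : [set om | _] = H n @^-1` `]r, +oo[%classic); last first.
    by apply/seteqP; split => om /=; rewrite in_itv /= andbT.
  by rewrite -[X in measurable X]setTI; exact: hold_measurable.
pose m1 := measure_function_mrestr__canonical__measure_function_Measure P mD.
pose m2 := measure_function_mscale__canonical__measure_function_Measure (NngNum k0)
  (mrestr P (mX n x)).
have m1E D : m1 D = P (D `&` ([set om | X n om = x] `&` [set om | X n.+1 om = x'] `&`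
    [set om | r < H n om])) by [].
have m2E D : m2 D = ((rate lambda mu w x x' / c_ x * expR (- (c_ x * r)))%:E *
    P (D `&` [set om | X n om = x]))%E by [].
rewrite -m2E -!setIA [X in E `&` X]setIA -m1E.
refine (@g_sigma_algebra_measure_unique _ R _ (cylinders n) (@cylinders_measurable n)
  (fun i => cylinder n (path_code i) (fun=> 0)) _ (cylinder_cover n) m1 m2
  (@setI_cylinders n) _ _ E mE).
- by move=> i; right; exists (path_code i), (fun=> 0).
- move=> _ [->|[t [s [s0 ->]]]]; first by rewrite !measure0.
  rewrite m1E m2E.
  have [tx|tx] := eqVneq (t n) x; last first.
    rewrite [X in P X](_ : _ = set0); last first.
      by rewrite -subset0 => om [[/(_ n (leqnn _)) h _] [[/= h' _] _]]; move/eqP: tx; rewrite -h.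
    rewrite [X in (_ * P X)%E](_ : _ = set0) ?measure0 ?mule0//.
    by rewrite -subset0 => om [[/(_ n (leqnn _)) h _] /= h']; move/eqP: tx; rewrite -h.
  (* The path is prolonged by [x'] and the constraints by the level [r] for the [n]-th holding time.
     A level 0 is no constraint, as holding times are positive. *)
  pose t' k := if (k <= n)%N then t k else x'.
  pose s' k := if (k < n)%N then s k else if k == n then r else 0.
  pose s'' k := if (k < n)%N then s k else 0.
  rewrite [X in P X](_ : _ = [set om | forall k, (k <= n.+1)%N -> X k om = t' k /\ s' k < H k om]);
      last first.
    apply/seteqP; split => om /=.
      move=> [[h1 h2] [[h3 h4] h5]] k; rewrite /t' /s'; case: (ltngtP k n) => [kn|kn|->].
      - by move=> _; split; [apply: h1; exact: ltnW|exact: h2].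
      - move=> kn'; have -> : k = n.+1 by apply/eqP; rewrite eqn_leq kn' kn.
        by split => //; exact: hold_gt0.
      - by rewrite h3 tx.
    move=> h; split; [split => k kn|split; [split|]].
    - by have [-> _] := h k (leqW kn); rewrite /t' kn.
    - by have [_] := h k (leqW (ltnW kn)); rewrite /s' kn.
    - by have [-> _] := h n (leqnSn n); rewrite /t' leqnn.
    - by have [-> _] := h n.+1 (leqnn _); rewrite /t' ltnn.
    - by have [_] := h n (leqnSn n); rewrite /s' ltnn eqxx.
  rewrite [X in (_ * P X)%E](_ : _ = [set om | forall k, (k <= n)%N -> X k om = t k /\ s'' k < H k om]);
      last first.
    apply/seteqP; split => om /=.
      move=> [[h1 h2] h3] k kn; split; first exact: h1.
      by rewrite /s''; case: ifP => kn'; [exact: h2|exact: hold_gt0].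
    move=> h; split; [split => k kn|].
    - by have [] := h k kn.
    - by have [_] := h k (ltnW kn); rewrite /s'' kn.
    - by have [-> _] := h n (leqnn n).
  rewrite !chain_law; last 2 first.
  - by move=> k _; rewrite /s''; case: ifP.
  - by move=> k _; rewrite /s'; case: ifP => // _; case: ifP.
  rewrite -EFinM; congr EFin.
  rewrite [X in _ * X * _]big_ord_recr /=.
  rewrite [X in _ * X = _]big_ord_recr /= [X in _ * (X * _) = _]big_ord_recr /=.
  rewrite [X in _ = _ * (_ * X)]big_ord_recr /=.
  have -> : t' 0%N = t 0%N by [].
  have -> : t' n = x by rewrite /t' leqnn.
  have -> : t' n.+1 = x' by rewrite /t' ltnn.
  have -> : s' n = r by rewrite /s' ltnn eqxx.
  have -> : s' n.+1 = 0 by rewrite /s' ltnNge leqnSn /= eqn_leq ltnn.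
  have -> : s'' n = 0 by rewrite /s'' ltnn.
  rewrite !mulr0 oppr0 expR0 !mulr1.
  have -> : \prod_(i < n) (rate lambda mu w (t' i) (t' i.+1) / c_ (t' i)) =
      \prod_(k < n) (rate lambda mu w (t k) (t k.+1) / c_ (t k)).
    by apply: eq_bigr => i _; rewrite /t' (ltnW (ltn_ord i)) (ltn_ord i).
  have -> : \prod_(i < n) expR (- (c_ (t' i) * s' i)) = \prod_(i < n) expR (- (c_ (t i) * s'' i)).
    by apply: eq_bigr => i _; rewrite /t' /s' /s'' (ltnW (ltn_ord i)) (ltn_ord i).
  move: (_ / c_ x) (expR _) (\prod_(i < n) _) (\prod_(i < n) _) (_%:R) => a b c d e.
  by clear - a b c d e; ring.
- move=> i; apply: (@le_lt_trans _ _ 1%E); last exact: ltry.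
  rewrite m1E; apply: probability_le1; apply: measurableI => //.
  exact: measurable_cylinder.
Qed.

Local Open Scope ereal_scope.

Definition tsum (h : tree -> \bar R) : \bar R :=
  \sum_(0 <= i <oo) oapp h 0 (choice.pickle_inv i).

Lemma eq_tsum g h : (forall y, g y = h y) -> tsum g = tsum h.
Proof. by move=> gh; congr tsum; apply/funext. Qed.

Lemma tsum_delta (a : R) z (I : tree -> \bar R) : (0 <= a)%R -> (forall y, 0 <= I y) ->
  tsum (fun y => (a * (y == z)%:R)%:E * I y) = a%:E * I z.
Proof.
move=> a0 I0; rewrite /tsum (@nneseries_split _ _ 0%N (choice.pickle z).+1); last first.
  by move=> i _; case: (choice.pickle_inv i) => //= y; rewrite mule_ge0// lee_fin mulr_ge0.
rewrite eseries0; last first.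
  move=> i; rewrite add0n => zi _; case E : (choice.pickle_inv i) => [y|]//=.
  have := @choice.pickle_invK tree i; rewrite E /= => yi.
  case: eqP => [yz|]; last by rewrite mulr0 mul0e.
  by move: zi; rewrite -yi yz ltnn.
rewrite adde0 add0n big_nat_recr//= big_nat big1 ?add0e.
  by rewrite choice.pickleK_inv /= eqxx mulr1.
move=> i /andP[_ iz]; case E : (choice.pickle_inv i) => [y|]//=.
have := @choice.pickle_invK tree i; rewrite E /= => yi.
case: eqP => [yz|]; last by rewrite mulr0 mul0e.
by move: iz; rewrite -yi yz ltnn.
Qed.

Lemma tsum_sum (I : eqType) (s : seq I) (h : I -> tree -> \bar R) :
  (forall p y, p \in s -> 0 <= h p y) ->
  tsum (fun y => \sum_(p <- s) h p y) = \sum_(p <- s) tsum (h p).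
Proof.
elim: s => [|p s IH] h0.
  rewrite big_nil; apply: eseries0 => i _ _; case: (choice.pickle_inv i) => //= y.
  by rewrite big_nil.
have h0' q y : q \in s -> 0 <= h q y by move=> qs; rewrite h0// inE qs orbT.
rewrite big_cons -IH// /tsum -nneseriesD; last 2 first.
- by move=> i _ _; case: (choice.pickle_inv i) => //= y; rewrite h0// mem_head.
- move=> i _ _; case: (choice.pickle_inv i) => //= y.
  by rewrite big_seq; apply: sume_ge0 => q qs; exact: h0'.
apply: eq_eseriesr => i _; case: (choice.pickle_inv i) => [y|] /=; last by rewrite adde0.
by rewrite big_cons.
Qed.

Lemma integral_tree_partition (D : set Om) (Y : Om -> tree) (g : Om -> \bar R) :
  measurable D -> (forall y, measurable [set om | Y om = y]) ->
  measurable_fun D g -> (forall om, 0 <= g om) ->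
  \int[P]_(om in D) g om = tsum (fun y => \int[P]_(om in D `&` [set om | Y om = y]) g om).
Proof.
move=> mD mY mg g0.
pose F i := D `&` [set om | choice.pickle (Y om) = i].
have FE i : F i = if choice.pickle_inv i is Some y then D `&` [set om | Y om = y] else set0.
  rewrite /F; case E : (choice.pickle_inv i) => [y|].
    congr (_ `&` _); apply/seteqP; split => om /=; last first.
      by have := @choice.pickle_invK tree i; rewrite E /= => <- ->.
    by move=> ei; move: E; rewrite -ei choice.pickleK_inv => -[].
  rewrite -subset0 => om [_ /= ei]; move: E; rewrite -ei choice.pickleK_inv//.
have DF : D = \bigcup_i F i.
  apply/seteqP; split => om; first by move=> Dom; exists (choice.pickle (Y om)).
  by move=> [i _ []].
rewrite [in LHS]DF ge0_integral_bigcup//.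
- apply: eq_eseriesr => i _; rewrite FE; case: (choice.pickle_inv i) => //=.
  exact: integral_set0.
- move=> i; rewrite FE; case: (choice.pickle_inv i) => // y; exact: measurableI.
- by rewrite -DF.
- move=> i j _ _ [om [[_ /= <-] [_ /= <-]]] //.
Qed.

Lemma measurable_fun_tree (Y : Om -> tree) d' (T : measurableType d') (g : Om -> T) :
  (forall y, measurable [set om | Y om = y]) ->
  (forall y, measurable_fun [set om | Y om = y] g) -> measurable_fun setT g.
Proof.
move=> mY mg.
have -> : setT = \bigcup_i (if @choice.unpickle tree i is Some y then [set om | Y om = y] else set0).
  apply/seteqP; split => // om _; exists (choice.pickle (Y om)) => //.
  by rewrite choice.pickleK.
apply/measurable_fun_bigcup => i; first by case: (choice.unpickle i).
case: (choice.unpickle i) => //; exact: measurable_fun_set0.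
Qed.

(** The conditional expectation of [f x y (k, h)], where [y] is the tree after [x] and [h] the
    holding time in [x]. *)
Definition step (f : tree -> tree -> R * R -> \bar R) (x : tree) (k : R) : \bar R :=
  \sum_(p <- succs x) (p.1 / c_ x)%:E *
    \int[lebesgue_measure]_y (f x p.2 (k, y) * (exponential_pdf (c_ x) y)%:E).

Section OneStep.
Variables (n : nat) (E : set Om) (K : Om -> R) (f : tree -> tree -> R * R -> \bar R).
Hypotheses (mE : @measurable _ (past n) E).
Hypothesis (mK : measurable_fun (setT : set (past n)) (K : past n -> R)).
Hypotheses (mf : forall x y, measurable_fun setT (f x y)) (f0 : forall x y z, 0 <= f x y z).

Let mK' : measurable_fun setT K.
Proof. by move=> _ U mU; apply: past_measurable; exact: mK. Qed.

Let mX m y : measurable [set om | X m om = y].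
Proof. exact: jumpc_measurable. Qed.

Let I x y k := \int[lebesgue_measure]_z (f x y (k, z) * (exponential_pdf (c_ x) z)%:E).

Let I0 x y k : 0 <= I x y k.
Proof.
apply: integral_ge0 => z _; rewrite mule_ge0// lee_fin exponential_pdf_ge0//.
exact: ltW (exit_rate_gt0 x).
Qed.

Let mI x y : measurable_fun setT (I x y).
Proof.
apply: (measurable_fun_integral2 (g := fun kz : R * R => f x y kz * (exponential_pdf (c_ x) kz.2)%:E)); last first.
  by move=> z; rewrite mule_ge0// lee_fin exponential_pdf_ge0// ltW// exit_rate_gt0.
apply: emeasurable_funM; first exact: mf.
apply/measurable_EFinP; apply: measurableT_comp; last exact: measurable_snd.
exact: measurable_exponential_pdf.
Qed.

Lemma measurable_step x : measurable_fun setT (step f x).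
Proof.
apply: emeasurable_sum => p; apply: emeasurable_funM => //; exact: mI.
Qed.

Lemma step_ge0 x k : 0 <= step f x k.
Proof.
rewrite /step big_seq; apply: sume_ge0 => p /succs_ge0 p0.
by rewrite mule_ge0//; [rewrite lee_fin divr_ge0// ltW// exit_rate_gt0|exact: I0].
Qed.

Lemma measurable_transition :
  measurable_fun setT (fun om => f (X n om) (X n.+1 om) (K om, H n om)).
Proof.
apply: (@measurable_fun_tree (X n)) => // x.
suff : measurable_fun setT (fun om => f x (X n.+1 om) (K om, H n om)).
  move=> /(measurable_funTS (D := [set om | X n om = x])).
  apply: eq_measurable_fun => om.
  by rewrite in_setE /= => ->.
apply: (@measurable_fun_tree (X n.+1)) => // y.
suff : measurable_fun setT (fun om => f x y (K om, H n om)).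
  move=> /(measurable_funTS (D := [set om | X n.+1 om = y])).
  apply: eq_measurable_fun => om.
  by rewrite in_setE /= => ->.
apply: measurableT_comp; first exact: mf.
apply: measurable_fun_pair => //; exact: hold_measurable.
Qed.

(** After a partition according to the trees at [n] and [n.+1], [markov] makes [H n] exponential and
    independent of [K] on each piece. *)
Lemma one_step : \int[P]_(om in E) f (X n om) (X n.+1 om) (K om, H n om) =
  \int[P]_(om in E) step f (X n om) (K om).
Proof.
have mE' := past_measurable mE.
have mstep : measurable_fun setT (fun om => step f (X n om) (K om)).
  apply: (@measurable_fun_tree (X n)) => // x.
  have : measurable_fun setT (fun om => step f x (K om)).
    by apply: measurableT_comp => //; exact: measurable_step.
  move=> /(measurable_funTS (D := [set om | X n om = x])).
  by apply: eq_measurable_fun => om; rewrite in_setE /= => ->.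
rewrite (@integral_tree_partition _ (X n))//; last exact: measurable_funTS measurable_transition.
rewrite [RHS](@integral_tree_partition _ (X n))//; last 2 first.
- exact: measurable_funTS.
- by move=> om; exact: step_ge0.
apply: eq_tsum => x; set A := E `&` _.
have mA : measurable A by exact: measurableI.
rewrite (@integral_tree_partition _ (X n.+1))//; last first.
  by apply: measurable_funTS; exact: measurable_transition.
pose J y := \int[P]_(om in A) I x y (K om).
have J0 y : 0 <= J y by apply: integral_ge0 => om _; exact: I0.
have ck p : p \in succs x -> (0 <= p.1 / c_ x)%R.
  by move=> /succs_ge0 p0; rewrite divr_ge0// ltW// exit_rate_gt0.
transitivity (tsum (fun y => \sum_(p <- succs x) (p.1 / c_ x * (y == p.2)%:R)%:E * J y)).
  apply: eq_tsum => y.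
  transitivity (\int[P]_(om in A `&` [set om | X n.+1 om = y]) f x y (K om, H n om)).
    by apply: eq_integral => om; rewrite in_setE => -[[_ /= ->] /= ->].
  have k0 : (0 <= rate lambda mu w x y / c_ x)%R.
    rewrite divr_ge0 ?(ltW (exit_rate_gt0 x))// rateE.
    by rewrite big_seq sumr_ge0// => p /succs_ge0 p0; rewrite mulr_ge0.
  rewrite (@integral_indep_exponential _ _ _ P A _ K (H n) (rate lambda mu w x y / c_ x) (c_ x) (f x y))//.
  - rewrite -/(J y) rateE mulr_suml big_seq [RHS]big_seq -ge0_sume_distrl; last first.
      by move=> p /ck; rewrite lee_fin => /mulr_ge0 ->.
    by rewrite sumEFin; congr (_%:E * _); apply: eq_bigr => p _; rewrite mulrAC.
  - exact: measurableI.
  - exact: hold_measurable.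
  - exact: hold_gt0.
  - exact: exit_rate_gt0.
  - move=> U r mU r0.
    have mEU : @measurable _ (past n) (E `&` K @^-1` U).
      apply: measurableI => //; rewrite -[X in measurable X]setTI; exact: mK.
    rewrite setIA (_ : A `&` _ `&` K @^-1` U = E `&` K @^-1` U `&` [set om | X n om = x] `&`
      [set om | X n.+1 om = y]); last by rewrite /A; apply/seteqP; split => om /=; tauto.
    rewrite markov//; congr (_ * P _).
    by rewrite /A; apply/seteqP; split => om /=; tauto.
rewrite tsum_sum; last first.
  by move=> p y /ck p0; rewrite mule_ge0// lee_fin mulr_ge0.
transitivity (\int[P]_(om in A) \sum_(p <- succs x) (p.1 / c_ x)%:E * I x p.2 (K om)); last first.
  by apply: eq_integral => om; rewrite in_setE => -[_ /= ->].
(* The absolute values make every summand nonnegative, also for pairs [p] outside [succs x]. *)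
have abs k : step f x k = \sum_(p <- succs x) `|p.1 / c_ x|%:E * I x p.2 k.
  by apply: eq_big_seq => p /ck /ger0_norm ->.
under [RHS]eq_integral do rewrite -/(step f x _) abs.
rewrite ge0_integral_sum//.
- apply: eq_big_seq => p /ck p0; rewrite tsum_delta// ge0_integralZl//.
  + by rewrite ger0_norm.
  + by apply: measurable_funTS; apply: measurableT_comp.
- by move=> p; apply: emeasurable_funM => //; apply: measurable_funTS; apply: measurableT_comp.
- by move=> p om _; rewrite mule_ge0// lee_fin.
Qed.

End OneStep.

End Chain.

(** * Non-explosion *)

Section Explosion.
Local Open Scope ereal_scope.
Context {R : realType}.
Variables (lambda mu : R) (w : vertex) (G : tree_chain lambda mu w).
Hypotheses (l0 : (0 < lambda)%R) (m0 : (0 < mu)%R).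
Variable T0 : tree.
Local Notation Om := (chain_space G).
Local Notation P := (chain_prob G T0).
Local Notation X := (@jumpc R lambda mu w G).
Local Notation H := (@hold R lambda mu w G).
Local Notation J := (@jump_time R lambda mu w G).
Local Notation c_ := (exit_rate lambda mu w).
Local Notation succs := (succs lambda mu w).

Let c0 T : (0 < c_ T)%R. Proof. exact: exit_rate_gt0. Qed.

Lemma jump_timeS n om : J n.+1 om = (J n om + H n om)%R.
Proof. by rewrite /jump_time big_ord_recr. Qed.

Lemma le_jump_time m n om : (m <= n)%N -> (J m om <= J n om)%R.
Proof.
elim: n => [|n IH]; first by rewrite leqn0 => /eqP ->.
rewrite leq_eqVlt => /predU1P[->//|/IH h].
by rewrite jump_timeS (le_trans h)// lerDl ltW// hold_gt0.
Qed.

Lemma jump_time_ge0 n om : (0 <= J n om)%R.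
Proof. by have := le_jump_time om (leq0n n); rewrite {1}/jump_time big_ord0. Qed.

Lemma past_jump_time n k : (k <= n)%N ->
  measurable_fun (setT : set (past G n)) (J k : past G n -> R).
Proof.
move=> kn; apply: measurable_sum => i; apply: past_hold.
exact: leq_trans (ltn_ord i) kn.
Qed.

Lemma past_elapsed m n : (m <= n)%N ->
  measurable_fun (setT : set (past G n)) ((fun om => (J n om - J m om)%R) : past G n -> R).
Proof. by move=> mn; apply: measurable_funB; exact: past_jump_time. Qed.

Lemma past_measurable_fun n (K : Om -> R) :
  measurable_fun (setT : set (past G n)) (K : past G n -> R) -> measurable_fun setT K.
Proof. by move=> mK _ U mU; apply: past_measurable; exact: mK. Qed.

Lemma measurable_jump_time n : measurable_fun setT (J n).
Proof. exact: past_measurable_fun (past_jump_time (leqnn n)). Qed.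

Lemma sum_rates T (r : R) : \sum_(p <- succs T) (p.1 / c_ T)%:E * r%:E = r%:E.
Proof.
under eq_bigr do rewrite -EFinM.
by rewrite sumEFin -mulr_suml -mulr_suml -exit_rateE divff ?gt_eqF// mul1r.
Qed.

Lemma chain_start : {ae P, forall om, X 0%N om = T0}.
Proof.
exists (~` [set om | X 0%N om = T0]); split => //.
  by apply: measurableC; exact: jumpc_measurable.
have -> : P (~` [set om | X 0%N om = T0]) = 1 - P [set om | X 0%N om = T0].
  by rewrite probability_setC//; exact: jumpc_measurable.
have := @chain_law _ _ _ _ G T0 0%N (fun=> T0) (fun=> 0%R) (fun _ _ => lexx _).
rewrite (_ : [set om | _] = [set om | X 0%N om = T0]); last first.
  apply/seteqP; split => om /=; first by move=> /(_ 0%N (leqnn _))[].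
  by move=> h k; rewrite leqn0 => /eqP ->; split => //; exact: hold_gt0.
move=> ->; rewrite big_ord0 big_ord1 eqxx mulr0 oppr0 expR0 !mulr1 subee//.
Qed.

Definition legal (om : Om) := X 0%N om = T0 /\
  forall n, X n.+1 om \in map snd (succs (X n om)).

(** The indicator of a transition outside [succs] has one-step expectation 0. *)
Lemma ae_legal : {ae P, forall om, legal om}.
Proof.
have tr n : {ae P, forall om, X n.+1 om \in map snd (succs (X n om))}.
  pose f (x y : tree) (z : R * R) : \bar R := (y \notin map snd (succs x))%:R%:E.
  have mf x y : measurable_fun setT (f x y) by exact: measurable_cst.
  have f0 x y z : 0 <= f x y z by rewrite lee_fin.
  have mK : measurable_fun (setT : set (past G n)) ((fun=> 0%R) : past G n -> R).
    exact: measurable_cst.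
  have := one_step l0 m0 T0 (measurableT : @measurable _ (past G n) setT) mK mf f0.
  rewrite [RHS](_ : _ = 0); last first.
    apply: integral0_eq => om _; rewrite /step big1_seq// => p /andP[_ ps].
    rewrite integral0_eq ?mule0// => y _; rewrite /f.
    by rewrite (_ : p.2 \notin _ = false) ?mul0e//; apply/negbTE; rewrite negbK map_f.
  have mt := measurable_transition mK mf.
  move=> f_eq0; have [+ _] := ae_eq_integral_abs P measurableT mt.
  have -> : \int[P]_om `|f (X n om) (X n.+1 om) (0%R, H n om)| = 0.
    by rewrite -f_eq0; apply: eq_integral => om _; rewrite gee0_abs.
  move=> /(_ erefl); apply: filterS => om /(_ Logic.I) /=; rewrite /f.
  by case: (_ \in _) => // -[] /eqP; rewrite oner_eq0.
have : {ae P, forall om, forall n, X n.+1 om \in map snd (succs (X n om))}.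
  exact: ae_foralln.
by have := chain_start; apply: filterS2 => om; split.
Qed.

Lemma legal_size n om : legal om -> (#|` X n om| <= #|` T0| + n)%N.
Proof.
move=> [h0 h]; elim: n => [|n IH]; first by rewrite h0 addn0.
have := h n; move: IH; rewrite addnS; move: (X n om) (X n.+1 om) => x y IH.
move=> /mapP[p]; rewrite mem_cat => /orP[] /mapP[u].
  by move=> us -> ->; rewrite /= card_add_child.
by move=> _ -> -> /=; rewrite (leq_trans (card_remove _ _))// leqW.
Qed.

Lemma frac_le (x y : R) : (0 <= x -> x <= y -> x / (x + 1) <= y / (y + 1))%R.
Proof.
move=> x0 xy; have p1 : (0 < x + 1)%R by rewrite ltr_wpDl.
have p2 : (0 < y + 1)%R by rewrite ltr_wpDl// (le_trans x0).
rewrite (ler_pdivrMr _ _ p1) mulrAC (ler_pdivlMr _ _ p2).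
by rewrite !mulrDr !mulr1 (mulrC y) lerD2l.
Qed.

Lemma exponential_mean_expN (c : R) : (0 < c)%R ->
  \int[lebesgue_measure]_y ((expR (- y))%:E * (exponential_pdf c y)%:E) = (c / (c + 1))%:E.
Proof.
move=> c1.
have c2 : (0 < c + 1)%R by rewrite addr_gt0.
transitivity (\int[lebesgue_measure]_y ((c / (c + 1))%:E * (exponential_pdf (c + 1) y)%:E)).
  apply: eq_integral => y _; rewrite -!EFinM; congr EFin.
  have [y0|y0] := ltP y 0%R; first by rewrite !lt0_exponential_pdf// !mulr0.
  rewrite !exponential_pdfE// [RHS]mulrA divfK ?gt_eqF// mulrCA; congr (_ * _)%R.
  by rewrite -expRD; congr expR; rewrite !mulNr mulrDl mul1r opprD addrC.
rewrite ge0_integralZl//.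
- by rewrite integral_exponential_pdf// mule1.
- by apply/measurable_EFinP; exact: measurable_exponential_pdf.
- by move=> y _; rewrite lee_fin exponential_pdf_ge0// ltW.
- by rewrite lee_fin divr_ge0// ltW.
Qed.

Let a_ n := \int[P]_om (expR (- J n om))%:E.
Let C_ n := ((lambda + mu) * (#|` T0| + n)%:R)%R.

Let C0 n : (0 <= C_ n)%R.
Proof. by rewrite mulr_ge0// addr_ge0// ltW. Qed.

Let measurable_expN n : measurable_fun setT (fun om => (expR (- J n om))%:E).
Proof.
apply/measurable_EFinP; apply: measurableT_comp => //.
apply: measurableT_comp => //; exact: measurable_jump_time.
Qed.

Let a_succ n : a_ n.+1 <= ((C_ n / (C_ n + 1))%:E * a_ n).
Proof.
pose f (x y : tree) (z : R * R) : \bar R := (expR (- (z.1 + z.2)))%:E.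
have mf x y : measurable_fun setT (f x y).
  apply/measurable_EFinP; apply: measurableT_comp => //; apply: measurableT_comp => //.
  exact: measurable_funD.
have f0 x y z : 0 <= f x y z by rewrite lee_fin expR_ge0.
have mK := past_jump_time (leqnn n).
have := one_step l0 m0 T0 (measurableT : @measurable _ (past G n) setT) mK mf f0.
rewrite /f /=.
under eq_integral do rewrite -jump_timeS.
rewrite -/(a_ n.+1) => ->.
have stepE x k : step lambda mu w f x k = (expR (- k) * (c_ x / (c_ x + 1)))%:E.
  rewrite /step.
  under eq_bigr => p _.
    have -> : \int[lebesgue_measure]_y (f x p.2 (k, y) * (exponential_pdf (c_ x) y)%:E) =
        (expR (- k) * (c_ x / (c_ x + 1)))%:E.
      rewrite EFinM -exponential_mean_expN// -ge0_integralZl//.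
      - by apply: eq_integral => y _; rewrite /f /= opprD expRD -!EFinM mulrA.
      - apply/measurable_EFinP; apply: measurable_funM; last exact: measurable_exponential_pdf.
        by apply: measurableT_comp => //; exact: measurableT_comp.
      - by move=> y _; rewrite lee_fin mulr_ge0 ?expR_ge0// exponential_pdf_ge0// ltW.
    over.
  exact: sum_rates.
under eq_integral do rewrite stepE.
rewrite -ge0_integralZl//; last by rewrite lee_fin divr_ge0// addr_ge0.
have frac_ge0 x : (0 <= x -> 0 <= x / (x + 1) :> R)%R by move=> x0; rewrite divr_ge0// addr_ge0.
apply: ae_ge0_le_integral => //.
- by move=> om _; rewrite lee_fin mulr_ge0 ?expR_ge0// frac_ge0// ltW.
- have := measurable_transition (G := G) mK (f := fun x _ z => (expR (- z.1) * (c_ x / (c_ x + 1)))%:E).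
  apply => x _; apply/measurable_EFinP; apply: measurable_funM => //.
  by apply: measurableT_comp => //; exact: measurableT_comp.
- by move=> om _; rewrite -EFinM lee_fin mulr_ge0 ?expR_ge0// frac_ge0.
- exact: emeasurable_funM.
apply: filterS ae_legal => om /(legal_size n) cn _.
rewrite -EFinM lee_fin mulrC ler_wpM2r ?expR_ge0//.
have cC : (c_ (X n om) <= C_ n)%R.
  by rewrite (le_trans (exit_rate_le _ _ m0 _))// ler_wpM2l ?ler_nat// addr_ge0// ltW.
exact: frac_le (ltW (c0 _)) cC.
Qed.

(** Given the past, [exp(- H n)] has mean [c / (c + 1)], with [c] the exit rate. A jump adds at most
    one vertex, so exit rates grow at most linearly in [n], and the product of the factors
    [1 - 1 / (1 + C_ n)] vanishes like the exponential of minus a multiple of the harmonic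
    series. *)
Lemma cvg_mean_expN : a_ n @[n --> \oo] --> 0.
Proof.
pose b k := ((1 + C_ k)^-1)%R.
have b0 k : (0 <= b k)%R by rewrite invr_ge0 addr_ge0.
have a_le n : a_ n <= (expR (- (\sum_(0 <= k < n) b k)))%:E.
  elim: n => [|n IH].
    rewrite big_geq// oppr0 expR0 /a_; under eq_integral do rewrite /jump_time big_ord0 oppr0 expR0.
    by rewrite integral_cst// mul1e probability_le1.
  apply: le_trans (a_succ n) _.
  apply: (@le_trans _ _ ((C_ n / (C_ n + 1))%:E * (expR (- (\sum_(0 <= k < n) b k)))%:E)).
    by apply: lee_wpmul2l => //; rewrite lee_fin divr_ge0// addr_ge0.
  rewrite big_nat_recr//= opprD expRD -EFinM lee_fin mulrC ler_wpM2l ?expR_ge0//.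
  apply: le_trans (expR_ge1Dx _); rewrite /b (addrC 1%R (C_ n)).
  rewrite -[X in (_ <= X - _)%R](@divff _ (C_ n + 1)%R); last by rewrite gt_eqF// ltr_wpDl.
  by rewrite -[X in (_ - X)%R]mul1r -mulrBl addrK.
pose D := ((lambda + mu) * (#|` T0| + 1)%:R + 1)%R.
have D0 : (0 < D)%R by rewrite ltr_wpDl// mulr_ge0// addr_ge0// ltW.
have bh k : (D^-1 * harmonic k <= b k)%R.
  rewrite /b /harmonic /= -invfM lef_pV2 ?posrE ?mulr_gt0//; last by rewrite ltr_wpDr.
  have lm : (0 <= lambda + mu)%R by rewrite addr_ge0// ltW.
  rewrite /C_ /D [leRHS]mulrDl mul1r addrC; apply: lerD; last by rewrite ler1n.
  rewrite -mulrA ler_wpM2l// -natrM ler_nat; lia.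
have hy : series (@harmonic R) n @[n --> \oo] --> +oo%R.
  apply: nondecreasing_dvgn_lt; last exact: dvg_harmonic.
  by apply: nondecreasing_series => // n _ _; exact: harmonic_ge0.
have Dy : expR (- (D^-1 * series (@harmonic R) n)) @[n --> \oo] --> 0%R.
  have Dy : (fun x : R => D^-1 * x)%R x @[x --> +oo%R] --> +oo%R.
    by apply: gt0_cvgMry => //; rewrite invr_gt0.
  exact: (cvg_comp _ _ (cvg_comp _ _ hy Dy) (@cvgr_expR R)).
apply: (@squeeze_cvge _ _ _ _ (fun=> 0) _ (fun n => (expR (- (D^-1 * series (@harmonic R) n)))%:E)).
- apply: nearW => n; rewrite integral_ge0/=; last by move=> om _; rewrite lee_fin expR_ge0.
  apply: le_trans (a_le n) _; rewrite lee_fin ler_expR lerN2 /series /= mulr_sumr.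
  by apply: ler_sum => i _; exact: bh.
- exact: cvg_cst.
- by apply: cvg_EFin => //; exact: nearW.
Qed.

(** On the event [D] that no jump time exceeds [k], [exp(- J n)] stays above [exp(- k)], so its mean
    cannot tend to 0 unless [D] is null. *)
Lemma ae_no_explosion : {ae P, forall om, forall t : R, exists n, (t < J n om)%R}.
Proof.
have H1 (k : nat) : {ae P, forall om, exists n, (k%:R < J n om)%R}.
  pose D := \bigcap_n [set om | (J n om <= k%:R)%R].
  have mJ n : measurable [set om | (J n om <= k%:R)%R].
    rewrite (_ : [set om | _] = J n @^-1` `]-oo, k%:R]%classic); last first.
      by apply/seteqP; split => om /=; rewrite in_itv.
    by rewrite -[X in measurable X]setTI; exact: measurable_jump_time.
  have mD : measurable D by exact: bigcapT_measurable.
  exists D; split => //; last first.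
    move=> om /= h n _ /=; rewrite leNgt; apply/negP => kJ; apply: h; by exists n.
  apply/eqP; rewrite eq_le measure_ge0 andbT.
  have PD n : P D * (expR (- k%:R))%:E <= a_ n.
    rewrite muleC -integral_cst//.
    apply: (@le_trans _ _ (\int[P]_(om in D) (expR (- J n om))%:E)).
      apply: ge0_le_integral => //.
      - by move=> om _; rewrite lee_fin expR_ge0.
      - exact: measurable_funTS.
      - by move=> om /(_ n Logic.I) /= h; rewrite lee_fin ler_expR lerN2.
    by apply: ge0_subset_integral => //.
  have : P D * (expR (- k%:R))%:E <= 0.
    rewrite -(cvg_lim _ cvg_mean_expN)//; apply: lime_ge; first by apply/cvg_ex; exists 0; exact: cvg_mean_expN.
    by apply: nearW.
  by rewrite pmule_lle0// lte_fin expR_gt0.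
apply: filterS (ae_foralln H1) => om h t.
have [n kn] := h (Num.bound `|t|); exists n; apply: le_lt_trans kn.
by rewrite (le_trans (ler_norm t))// ltW// archi_boundP.
Qed.

Lemma measurable_elapsed_le m n (t : R) : measurable [set om | (J n om - J m om <= t)%R].
Proof.
rewrite (_ : [set om | _] = (fun om => J n om - J m om)%R @^-1` `]-oo, t]%classic); last first.
  by apply/seteqP; split => om /=; rewrite in_itv.
rewrite -[X in measurable X]setTI.
by apply: measurable_funB => //; exact: measurable_jump_time.
Qed.

Lemma cvg_elapsed m (t : R) : P [set om | (J n om - J m om <= t)%R] @[n --> \oo] --> 0.
Proof.
pose F n := [set om | (J n om - J m om <= t)%R].
have mF n : measurable (F n) by exact: measurable_elapsed_le.
have mcap : measurable (\bigcap_n F n) by exact: bigcapT_measurable.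
have <- : P (\bigcap_n F n) = 0.
  apply: measure_negligible => //; apply: negligibleS ae_no_explosion => om h /=.
  move=> /(_ (t + J m om)%R) [n]; rewrite ltNge -lerBlDr => /negP; apply; exact: (h n).
apply: (nonincreasing_cvg_mu (F := F)) => //.
  by rewrite (le_lt_trans (probability_le1 _ _))// ltry.
move=> i j ij; apply/subsetPset => om; rewrite /F /=; apply: le_trans.
by rewrite lerD2r le_jump_time.
Qed.

End Explosion.

(** * Identification of solutions of the backward equations *)

Section Verification.
Local Open Scope ereal_scope.
Context {R : realType}.
Variables (lambda mu : R) (w : vertex).
Hypotheses (l0 : (0 < lambda)%R) (m0 : (0 < mu)%R).
Local Notation c_ := (exit_rate lambda mu w).
Local Notation succs := (succs lambda mu w).

Lemma integral_itg (h : R -> R) (a b : R) : lip h ->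
  \int[lebesgue_measure]_(x in `[a, b]) (h x)%:E = (itg h a b)%:E.
Proof.
by move=> lh; rewrite /itg /Rintegral fineK//; apply: integrable_fin_num => //; exact: lip_integrable.
Qed.

Lemma itg_sum (I : eqType) (s : seq I) (h : I -> R -> R) (a b : R) : (forall i, lip (h i)) ->
  (\sum_(i <- s) itg (h i) a b = itg (fun x => \sum_(i <- s) h i x) a b)%R.
Proof.
move=> lh; elim: s => [|i s IH].
  rewrite big_nil (_ : (fun x => _) = (fun=> 0 * 1)%R).
    by rewrite itgZ ?mul0r//; exact: lip_cst.
  by apply/funext => x; rewrite big_nil mul0r.
rewrite big_cons IH -itgD//; last exact: lip_sum.
by congr itg; apply/funext => x; rewrite big_cons.
Qed.

Lemma measurable_ltb d (S : measurableType d) (u v : S -> R) :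
  measurable_fun setT u -> measurable_fun setT v ->
  measurable_fun setT (fun z => (u z < v z)%R%:R : R).
Proof.
move=> mu' mv; rewrite (_ : (fun z => _) = \1_[set z | (u z < v z)%R]).
  apply: measurable_indic.
  rewrite -[X in measurable X]setTI; apply: (measurable_fun_ltr mu' mv measurableT) (_ : measurable [set true]).
  by [].
by apply/funext => z; rewrite indicE; congr ((nat_of_bool _)%:R); apply/idP/idP; rewrite in_setE.
Qed.

Lemma measurable_leb d (S : measurableType d) (u v : S -> R) :
  measurable_fun setT u -> measurable_fun setT v ->
  measurable_fun setT (fun z => (u z <= v z)%R%:R : R).
Proof.
move=> mu' mv; rewrite (_ : (fun z => _) = (fun z => 1 - (v z < u z)%R%:R)%R).
  by apply: measurable_funB => //; exact: measurable_ltb.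
by apply/funext => z; rewrite leNgt; case: ltP => _ /=; rewrite ?subrr ?subr0.
Qed.

Variables (f : tree -> R -> R).
Hypothesis f01 : forall T t, (0 <= f T t <= 1)%R.
Hypothesis lf : forall T, lip (f T).

(** Variation of constants: only the contributions of the successors remain in the derivative of
    [exp(c * t) * f T t]. The outcome is a decomposition at the first jump, the last term being the
    absence of jumps before [s]. *)
Lemma backward_duhamel T (s : R) : C11 (f T) (fun t => gen lambda mu w (f^~ t) T) -> (0 <= s)%R ->
  (f T s = \sum_(p <- succs T) p.1 / c_ T *
      (itg (fun y => f p.2 (s - y) * (c_ T * expR (- c_ T * y))) 0 s) +
    f T 0 * expR (- (c_ T * s)))%R.
Proof.
move=> hf s0; set c := c_ T.
have cn0 : (c != 0)%R by rewrite gt_eqF// exit_rate_gt0.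
have le (d : R) : lip (fun y : R => expR (d * y)) by apply: lip_expR; apply: lipZ; exact: lip_id.
have cid : C11 (fun t : R => c * t)%R (fun=> c).
  by have := C11Z c (@C11_id1 R); congr C11; apply/funext => t; rewrite mulr1.
have hg := C11M (C11_expR cid) hf.
have H := C11_ftc hg (lexx 0%R) s0.
have lfe T' : lip (fun t => f T' t * expR (c * t))%R by exact: lipM (lf T') (le c).
have genE' t : (c * expR (c * t) * f T t + expR (c * t) * gen lambda mu w (f^~ t) T =
    \sum_(p <- succs T) p.1 * (f p.2 t * expR (c * t)))%R.
  rewrite genE -mulrA mulrCA -mulrDr (mulrC (expR _)) [c]exit_rateE -/c mulr_suml -big_split /=.
  rewrite mulr_suml; apply: eq_bigr => p _.
  by rewrite -mulrDr addrC subrK mulrA.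
rewrite (_ : itg _ 0 s = \sum_(p <- succs T) p.1 * itg (fun t => f p.2 t * expR (c * t)) 0 s)%R in H;
    last first.
  rewrite (eq_bigr (fun p => itg (fun t => p.1 * (f p.2 t * expR (c * t))) 0 s)%R); last first.
    by move=> p _; rewrite itgZ//; exact: lfe.
  rewrite itg_sum; last by move=> p; exact: lipZ (lfe _).
  by congr itg; apply/funext => t; exact: genE'.
have revE p : itg (fun y => f p.2 (s - y) * (c * expR (- c * y)))%R 0 s =
    (c * expR (- (c * s)) * itg (fun t => f p.2 t * expR (c * t)) 0 s)%R.
  rewrite -itgZ; last exact: lfe.
  rewrite -(itg_rev s0 (lipZ (c * expR (- (c * s)))%R (lfe p.2))).
  apply: eq_itg => y _ _; rewrite [RHS]mulrCA -mulrA; congr (_ * (_ * _))%R.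
  by rewrite -expRD; congr expR; rewrite mulrBr addrA addNr add0r mulNr.
under eq_bigr => p _.
  have -> : (p.1 / c * itg (fun y => f p.2 (s - y) * (c * expR (- c * y))) 0 s =
     expR (- (c * s)) * (p.1 * itg (fun t => f p.2 t * expR (c * t)) 0 s))%R.
    by rewrite revE -!mulrA (mulKf cn0) mulrCA.
  over.
rewrite -mulr_sumr H mulr0 expR0 mul1r mulrBr mulrA -expRD addNr expR0 mul1r.
by rewrite (mulrC (f T 0)) subrK.
Qed.

(* The contribution to [f] at the horizon [t] of a holding time that starts at
   time [z.1] and has length [z.2], according to whether it ends before [t]. *)
Definition payoff (t : R) (x y : tree) (z : R * R) : \bar R :=
  (f y (t - z.1 - z.2) * (z.1 + z.2 <= t)%R%:R +
   f x 0 * (z.1 <= t < z.1 + z.2)%R%:R)%:E.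

Let f0 T t : (0 <= f T t)%R. Proof. by case/andP: (f01 T t). Qed.

Lemma measurable_payoff t x y : measurable_fun setT (payoff t x y).
Proof.
apply/measurable_EFinP; apply: measurable_funD.
  apply: measurable_funM.
    apply: measurableT_comp; first exact: lip_measurable.
    by apply: measurable_funB => //; exact: measurable_funB.
  by apply: measurable_leb => //; exact: measurable_funD.
apply: measurable_funM => //.
rewrite (_ : (fun z => _) = (fun z : R * R => (z.1 <= t)%R%:R * (t < z.1 + z.2)%R%:R)%R).
  apply: measurable_funM; first exact: measurable_leb.
  by apply: measurable_ltb => //; exact: measurable_funD.
by apply/funext => z; case: (_ <= _)%R => /=; rewrite ?mul1r ?mul0r.
Qed.

Lemma payoff_ge0 t x y z : 0 <= payoff t x y z.
Proof. by rewrite lee_fin addr_ge0// mulr_ge0. Qed.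

(** This is [backward_duhamel] with horizon [t - k]: the first term of [payoff] yields the integral,
    the second the term without jump. If [k > t], both terms vanish for positive holding times. *)
Lemma step_payoff t T k : C11 (f T) (fun t => gen lambda mu w (f^~ t) T) ->
  step lambda mu w (payoff t) T k = (f T (t - k) * (k <= t)%R%:R)%:E.
Proof.
move=> hf; have c0 : (0 < c_ T)%R by exact: exit_rate_gt0.
have pdf0 y : (0 <= exponential_pdf (c_ T) y)%R by exact: exponential_pdf_ge0 (ltW c0) _.
have [kt|tk] := leP k t; last first.
  rewrite mulr0 /step big1// => p _; rewrite integral0_eq ?mule0// => y _.
  have [y0|y0] := ltP y 0%R; first by rewrite lt0_exponential_pdf// mule0.
  rewrite /payoff /= [(k + y <= t)%R](_ : _ = false); last first.
    by apply/negbTE; rewrite -ltNge (lt_le_trans tk)// lerDl.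
  by rewrite [(k <= t)%R](_ : _ = false) ?mulr0 ?addr0 ?mul0e//; apply/negbTE; rewrite -ltNge.
set s := (t - k)%R; have s0 : (0 <= s)%R by rewrite subr_ge0.
rewrite mulr1 (backward_duhamel hf s0).
have intE T' : \int[lebesgue_measure]_y (payoff t T T' (k, y) * (exponential_pdf (c_ T) y)%:E) =
    (itg (fun y => f T' (s - y) * (c_ T * expR (- c_ T * y))) 0 s + f T 0 * expR (- (c_ T * s)))%:E.
  have mle (a : R) : measurable_fun setT (fun y : R => (y <= a)%R%:R : R).
    exact: measurable_leb.
  have mlt (a : R) : measurable_fun setT (fun y : R => (a < y)%R%:R : R).
    exact: measurable_ltb.
  have mpdf := measurable_exponential_pdf (c_ T).
  have m1 : measurable_fun setT (fun y : R => f T' (s - y) * (y <= s)%R%:R * exponential_pdf (c_ T) y)%R.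
    by apply: measurable_funM => //; apply: measurable_funM => //; apply: lip_measurable; exact: lip_rev.
  have m2 : measurable_fun setT (fun y : R => (s < y)%R%:R * exponential_pdf (c_ T) y)%R.
    exact: measurable_funM.
  transitivity (\int[lebesgue_measure]_y ((f T' (s - y) * (y <= s)%R%:R * exponential_pdf (c_ T) y)%:E +
      (f T 0)%:E * ((s < y)%R%:R * exponential_pdf (c_ T) y)%:E)).
    apply: eq_integral => y _; rewrite /payoff /= kt /= -!EFinM -EFinD; congr EFin.
    have -> : (k + y <= t)%R = (y <= s)%R by rewrite /s lerBrDl.
    have -> : (t < k + y)%R = (s < y)%R by rewrite /s ltrBlDl.
    by rewrite mulrDl -/s [in RHS]mulrA.
  rewrite ge0_integralD//=; first last.
  - by apply: measurable_funeM; apply/measurable_EFinP; exact: m2.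
  - by move=> y _; rewrite -EFinM lee_fin !mulr_ge0.
  - by apply/measurable_EFinP; exact: m1.
  - by move=> y _; rewrite lee_fin !mulr_ge0.
  rewrite EFinD; congr (_ + _).
    rewrite -integral_itg; last first.
      apply: lipM; first exact: lip_rev.
      by apply: lipZ; apply: lip_expR; apply: lipZ; exact: lip_id.
    rewrite [RHS]integral_mkcond; apply: eq_integral => y _; rewrite patchE mem_setE in_itv /=.
    have [y0|y0] := ltP y 0%R; first by rewrite lt0_exponential_pdf// mulr0.
    by rewrite exponential_pdfE//; case: (y <= s)%R; rewrite ?mulr1 ?mulr0 ?mul0r.
  rewrite ge0_integralZl//; last 3 first.
  - by apply/measurable_EFinP; exact: m2.
  - by move=> y _; rewrite lee_fin mulr_ge0.
  - by rewrite lee_fin.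
  rewrite EFinM -exponential_prob_ray//; congr (_ * _).
  rewrite /exponential_prob [RHS]integral_mkcond; apply: eq_integral => y _.
  by rewrite patchE mem_setE in_itv /= andbT; case: (s < y)%R; rewrite ?mul1r ?mul0r.
rewrite /step; under eq_bigr do rewrite intE -EFinM mulrDr.
rewrite sumEFin big_split /= -!mulr_suml -exit_rateE divff ?mul1r// gt_eqF//.
Qed.

Section Telescope.
Variables (G : tree_chain lambda mu w) (T0 : tree).
Local Notation Om := (chain_space G).
Local Notation P := (chain_prob G T0).
Local Notation X := (@jumpc R lambda mu w G).
Local Notation H := (@hold R lambda mu w G).
Local Notation J := (@jump_time R lambda mu w G).

Lemma past_le k n (D : set Om) : (k <= n)%N ->
  @measurable _ (past G k) D -> @measurable _ (past G n) D.
Proof.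
move=> kn mD; elim: n kn => [|n IH]; first by rewrite leqn0 => /eqP <-.
by rewrite leq_eqVlt => /predU1P[<-//|/IH]; exact: past_succ.
Qed.

Variables (m : nat) (Q : tree -> bool) (E0 : set Om) (t : R).
Hypotheses (mE0 : @measurable _ (past G m) E0).
Hypothesis hf : forall T, Q T -> C11 (f T) (fun t => gen lambda mu w (f^~ t) T).

(** The chain is followed from step [m] on [E0], as long as its trees satisfy [Q], for which [f] is
    known to solve the backward equation. *)
Definition alive n := E0 `&` [set om | forall i, (m <= i <= n)%N -> Q (X i om)].

Local Notation K n om := (J n om - J m om)%R.

Lemma past_alive n : (m <= n)%N -> @measurable _ (past G n) (alive n).
Proof.
move=> mn; apply: (@measurableI _ (past G n)).
  exact: past_le mE0.
apply: (past_path (Q := fun s => forall i, (m <= i <= n)%N -> Q (s i))) => s s' ss' h i /andP[mi ni].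
by rewrite -ss'// h// mi.
Qed.

Lemma measurable_alive n : (m <= n)%N -> measurable (alive n).
Proof. by move=> /past_alive; exact: past_measurable. Qed.

(** Time is counted from the [m]-th jump. [A n] is the part still running at step [n]; [S n] comes
    from the paths for which [t] falls in the [n]-th holding time, where [f] takes its initial
    value; [D n] from those that leave [Q] at step [n.+1]. *)
Let A n := \int[P]_(om in alive n) (f (X n om) (t - K n om) * (K n om <= t)%R%:R)%:E.
Let S n := \int[P]_(om in alive n) (f (X n om) 0 * (K n om <= t < K n.+1 om)%R%:R)%:E.
Let D n := \int[P]_(om in alive n `&` [set om | ~~ Q (X n.+1 om)])
  (f (X n.+1 om) (t - K n.+1 om) * (K n.+1 om <= t)%R%:R)%:E.

Let mX n y : measurable [set om | X n om = y].
Proof. exact: jumpc_measurable. Qed.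

Let mK n : measurable_fun setT (fun om => K n om).
Proof. by apply: measurable_funB; exact: measurable_jump_time. Qed.

Let mstay n : measurable_fun setT (fun om => (f (X n om) 0 * (K n om <= t < K n.+1 om)%R%:R)%:E).
Proof.
apply/measurable_EFinP; apply: measurable_funM.
  apply: (@measurable_fun_tree _ _ _ _ _ (X n)) => // y.
  by apply: (eq_measurable_fun (fun=> f y 0)) => // om; rewrite in_setE => ->.
rewrite (_ : (fun z => _) = (fun om => (K n om <= t)%R%:R * (t < K n.+1 om)%R%:R)%R).
  by apply: measurable_funM; [exact: measurable_leb|exact: measurable_ltb].
by apply/funext => z; case: (_ <= _)%R => /=; rewrite ?mul1r ?mul0r.
Qed.

Let mcur n : measurable_fun setT (fun om => (f (X n om) (t - K n om) * (K n om <= t)%R%:R)%:E).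
Proof.
apply/measurable_EFinP; apply: measurable_funM; last exact: measurable_leb.
apply: (@measurable_fun_tree _ _ _ _ _ (X n)) => // y.
have : measurable_fun setT (fun om => f y (t - K n om)).
  apply: measurableT_comp; first exact: lip_measurable.
  exact: measurable_funB.
move=> /(measurable_funTS (D := [set om | X n om = y])).
by apply: eq_measurable_fun => om; rewrite in_setE => ->.
Qed.

Let mQ n : measurable [set om | ~~ Q (X n om)].
Proof.
apply: (@past_measurable _ _ _ _ _ n).
by apply: (past_path (Q := fun s => ~~ Q (s n))) => s s' ss'; rewrite ss'.
Qed.

Lemma one_step_alive n : (m <= n)%N -> A n = S n + D n + A n.+1.
Proof.
move=> mn; have mA := measurable_alive mn.
have -> : A n = \int[P]_(om in alive n) payoff t (X n om) (X n.+1 om) (K n om, H n om).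
  rewrite (one_step l0 m0 T0 (past_alive mn) (past_elapsed mn) (measurable_payoff t) (payoff_ge0 t)).
  apply: eq_integral => om; rewrite in_setE => -[_ /(_ n)] QX.
  by rewrite step_payoff//; apply: hf; apply: QX; rewrite mn leqnn.
transitivity (\int[P]_(om in alive n) ((f (X n om) 0 * (K n om <= t < K n.+1 om)%R%:R)%:E +
    (f (X n.+1 om) (t - K n.+1 om) * (K n.+1 om <= t)%R%:R)%:E)).
  apply: eq_integral => om _; rewrite /payoff /= -EFinD addrC; congr (_ + _)%:E.
  - by rewrite jump_timeS addrAC.
  - rewrite jump_timeS [in RHS](addrAC (J n om)).
    by move: (K n om) => k; rewrite opprD addrA.
rewrite ge0_integralD//; last 4 first.
- by move=> om _; rewrite lee_fin mulr_ge0.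
- exact: measurable_funTS.
- by move=> om _; rewrite lee_fin mulr_ge0.
- exact: measurable_funTS.
rewrite -addeA; congr (_ + _).
have aliveS : alive n.+1 = alive n `\` [set om | ~~ Q (X n.+1 om)].
  apply/seteqP; split => om.
    move=> [h1 h2]; split; last by move=> /=; rewrite h2// leqnn (leqW mn).
    by split => // i /andP[mi ni]; rewrite h2// mi leqW.
  move=> [[h1 h2] /negP]; rewrite negbK => h3; split => // i /andP[mi].
  by rewrite leq_eqVlt => /predU1P[->//|ni]; rewrite h2// mi.
rewrite -[in LHS](setUIDK (alive n) [set om | ~~ Q (X n.+1 om)]) -aliveS ge0_integral_setU//.
- exact: measurableI.
- exact: measurable_alive (leqW mn).
- exact: measurable_funTS.
- by move=> om _; rewrite lee_fin mulr_ge0.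
- by rewrite aliveS; apply/disj_setPS => om [[_ h] [_ /=]].
Qed.

Let S0 n : 0 <= S n. Proof. by apply: integral_ge0 => om _; rewrite lee_fin mulr_ge0. Qed.
Let D0 n : 0 <= D n. Proof. by apply: integral_ge0 => om _; rewrite lee_fin mulr_ge0. Qed.
Let A0 n : 0 <= A n. Proof. by apply: integral_ge0 => om _; rewrite lee_fin mulr_ge0. Qed.

(** The relation [A n = S n + D n + A n.+1] telescopes, and [A n] is at most the probability that
    the [n]-th jump comes before the horizon, which tends to 0 by non-explosion. For [dead] only the
    terms [D] will remain, for [gf] only the terms [S]. *)
Lemma verification : \int[P]_(om in alive m) (f (X m om) t * (0 <= t)%R%:R)%:E =
  \sum_(m <= n <oo) (S n + D n).
Proof.
have -> : \int[P]_(om in alive m) (f (X m om) t * (0 <= t)%R%:R)%:E = A m.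
  by apply: eq_integral => om _; rewrite subrr subr0.
have AP n : (m <= n)%N -> A n <= P [set om | (K n om <= t)%R].
  move=> mn; have mle := measurable_elapsed_le G m n t.
  rewrite -[leRHS]mul1e -integral_cst// /A [leLHS]integral_mkcond [leRHS]integral_mkcond.
  apply: ge0_le_integral => //.
  - by move=> om _; rewrite patchE; case: ifP => // _; rewrite lee_fin mulr_ge0.
  - apply/(measurable_restrictT _ (measurable_alive mn)); exact: measurable_funTS.
  - apply/(measurable_restrictT _ mle); exact: measurable_cst.
  - move=> om _; rewrite !patchE; case: ifPn => _.
      case: ifPn => h; first by rewrite lee_fin mulr_ile1 ?lern1 ?leq_b1//; case/andP: (f01 (X n om) (t - K n om)).
      have -> : (K n om <= t)%R = false by apply/negbTE; apply: contra h => h; rewrite in_setE.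
      by rewrite mulr0.
    by case: ifPn => // _; rewrite lee_fin.
have AE n : (m <= n)%N -> A m = \sum_(m <= i < n) (S i + D i) + A n.
  elim: n => [|n IH]; first by rewrite leqn0 => /eqP ->; rewrite big_geq// add0e.
  rewrite leq_eqVlt => /predU1P[<-|mn]; first by rewrite big_geq// add0e.
  by rewrite big_nat_recr//= -addeA -one_step_alive// IH.
have A_cvg : A n @[n --> \oo] --> 0.
  apply: (@squeeze_cvge _ _ _ _ (fun=> 0) _ (fun n => P [set om | (K n om <= t)%R])).
  - by exists m => // n mn; rewrite A0 AP.
  - exact: cvg_cst.
  - exact: cvg_elapsed.
have S_cvg : \sum_(m <= i < n) (S i + D i) @[n --> \oo] --> \sum_(m <= n <oo) (S n + D n).
  by apply: is_cvg_nneseries => i _ _; exact: adde_ge0.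
have sum_cvg : \sum_(m <= i < n) (S i + D i) + A n @[n --> \oo] -->
    \sum_(m <= n <oo) (S n + D n) + 0.
  by apply: cvgeD => //; rewrite fin_num_adde_defl.
rewrite -[RHS]adde0 -(cvg_lim _ sum_cvg)//; apply/esym/lim_near_cst => //.
by exists m => // n mn /=; rewrite -AE.
Qed.

End Telescope.
End Verification.

(** * Lifetimes *)

Lemma measure_ae_eq d (T : measurableType d) (R : realType)
    (mu : {measure set T -> \bar R}) (A B : set T) :
  measurable A -> measurable B -> {ae mu, forall x, A x <-> B x} -> mu A = mu B.
Proof.
have le (C D : set T) : measurable C -> measurable D ->
    {ae mu, forall x, C x <-> D x} -> (mu C <= mu D)%E.
  move=> mC mD CD.
  have CD0 : mu (C `\` D) = 0%E.
    apply: measure_negligible; first exact: measurableD.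
    by apply: negligibleS CD => x [Cx nDx] /= h; apply: nDx; apply/h.
  rewrite -[leRHS]adde0 -CD0.
  apply: (@le_trans _ _ (mu (D `|` C `\` D))); last by apply: measureU2 => //; exact: measurableD.
  apply: le_measure; rewrite ?in_setE//; first by apply: measurableU => //; exact: measurableD.
  by move=> x Cx; have [Dx|nDx] := pselect (D x); [left|right].
move=> mA mB AB; apply/eqP; rewrite eq_le !le//.
by apply: filterS AB => x h; split => /h.
Qed.

Section Lifetimes.
Local Open Scope ereal_scope.
Context {R : realType}.
Variables (lambda mu : R) (q : R -> R).
Hypotheses (l0 : (0 < lambda)%R) (m0 : (0 < mu)%R) (Hq : survival lambda mu q).
Variables (G : tree_chain lambda mu [::]) (T0 : tree).
Local Notation Om := (chain_space G).
Local Notation P := (chain_prob G T0).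
Local Notation X := (@jumpc R lambda mu [::] G).
Local Notation H := (@hold R lambda mu [::] G).
Local Notation J := (@jump_time R lambda mu [::] G).

Definition died m v (t : R) : set Om :=
  [set om | exists n, [/\ (m < n)%N, v \notin vertices (X n om) & (J n om - J m om <= t)%R]].

Let mXQ n (Q : pred tree) : measurable [set om | Q (X n om)].
Proof.
apply: (@past_measurable _ _ _ _ _ n).
by apply: (past_path (Q := fun s => Q (s n))) => s s' ss'; rewrite ss'.
Qed.

Lemma measurable_died m v t : measurable (died m v t).
Proof.
rewrite (_ : died m v t = \bigcup_(n in [set n | (m < n)%N])
    ([set om | v \notin vertices (X n om)] `&` [set om | (J n om - J m om <= t)%R])).
  apply: bigcup_measurable => n _; apply: measurableI; last exact: measurable_elapsed_le.
  exact: (mXQ n (fun T => v \notin vertices T)).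
apply/seteqP; split => om; first by move=> [n [mn vn Jn]]; exists n.
by move=> [n mn [vn Jn]]; exists n.
Qed.

(** With [Q] the presence of [v], [dead] is 0 at time 0 while [v] is present and 1 once it is
    absent: the sum in [verification] is that of the probabilities that [v] first disappears at step
    [n.+1], within time [t]. *)
Lemma death_law m v (E0 : set Om) (t : R) : @measurable _ (past G m) E0 ->
  E0 `<=` [set om | is_leaf (X m om) v] -> v != [::] -> (0 <= t)%R ->
  P (E0 `&` died m v t) = (1 - q t)%:E * P E0.
Proof.
move=> mE0 E0v v0 t0.
pose Q T := v \in vertices T.
have f01 T s : (0 <= dead lambda mu q T v s <= 1)%R by exact: (dead_01 m0 Hq).
have hf T : Q T -> C11 (dead lambda mu q T v)
    (fun s => gen lambda mu [::] (fun S => dead lambda mu q S v s) T).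
  exact: C11_dead_chain.
have := verification l0 m0 f01 (fun T => lip_dead Hq T v) T0 t mE0 hf.
have -> : alive m Q E0 m = E0.
  apply/seteqP; split => om; first by case.
  move=> h; split => // i; rewrite -eqn_leq => /eqP <-.
  by have /andP[] := E0v _ h.
have mE := past_measurable mE0.
have -> : \int[P]_(om in E0) (dead lambda mu q (X m om) v t * (0 <= t)%R%:R)%:E =
    (1 - q t)%:E * P E0.
  rewrite -integral_cst//; apply: eq_integral => om; rewrite in_setE => /E0v /= lv.
  by rewrite t0 mulr1 (dead_leaf Hq).
move=> ->.
pose F n := alive m Q E0 n `&` [set om | ~~ Q (X n.+1 om)] `&`
  [set om | (J n.+1 om - J m om <= t)%R].
have mF n : (m <= n)%N -> measurable (F n).
  move=> mn; apply: measurableI; last exact: measurable_elapsed_le.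
  by apply: measurableI; [exact: measurable_alive|exact: (mXQ n.+1 (fun T => ~~ Q T))].
have FE : E0 `&` died m v t = \bigcup_(n in [set n | (m <= n)%N]) F n.
  apply/seteqP; split => om.
    move=> [E0om [n [mn vn Jn]]].
    have ex : exists i, (m < i)%N && (v \notin vertices (X i om)) by exists n; rewrite mn.
    (* The first absence is retained, since the label [v] may be used again later. *)
    case: (ex_minnP ex) => -[//|i] /andP[mi vi] imin; exists i => //; split; [split; [split|]|].
    - exact: E0om.
    - move=> j /andP[]; rewrite leq_eqVlt => /predU1P[<- _|mj ji].
        by have /andP[] := E0v _ E0om.
      rewrite /Q; apply: contraT => vj.
      by have := imin j; rewrite mj vj => /(_ isT); rewrite ltnNge ji.
    - exact: vi.
    - apply: le_trans Jn; rewrite lerD2r; apply: le_jump_time.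
      by apply: imin; rewrite mn.
  by move=> [n mn [[[E0om _] vn] Jn]]; split => //; exists n.+1.
rewrite FE measure_bigcup; last 2 first.
- by move=> n; exact: mF.
- move=> i j mi mj [om [[[[_ hi] vi] _] [[[_ hj] vj] _]]].
  case: (ltngtP i j) => // ij.
  + by move: vi => /=; rewrite hj// ij (leq_trans mi).
  + by move: vj => /=; rewrite hi// ij (leq_trans mj).
rewrite [RHS]eseries_cond.
rewrite (@eq_eseriesl _ _ (fun n => true && (m <= n)%N)); last first.
  by move=> n /=; apply/idP/idP; rewrite in_setE.
apply: eq_eseriesr => n /= mn.
rewrite [X in _ = X + _]integral0_eq ?add0e; last first.
  move=> om [_ /(_ n)]; rewrite mn leqnn => /(_ isT) vX.
  by rewrite dead_nonpos ?mul0r.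
have mle := measurable_elapsed_le G m n.+1 t.
have mAQ : measurable (alive m Q E0 n `&` [set om | ~~ Q (X n.+1 om)]).
  by apply: measurableI; [exact: measurable_alive|exact: (mXQ n.+1 (fun T => ~~ Q T))].
rewrite -[LHS]mul1e -integral_cst; last exact: mF.
rewrite [LHS]integral_mkcond [RHS]integral_mkcond; apply: eq_integral => om _.
rewrite !patchE /F in_setI; case: ifPn; case: ifPn => //=.
- rewrite in_setE => -[_ vn] /= /set_mem /= ->.
  by rewrite dead_out// mul1r.
- rewrite in_setE => -[_ vn] /= h; rewrite (_ : (_ <= t)%R = false) ?mulr0//.
  by apply/negbTE; apply: contra h => h; apply/mem_set.
Qed.

Lemma born_leaf k v : {ae P, forall om, born k v om -> is_leaf (X k.+1 om) v}.
Proof.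
apply: filterS (ae_legal G l0 m0 T0) => om [_ /(_ k)].
rewrite /born /=; move: (X k om) (X k.+1 om) => S S' /mapP[p ps ->] [vS].
move: ps; rewrite mem_cat => /orP[] /mapP[u].
  move=> uS -> /=; rewrite in_add_child// => /predU1P[->|].
    exact: leaf_newborn.
  by rewrite (negbTE vS).
rewrite mem_filter => /andP[/and3P[u0 _ lu] uS] -> /=.
by rewrite in_remove// (negbTE vS) andbF.
Qed.

Lemma born_neq_root k v (om : Om) : born k v om -> v != [::].
Proof. by move=> [vS _]; apply: contraNneq vS => ->; exact: root_in_tree. Qed.

Lemma past_born k v : @measurable _ (past G k.+1) (born k v).
Proof.
apply: (past_path (Q := fun s => v \notin vertices (s k) /\ v \in vertices (s k.+1))).
by move=> s s' ss'; rewrite !ss'.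
Qed.

Lemma measurable_born k v : measurable (born k v : set Om).
Proof. by apply: (@past_measurable _ _ _ _ _ k.+1); exact: past_born. Qed.

Lemma lifetime_le k v (t : R) :
  [set om | lifetime k v om <= t%:E] = died k.+1 v t.
Proof.
apply/seteqP; split => om /=; last first.
  move=> [n [kn vn Jn]]; apply: (@le_trans _ _ (J n om - J k.+1 om)%R%:E).
    by apply: ereal_inf_lbound; exists n.
  by rewrite lee_fin.
have [[n0 /andP[kn0 vn0]]|none] :=
    pselect (exists n, (k.+1 < n)%N && (v \notin vertices (X n om))).
  have ex : exists n, (k.+1 < n)%N && (v \notin vertices (X n om)) by exists n0; rewrite kn0.
  case: (ex_minnP ex) => n /andP[kn vn] nmin le_t; exists n; split => //.
  rewrite -lee_fin; apply: le_trans le_t; apply: le_ereal_inf_tmp => _ [i [ki vi] <-].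
  by rewrite lee_fin lerD2r le_jump_time// nmin// ki.
rewrite /lifetime (_ : [set _ | _ in _] = set0) ?ereal_inf0//.
by rewrite -subset0 => x [n [kn vn] _]; apply: none; exists n; rewrite kn.
Qed.

Lemma lifetime_law k v (t : R) :
  P (born k v `&` [set om | lifetime k v om <= t%:E]) = (1 - q t)%:E * P (born k v).
Proof.
have [t0|t0] := ltP t 0%R.
  have -> : q t = 1%R by case: Hq => _ -> //; exact: ltW.
  rewrite subrr mul0e lifetime_le (_ : _ `&` _ = set0) ?measure0//.
  rewrite -subset0 => om [_ [n [kn _]]]; rewrite leNgt => /negP; apply.
  by rewrite (lt_le_trans t0)// subr_ge0 le_jump_time// ltnW.
have [v0|/negPn/eqP v0] := boolP (v != [::]); last first.
  rewrite (_ : born k v = set0) ?set0I ?measure0 ?mule0//.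
  by rewrite -subset0 => om /born_neq_root; rewrite v0.
(* A newborn vertex is a leaf only almost surely, for illegal paths exist, whereas [death_law] asks
   for a leaf everywhere on the event. *)
pose L := [set om : Om | is_leaf (X k.+1 om) v].
have mL : @measurable _ (past G k.+1) L.
  by apply: (past_path (Q := fun s => is_leaf (s k.+1) v)) => s s' ss'; rewrite ss'.
have mBL : @measurable _ (past G k.+1) (born k v `&` L).
  by apply: measurableI => //; exact: past_born.
have PL D : measurable D -> P (born k v `&` L `&` D) = P (born k v `&` D).
  move=> mD; apply: (measure_ae_eq (mu := P)).
  - by apply: measurableI => //; exact: past_measurable mBL.
  - by apply: measurableI => //; exact: measurable_born.
  - apply: filterS (born_leaf k v) => om h; split; first by move=> [[]].
    by move=> [b D']; split => //; split => //; exact: h.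
rewrite lifetime_le -PL; last exact: measurable_died.
rewrite death_law//; congr (_ * _).
by rewrite -[LHS]/(P _) -[X in P X = _](setIT (born k v `&` L)) PL ?setIT.
Qed.

Hypothesis qmono : forall s t : R, (s <= t)%R -> (q t <= q s)%R.
Let c := inf (range q).

Lemma death_eventually m v (E0 : set Om) : @measurable _ (past G m) E0 ->
  E0 `<=` [set om | is_leaf (X m om) v] -> v != [::] ->
  P (E0 `&` [set om | exists2 n, (m < n)%N & v \notin vertices (X n om)]) <= (1 - c)%:E * P E0.
Proof.
move=> mE0 E0v v0.
have -> : E0 `&` [set om | exists2 n, (m < n)%N & v \notin vertices (X n om)] =
    \bigcup_(k : nat) (E0 `&` died m v k%:R).
  apply/seteqP; split => om.
    move=> [E0om [n mn vn]]; exists (Num.bound (J n om - J m om)%R) => //; split => //.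
    by exists n; split => //; rewrite ltW// archi_boundP// subr_ge0 le_jump_time// ltnW.
  by move=> [k _ [E0om [n [mn vn _]]]]; split => //; exists n.
have mF k : measurable (E0 `&` died m v k%:R).
  by apply: measurableI; [exact: past_measurable mE0|exact: measurable_died].
have cvgP : P (E0 `&` died m v k%:R) @[k --> \oo] --> P (\bigcup_(k : nat) (E0 `&` died m v k%:R)).
  apply: (nondecreasing_cvg_mu (F := fun k => E0 `&` died m v k%:R)) => //.
    exact: bigcupT_measurable.
  move=> i j ij; apply/subsetPset => om [E0om [n [mn vn Jn]]]; split => //; exists n; split => //.
  by rewrite (le_trans Jn)// ler_nat.
rewrite -(cvg_lim _ cvgP)//; apply: lime_le.
  by apply/cvg_ex; eexists; exact: cvgP.
apply: nearW => k; rewrite death_law// lee_wpmul2r// lee_fin lerB//.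
apply: ge_inf; last by exists k%:R.
by exists 0%R => _ [x _ <-]; have /andP[/ltW] : (0 < q x <= 1)%R by case: Hq.
Qed.

End Lifetimes.

(** * Monotonicity of [q] and mean lifetime *)

Section MeanLifetime.
Local Open Scope ereal_scope.
Context {R : realType}.
Variables (lambda mu : R) (q : R -> R).
Hypotheses (l0 : (0 < lambda)%R) (m0 : (0 < mu)%R) (Hq : survival lambda mu q).
Variables (G : tree_chain lambda mu [::]).
Local Notation Om := (chain_space G).
Local Notation P := (proba G).
Local Notation X := (@jumpc R lambda mu [::] G).
Local Notation J := (@jump_time R lambda mu [::] G).

(** The first transition from the root alone is almost surely the birth of [v], so that [1 - q] is
    the distribution function of an actual lifetime. *)
Lemma survival_ninc (s t : R) : (s <= t)%R -> (q t <= q s)%R.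
Proof.
pose v := newborn root_tree [::].
have P1 : P (born 0 v) = 1.
  rewrite -(probability_setT P); apply: (measure_ae_eq (mu := P)) => //.
    exact: measurable_born.
  apply: filterS (ae_legal G l0 m0 root_tree) => om [X0 /(_ 0%N)].
  rewrite /born /= X0 => /mapP[p]; rewrite mem_cat => /orP[] /mapP[u].
    move=> /fset1P -> -> -> /=; split => // _; split; first exact: newborn_notin.
    by rewrite in_add_child ?root_in_tree// eqxx.
  by rewrite mem_filter => /andP[/and3P[u0 _ _] /fset1P uE]; rewrite uE in u0.
have q01 x : (0 < q x <= 1)%R by case: Hq.
move=> st; have := lifetime_law l0 m0 Hq G root_tree 0 v s.
have := lifetime_law l0 m0 Hq G root_tree 0 v t.
rewrite -/P P1 !mule1 => Et Es; rewrite -lerN2 -(lerD2l 1) -lee_fin -Et -Es.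
apply: le_measure; rewrite ?in_setE.
- rewrite lifetime_le; apply: measurableI; [exact: measurable_born|exact: measurable_died].
- rewrite lifetime_le; apply: measurableI; [exact: measurable_born|exact: measurable_died].
- by move=> om [b /= h]; split => //=; rewrite (le_trans h)// lee_fin.
Qed.

Let c := inf (range q).

Section Conditional.
Variables (k : nat) (v : vertex).
Hypothesis born_gt0 : 0 < P (born k v).

Lemma lifetime_dfE (t : R) : lifetime_df G k v t = (1 - q t)%R.
Proof.
rewrite /lifetime_df (lifetime_law l0 m0 Hq) fineM ?fin_num_measure//; last exact: measurable_born.
rewrite mulfK// gt_eqF// fine_gt0// born_gt0 /=.
by rewrite (le_lt_trans (probability_le1 _ _)) ?ltry//; exact: measurable_born.
Qed.

Lemma lifetime_df_cvg : lifetime_df G k v t @[t --> +oo%R] --> (1 - c)%R.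
Proof.
rewrite (_ : lifetime_df G k v = fun t => 1 - q t)%R; last by apply/funext => t; exact: lifetime_dfE.
apply: cvgB; first exact: cvg_cst.
exact: survival_cvg Hq survival_ninc.
Qed.

Lemma ellE : ell G k v = (1 - c)%R.
Proof. by apply/cvg_lim => //; exact: lifetime_df_cvg. Qed.

Lemma measurable_lifetime : measurable_fun setT (lifetime k v : Om -> \bar R).
Proof.
apply: (measurability (@ErealGenOInfty.G R)); first exact: ErealGenOInfty.measurableE.
move=> _ [_ [x ->] <-]; rewrite setTI (_ : _ @^-1` _ = ~` [set om | lifetime k v om <= x%:E]).
  by apply: measurableC; rewrite lifetime_le; exact: measurable_died.
apply/seteqP; split => om /=; rewrite in_itv /= andbT.
  by move=> h; apply/negP; rewrite -ltNge.
by move/negP; rewrite -ltNge.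
Qed.

Lemma lifetime_gt_law (t : R) :
  P (born k v `&` [set om | t%:E < lifetime k v om]) = (q t)%:E * P (born k v).
Proof.
have mb : measurable (born k v : set Om) by exact: measurable_born.
have ml : measurable (born k v `&` [set om : Om | lifetime k v om <= t%:E]).
  by apply: measurableI => //; rewrite lifetime_le; exact: measurable_died.
have p_fin : P (born k v) \is a fin_num by rewrite fin_num_measure.
rewrite (_ : _ `&` _ = born k v `\` (born k v `&` [set om | lifetime k v om <= t%:E])); last first.
  apply/seteqP; split => om [b h]; split => //.
    by move=> [_]; apply/negP; rewrite -ltNge.
  by rewrite /= ltNge; apply/negP => h'; apply: h.
rewrite measureD//; last by rewrite -ge0_fin_numE.
have := lifetime_law l0 m0 Hq G root_tree k v t; rewrite -/(proba G) => law.
rewrite [X in _ - X](_ : _ = (1 - q t)%:E * P (born k v)); last first.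
  by rewrite setIA setIid; exact: law.
pose p := fine (P (born k v)); have pE : P (born k v) = p%:E by rewrite fineK.
transitivity (p%:E - (1 - q t)%:E * p%:E); first by congr (_ - _ * _); exact: pE.
rewrite pE -!EFinM -EFinB; congr EFin.
by rewrite mulrBl mul1r opprB addrC subrK.
Qed.

Lemma lifetime_finite : c = 0%R -> {ae P, forall om, born k v om -> lifetime k v om < +oo}.
Proof.
move=> c_eq0.
have mb : measurable (born k v : set Om) by exact: measurable_born.
pose N := born k v `&` [set om : Om | lifetime k v om = +oo].
have mN : measurable N.
  apply: measurableI => //; rewrite -[X in measurable X]setTI.
  exact: (measurable_lifetime measurableT (emeasurable_set1 +oo)).
have PN t : P N <= (q t)%:E.
  rewrite -[leRHS]mule1; apply: (@le_trans _ _ ((q t)%:E * P (born k v))); last first.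
    rewrite lee_wpmul2l ?probability_le1// lee_fin.
    by have /andP[/ltW] : (0 < q t <= 1)%R by case: Hq.
  rewrite -lifetime_gt_law; apply: le_measure; rewrite ?in_setE//; last first.
    by move=> om [b /= ->]; split => //=; rewrite ltry.
  apply: measurableI => //; rewrite (_ : [set om | _] = ~` [set om | lifetime k v om <= t%:E]).
    by apply: measurableC; rewrite lifetime_le; exact: measurable_died.
  by apply/seteqP; split => om /=; rewrite ltNge => /negP.
exists N; split => //; last first.
  move=> om /= /not_implyP[b /negP]; rewrite -leNgt leye_eq => /eqP h; by split.
apply/eqP; rewrite eq_le measure_ge0 andbT.
have N_fin : P N \is a fin_num by rewrite fin_num_measure.
rewrite -(fineK N_fin) lee_fin -c_eq0; apply: lb_le_inf; first by exists (q 0%R), 0%R.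
by move=> _ [t _ <-]; rewrite -lee_fin fineK.
Qed.

(** The mean is the integral of the tail, here [q t * P (born k v)]. It is computed for the real
    variable [Y], which is 0 off [born k v] and agrees almost surely with the lifetime on it, since
    [c = 0] makes the lifetime finite. *)
Lemma mean_lifetimeE (r : R) : c = 0%R -> itg q 0 t @[t --> +oo%R] --> r ->
  mean_lifetime G k v = r%:E.
Proof.
move=> c_eq0 q_r.
have mb : measurable (born k v : set Om) by exact: measurable_born.
pose Y om : R := (fine (lifetime k v om) * \1_(born k v : set Om) om)%R.
have lt0 (om : Om) : 0 <= lifetime k v om.
  apply: le_ereal_inf_tmp => _ [n [kn _] <-].
  by rewrite lee_fin subr_ge0 le_jump_time// ltnW.
have Y0 om : (0 <= Y om)%R by rewrite mulr_ge0// fine_ge0.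
have mY : measurable_fun setT Y.
  apply: measurable_funM; last exact: measurable_indic.
  by apply: measurableT_comp measurable_lifetime.
pose Y' : {RV P >-> R} := mfun_Sub (mem_set mY).
have fin_ae := lifetime_finite c_eq0.
have YE : \int[P]_(om in born k v) lifetime k v om = 'E_P[Y'].
  rewrite expectation_def [LHS]integral_mkcond; apply: ge0_ae_eq_integral => //.
  - by apply/(measurable_restrictT _ mb); exact: measurable_funTS measurable_lifetime.
  - exact/measurable_EFinP.
  - by move=> om _; rewrite patchE; case: ifP.
  - by move=> om _; rewrite lee_fin Y0.
  - apply: filterS fin_ae => om h _; rewrite patchE /= /Y indicE.
    case: ifPn => bom; last by rewrite mulr0.
    have lf : lifetime k v om \is a fin_num.
      by rewrite (ge0_fin_numE (lt0 om)); apply: h; move: bom; rewrite in_setE.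
    by rewrite mulr1 fineK.
rewrite /mean_lifetime YE ge0_expectation_ccdf//.
have p_fin : P (born k v) \is a fin_num by rewrite fin_num_measure.
transitivity ((\int[lebesgue_measure]_(t in `[0%R, +oo[) (P (born k v) * (q t)%:E)) *
    ((fine (P (born k v)))^-1)%:E).
  congr (_ * _); apply: eq_integral => t; rewrite in_setE /= in_itv /= andbT => t0.
  rewrite muleC -lifetime_gt_law /ccdf /distribution /pushforward /=.
  apply: (measure_ae_eq (mu := P)).
  - by rewrite -[X in measurable X]setTI; exact: (mY measurableT _ (measurable_itv _)).
  - apply: measurableI => //; rewrite (_ : [set om | _] = ~` [set om | lifetime k v om <= t%:E]).
      by apply: measurableC; rewrite lifetime_le; exact: measurable_died.
    by apply/seteqP; split => om /=; rewrite ltNge => /negP.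
  - apply: filterS fin_ae => om h /=; rewrite in_itv /= andbT /Y indicE.
    have [bom|bom] := boolP (om \in _); last first.
      rewrite mulr0 ltNge t0; split => // -[b _].
      by case/negP: bom; exact/mem_set.
    have b : born k v om by rewrite in_setE in bom.
    have lf : lifetime k v om \is a fin_num by rewrite (ge0_fin_numE (lt0 om)); exact: h.
    by rewrite mulr1 -lte_fin fineK//; split => // -[].
have q0 t : (0 <= q t)%R by have /andP[/ltW] : (0 < q t <= 1)%R by case: Hq.
have lq : lip q by case: Hq.
have mq : measurable_fun setT (EFin \o q) by apply/measurable_EFinP; exact: lip_measurable.
rewrite ge0_integralZl//; first last.
- by move=> t _; rewrite lee_fin.
- exact: measurable_funTS.
have cvg1 : \int[lebesgue_measure]_(t in `[0%R, (0 + n%:R)%R]) (q t)%:E @[n --> \oo] -->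
    \int[lebesgue_measure]_(t in \bigcup_n `[0%R, (0 + n%:R)%R]) (q t)%:E.
  apply: ge0_nondecreasing_set_cvg_integral => //.
  - move=> i j ij; apply/subsetPset; apply: subset_itvl; rewrite bnd_simp.
    by rewrite !add0r ler_nat.
  - by move=> n; exact: measurable_funTS.
  - by move=> n t _; rewrite lee_fin.
have cvg2 : \int[lebesgue_measure]_(t in `[0%R, (0 + n%:R)%R]) (q t)%:E @[n --> \oo] --> r%:E.
  under eq_fun do rewrite integral_itg// add0r.
  apply: cvg_EFin; first exact: nearW.
  exact: (cvg_comp _ _ (@cvgr_idn R) q_r).
rewrite itv_bndy_bigcup_BRight -(cvg_lim _ cvg1)// (cvg_lim _ cvg2)//.
rewrite muleAC -{1}(fineK p_fin) -EFinM divff ?mul1r//.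
by rewrite gt_eqF// fine_gt0// born_gt0 /= -ge0_fin_numE.
Qed.

End Conditional.
End MeanLifetime.

(** * Descendants at steady state *)

Lemma ge0_ae_eq_patch_integral d (T : measurableType d) (R : realType)
    (mu : {measure set T -> \bar R}) (D E : set T) (f g : T -> \bar R) :
  measurable D -> measurable E -> measurable_fun setT f -> measurable_fun setT g ->
  (forall x, 0 <= f x)%E -> (forall x, 0 <= g x)%E ->
  {ae mu, forall x, (f \_ D) x = (g \_ E) x} ->
  (\int[mu]_(x in D) f x = \int[mu]_(x in E) g x)%E.
Proof.
move=> mD mE mf mg f0 g0 fg; rewrite integral_mkcond [RHS]integral_mkcond.
apply: ge0_ae_eq_integral => //.
- by apply/(measurable_restrictT _ mD); exact: measurable_funTS.
- by apply/(measurable_restrictT _ mE); exact: measurable_funTS.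
- by move=> x _; rewrite patchE; case: ifP.
- by move=> x _; rewrite patchE; case: ifP.
- by apply: filterS fg => x.
Qed.

(** * Generating functions and Poisson laws *)

Section PowerSeries.
Local Open Scope ereal_scope.
Context {R : realType}.
Implicit Types a b : nat -> R.

(** Once the coefficients below [k] cancel, the remaining tail is at most [z ^+ k.+1]; division by
    [z ^+ k] leaves [a k <= b k + z] for small positive [z]. *)
Let pgf_le a b k : (forall j, 0 <= a j)%R -> (forall j, 0 <= b j)%R ->
  \sum_(0 <= j <oo) (a j)%:E <= 1 -> \sum_(0 <= j <oo) (b j)%:E <= 1 ->
  (forall z, 0 <= z <= 1 -> \sum_(0 <= j <oo) (a j * z ^+ j)%:E =
                           \sum_(0 <= j <oo) (b j * z ^+ j)%:E)%R ->
  (forall j, (j < k)%N -> a j = b j) -> (a k <= b k)%R.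
Proof.
move=> a0 b0 a1 b1 ab abk.
have split_sum (d : nat -> R) (z : R) : (forall j, 0 <= d j)%R -> (0 <= z)%R ->
    \sum_(0 <= j <oo) (d j * z ^+ j)%:E = (\sum_(0 <= j < k) d j * z ^+ j)%:E +
      ((d k * z ^+ k)%:E + \sum_(k.+1 <= j <oo) (d j * z ^+ j)%:E).
  move=> d0 z0; have pos j : 0 <= (d j * z ^+ j)%:E by rewrite lee_fin mulr_ge0// exprn_ge0.
  rewrite (nneseries_split 0%N k)// add0n (nneseries_split k 1%N)// addn1 big_nat1 sumEFin//.
apply/ler_addgt0Pl => z z0.
wlog z1 : z z0 / (z <= 1)%R.
  move=> H; have [|z1] := leP z 1%R; first exact: H.
  by rewrite (le_trans (H 1%R _ _))// lerD2r ltW.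
have := ab z; rewrite (ltW z0) z1 => /(_ isT).
rewrite !split_sum ?(ltW z0)//.
have -> : (\sum_(0 <= j < k) a j * z ^+ j = \sum_(0 <= j < k) b j * z ^+ j)%R.
  by rewrite big_nat [RHS]big_nat; apply: eq_bigr => j /andP[_ jk]; rewrite abk.
move=> abz; have {abz} : (a k * z ^+ k)%:E <=
    (b k * z ^+ k)%:E + \sum_(k.+1 <= j <oo) (b j * z ^+ j)%:E.
  rewrite -(leeD2lE (x := (\sum_(0 <= j < k) b j * z ^+ j)%:E))// -abz leeD2lE// leeDl//.
  by apply: nneseries_ge0 => j _ _; rewrite lee_fin mulr_ge0// exprn_ge0// ltW.
have tail : \sum_(k.+1 <= j <oo) (b j * z ^+ j)%:E <= (z ^+ k.+1)%:E.
  apply: (@le_trans _ _ (\sum_(k.+1 <= j <oo) ((z ^+ k.+1)%:E * (b j)%:E))).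
    rewrite eseries_cond [leRHS]eseries_cond; apply: lee_nneseries => j.
      by move=> _ _; rewrite lee_fin mulr_ge0// exprn_ge0// ltW.
    by move=> /andP[_ kj]; rewrite -EFinM lee_fin mulrC ler_wpM2r// ler_wiXn2l ?(ltW z0).
  rewrite nneseriesZl; last by move=> j _; rewrite lee_fin.
  rewrite -[leRHS]mule1; apply: lee_wpmul2l; first by rewrite lee_fin exprn_ge0// ltW.
  apply: le_trans b1; rewrite [leRHS](nneseries_split 0%N k.+1); last first.
    by move=> j _; rewrite lee_fin.
  rewrite add0n leeDr//.
  by apply: sume_ge0 => j _; rewrite lee_fin.
move=> /le_trans/(_ (leeD2l _ tail)); rewrite -EFinD lee_fin exprS -mulrDl addrC.
by rewrite ler_pM2r// exprn_gt0.
Qed.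

Lemma pgf_inj a b : (forall j, 0 <= a j)%R -> (forall j, 0 <= b j)%R ->
  \sum_(0 <= j <oo) (a j)%:E <= 1 -> \sum_(0 <= j <oo) (b j)%:E <= 1 ->
  (forall z, 0 <= z <= 1 -> \sum_(0 <= j <oo) (a j * z ^+ j)%:E =
                           \sum_(0 <= j <oo) (b j * z ^+ j)%:E)%R ->
  forall j, a j = b j.
Proof.
move=> a0 b0 a1 b1 ab; elim/ltn_ind => k IH.
apply/eqP; rewrite eq_le; apply/andP; split; apply: pgf_le => //.
  by move=> z z01; rewrite ab.
by move=> j jk; rewrite IH.
Qed.

Definition poisson (m : R) (j : nat) : R := (expR (- m) * (m ^+ j / j`!%:R))%R.

Lemma poisson_ge0 m j : (0 <= m)%R -> (0 <= poisson m j)%R.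
Proof. by move=> m0; rewrite mulr_ge0 ?expR_ge0// divr_ge0// exprn_ge0. Qed.

Lemma poisson_pgf m z : (0 <= m)%R -> (0 <= z)%R ->
  \sum_(0 <= j <oo) (poisson m j * z ^+ j)%:E = (expR (- ((1 - z) * m)))%:E.
Proof.
move=> m0 z0.
have mz : (0 <= m * z)%R by exact: mulr_ge0.
have expE : \sum_(0 <= j <oo) (exp_coeff (m * z) j)%:E = (expR (m * z))%:E.
  apply/cvg_lim => //; rewrite (_ : (fun n => _) = EFin \o series (exp_coeff (m * z))).
    by apply: cvg_EFin; [exact: nearW|exact: is_cvg_series_exp_coeff].
  by apply/funext => n; rewrite /= /series /= sumEFin.
transitivity (\sum_(0 <= j <oo) ((expR (- m))%:E * (exp_coeff (m * z) j)%:E)).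
  apply: eq_eseriesr => j _; rewrite -EFinM /poisson /exp_coeff /= exprMn -!mulrA.
  by congr (_ * (_ * _))%:E; rewrite mulrC.
rewrite nneseriesZl; last by move=> j _; rewrite lee_fin exp_coeff_ge0.
by rewrite expE -EFinM -expRD; congr (expR _)%:E; rewrite mulrBl mul1r opprB mulrC addrC.
Qed.

Lemma poisson_sum m : (0 <= m)%R -> \sum_(0 <= j <oo) (poisson m j)%:E = 1.
Proof.
move=> m0; have := poisson_pgf m0 ler01; rewrite subrr mul0r oppr0 expR0 => <-.
by apply: eq_eseriesr => j _; rewrite expr1n mulr1.
Qed.

Lemma poisson_mean m : (0 <= m)%R -> \sum_(0 <= j <oo) (j%:R * poisson m j)%:E = m%:E.
Proof.
move=> m0.
apply/cvg_lim => //; rewrite -(cvg_shiftS (fun n => \sum_(0 <= j < n) (j%:R * poisson m j)%:E)) /=.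
rewrite (_ : (fun n => _) = (fun n => m%:E * \sum_(0 <= j < n) (poisson m j)%:E)).
  have sum_cvg : \sum_(0 <= j < n) (poisson m j)%:E @[n --> \oo] --> 1.
    rewrite -(poisson_sum m0).
    by apply: is_cvg_nneseries => j _ _; rewrite lee_fin poisson_ge0.
  have m_fin : m%:E \is a fin_num by [].
  by have := cvgeZl m_fin sum_cvg; rewrite mule1.
apply/funext => n; rewrite big_nat_recl//= mul0r add0e !sumEFin -EFinM mulr_sumr.
congr EFin; apply: eq_bigr => j _; rewrite /poisson factS natrM exprS.
rewrite invfM mulrCA [RHS]mulrCA; congr (_ * _)%R.
by rewrite -!mulrA mulrCA; congr (_ * _)%R; rewrite mulrCA mulVKf// pnatr_eq0.
Qed.

End PowerSeries.

Section Descendants.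
Local Open Scope ereal_scope.
Context {R : realType}.
Variables (lambda mu : R) (q : R -> R).
Hypotheses (l0 : (0 < lambda)%R) (m0 : (0 < mu)%R) (Hq : survival lambda mu q).
Variables (w : vertex) (G : tree_chain lambda mu w) (T0 : tree).
Hypothesis wT0 : w \in vertices T0.
Local Notation Om := (chain_space G).
Local Notation P := (chain_prob G T0).
Local Notation X := (@jumpc R lambda mu w G).
Local Notation J := (@jump_time R lambda mu w G).
Local Notation N t om := (n_children (tree_at t om) w).

Let in_step n (t : R) : set Om := [set om | (J n om <= t < J n.+1 om)%R].

Let measurable_in_step n t : measurable (in_step n t).
Proof.
rewrite (_ : in_step n t = J n @^-1` `]-oo, t]%classic `&` J n.+1 @^-1` `]t, +oo[%classic).
  by apply: measurableI; rewrite -[X in measurable X]setTI; exact: measurable_jump_time.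
by apply/seteqP; split => om /=; rewrite !in_itv /= andbT => /andP.
Qed.

Lemma in_step_uniq m n t (om : Om) : in_step m t om -> in_step n t om -> m = n.
Proof.
move=> /andP[m1 m2] /andP[n1 n2]; case: (ltngtP m n) => // mn.
- by have := lt_le_trans m2 (le_trans (le_jump_time om mn) n1); rewrite ltxx.
- by have := lt_le_trans n2 (le_trans (le_jump_time om mn) m1); rewrite ltxx.
Qed.

Lemma tree_at_step n t (om : Om) : in_step n t om -> tree_at t om = X n om.
Proof.
move=> h; rewrite /tree_at; congr (jumpc _ _).
by apply: (@in_step_uniq _ _ t om _ h); exact: (@xgetI _ _ [set n | in_step n t om] n).
Qed.

Lemma measurable_tree_at t T : measurable [set om : Om | tree_at t om = T].
Proof.
(* The second part is the default of [xget]: at a time that belongs to no holding interval,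
   [tree_at] is the initial tree. *)
rewrite (_ : [set om | _] = \bigcup_n ([set om | X n om = T] `&` in_step n t) `|`
    ([set om | X 0%N om = T] `&` ~` \bigcup_n in_step n t)).
  apply: measurableU; last first.
    apply: measurableI; first exact: jumpc_measurable.
    by apply: measurableC; exact: bigcupT_measurable.
  by apply: bigcupT_measurable => n; apply: measurableI => //; exact: jumpc_measurable.
have none om : ~ (\bigcup_n in_step n t) om -> tree_at t om = X 0%N om.
  move=> h; rewrite /tree_at xgetPN//= => n h'; apply: h; by exists n.
apply/seteqP; split => om.
  have [[n _ h]|h] := pselect ((\bigcup_n in_step n t) om).
    by rewrite /= (tree_at_step h) => XT; left; exists n.
  by rewrite /= none// => XT; right.
by move=> [[n _ [/= <- h]]|[/= <- h]]; [exact: tree_at_step|exact: none].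
Qed.

Lemma measurable_descendants t (Q : pred nat) : measurable [set om : Om | Q (N t om)].
Proof.
have mN : measurable_fun setT (fun om : Om => N t om).
  apply: (measurable_fun_tree (measurable_tree_at t)) => T.
  apply: (eq_measurable_fun (fun=> n_children T w)) => // om.
  by rewrite in_setE => /= ->.
have := mN measurableT [set n | Q n] _; rewrite setTI; exact.
Qed.

Lemma legal_in (om : Om) n : legal T0 om -> w \in vertices (X n om).
Proof.
move=> [X0 h]; elim: n => [|n IH]; first by rewrite X0.
have := h n; move: IH; move: (X n om) (X n.+1 om) => S S' wS /mapP[p].
rewrite mem_cat => /orP[] /mapP[u] /=; first by move=> uS -> ->; rewrite in_add_child// wS orbT.
rewrite mem_filter => /andP[/and3P[u0 uw lu] uS] -> -> /=.
by rewrite in_remove// wS andbT eq_sym.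
Qed.

(** [verification] is applied with [Q] the presence of [w], which almost surely never fails. Only
    the terms in which [t] falls in a holding time remain, and there [gf] at time 0 is
    [z ^+ n_children]. *)
Lemma descendants_transform (z t : R) : (0 <= z <= 1)%R -> (0 <= t)%R ->
  \int[P]_om (z ^+ N t om)%:E = (gf lambda mu q z T0 w t)%:E.
Proof.
move=> z01 t0.
pose Q T := w \in vertices T.
have f01 T s : (0 <= gf lambda mu q z T w s <= 1)%R by exact: gf_01.
have hf T : Q T -> C11 (gf lambda mu q z T w)
    (fun s => gen lambda mu w (fun S => gf lambda mu q z S w s) T).
  exact: C11_gf.
have mT : @measurable _ (past G 0) setT by exact: measurableT.
have := verification l0 m0 f01 (fun T => lip_gf Hq z T w) T0 t mT hf.
have legal_alive (om : Om) n : legal T0 om -> alive 0 Q setT n om.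
  by move=> h; split => // i _; exact: legal_in.
have z0 : (0 <= z)%R by case/andP: z01.
have J0 om : J 0 om = 0%R by rewrite /jump_time big_ord0.
have mX n : measurable_fun setT (fun om => (gf lambda mu q z (X n om) w t)%:E).
  apply: (measurable_fun_tree (Y := X n)) => [T|T]; first exact: jumpc_measurable.
  apply: (eq_measurable_fun (fun=> (gf lambda mu q z T w t)%:E)) => // om.
  by rewrite in_setE => /= ->.
have mA n : measurable (alive 0 Q setT n : set Om) by exact: measurable_alive.
have mN : measurable_fun setT (fun om : Om => (z ^+ N t om)%:E).
  apply: (measurable_fun_tree (measurable_tree_at t)) => T.
  apply: (eq_measurable_fun (fun=> (z ^+ n_children T w)%:E)) => // om.
  by rewrite in_setE => /= ->.
rewrite [LHS](_ : _ = (gf lambda mu q z T0 w t)%:E); last first.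
  rewrite -[RHS]mule1 -(probability_setT P) -integral_cst//.
  apply: ge0_ae_eq_patch_integral => //.
  - by under eq_fun do rewrite t0 mulr1; exact: mX.
  - by move=> om; rewrite t0 mulr1 lee_fin; case/andP: (f01 (X 0%N om) t).
  - by move=> om; rewrite lee_fin; case/andP: (f01 T0 t).
  - apply: filterS (ae_legal G l0 m0 T0) => om h.
    rewrite !patchE mem_set; last exact: legal_alive.
    by rewrite in_setT; case: h => -> _; rewrite t0 mulr1.
move=> ->.
have cover : {ae P, forall om, (\bigcup_n in_step n t) om}.
  apply: filterS (ae_no_explosion G l0 m0 T0) => om /(_ t) ex.
  case: (ex_minnP ex) => -[|n] tn nmin; first by rewrite J0 ltNge t0 in tn.
  exists n => //; rewrite /in_step /= tn andbT leNgt; apply/negP => /nmin; rewrite ltnn//.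
have mcover : measurable (\bigcup_n in_step n t) by exact: bigcupT_measurable.
transitivity (\int[P]_(om in \bigcup_n in_step n t) (z ^+ N t om)%:E).
  apply: ge0_ae_eq_patch_integral => //.
  - by move=> om; rewrite lee_fin exprn_ge0.
  - by move=> om; rewrite lee_fin exprn_ge0.
  - by apply: filterS cover => om h; rewrite !patchE in_setT mem_set.
rewrite ge0_integral_bigcup//; last 3 first.
- exact: measurable_funTS.
- by move=> om _; rewrite lee_fin exprn_ge0.
- by move=> m n _ _ [om [hm hn]]; exact: in_step_uniq hm hn.
apply: eq_eseriesr => n _.
rewrite [X in _ = _ + X](_ : _ = 0) ?adde0; last first.
  have mQ : measurable (alive 0 Q setT n `&` [set om | ~~ Q (X n.+1 om)] : set Om).
    apply: measurableI; first exact: measurable_alive.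
    apply: (@past_measurable _ _ _ _ _ n.+1).
    by apply: (past_path (Q := fun s => ~~ Q (s n.+1))) => s s' ss'; rewrite ss'.
  rewrite -(integral_set0 P (fun=> 0)); apply: ge0_ae_eq_patch_integral => //.
  - apply/measurable_EFinP; apply: measurable_funM; last first.
      by apply: measurable_leb => //; apply: measurable_funB; exact: measurable_jump_time.
    apply: (measurable_fun_tree (Y := X n.+1)) => T; first exact: jumpc_measurable.
    apply: (eq_measurable_fun (fun om => gf lambda mu q z T w (t - (J n.+1 om - J 0 om))%R)).
      by move=> om; rewrite in_setE => /= ->.
    apply: measurable_funTS; apply: measurableT_comp; first exact: lip_measurable (lip_gf Hq _ _ _).
    by apply: measurable_funB => //; apply: measurable_funB; exact: measurable_jump_time.
  - by move=> om; rewrite lee_fin mulr_ge0//; case/andP: (f01 (X n.+1 om) (t - (J n.+1 om - J 0 om))%R).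
  - apply: filterS (ae_legal G l0 m0 T0) => om h.
    by rewrite !patchE in_set0 memNset// => -[_ /=]; rewrite /Q legal_in.
apply: ge0_ae_eq_patch_integral => //.
- apply/measurable_EFinP; apply: measurable_funM.
    apply: (measurable_fun_tree (Y := X n)) => T; first exact: jumpc_measurable.
    apply: (eq_measurable_fun (fun=> gf lambda mu q z T w 0)) => // om.
    by rewrite in_setE => /= ->.
  rewrite (_ : (fun om => _) = \1_(in_step n t)); first exact: measurable_indic.
  apply/funext => om; rewrite J0 !subr0 indicE; congr ((nat_of_bool _)%:R).
  by apply/idP/idP => h; [exact/mem_set|rewrite in_setE in h].
- by move=> om; rewrite lee_fin exprn_ge0.
- by move=> om; rewrite lee_fin mulr_ge0//; case/andP: (f01 (X n om) 0%R).
- apply: filterS (ae_legal G l0 m0 T0) => om h.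
  rewrite !patchE [X in _ = if X then _ else _]mem_set; last exact: legal_alive.
  rewrite J0 !subr0 gf_at0; case: ifPn => hn.
    have h' : in_step n t om by rewrite in_setE in hn.
    by rewrite (tree_at_step h') h' mulr1.
  rewrite (_ : (_ <= t < _)%R = false) ?mulr0//; apply/negbTE; apply: contra hn => h'.
  exact/mem_set.
Qed.

(** Starting from a leaf, both laws have the generating function
    [exp(- (1 - z) * (lambda * itg q 0 t))]. *)
Lemma descendants_poisson (t : R) j : is_leaf T0 w -> (0 <= t)%R ->
  descendants_law G T0 t j = poisson (lambda * itg q 0 t) j.
Proof.
move=> lw t0.
have q0 x : (0 <= q x)%R by have /andP[/ltW] : (0 < q x <= 1)%R by case: Hq.
have M0 : (0 <= lambda * itg q 0 t)%R by rewrite mulr_ge0 ?(ltW l0)// itg_ge0.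
pose F i := [set om : Om | N t om = i].
have mF i : measurable (F i).
  rewrite (_ : F i = [set om | N t om == i]); first exact: (measurable_descendants t (pred1 i)).
  by apply/seteqP; split => om /eqP.
have trF : trivIset setT F by move=> a b _ _ [om [<- <-]].
have FT : \bigcup_i F i = setT by apply/seteqP; split => // om _; exists (N t om).
have PF i : P (F i) = (fine (P (F i)))%:E by rewrite fineK// fin_num_measure.
have sumF z : (0 <= z <= 1)%R ->
    \sum_(0 <= i <oo) (fine (P (F i)) * z ^+ i)%:E = (gf lambda mu q z T0 w t)%:E.
  move=> z01; rewrite -descendants_transform//.
  have z0 : (0 <= z)%R by case/andP: z01.
  have mN : measurable_fun setT (fun om : Om => (z ^+ N t om)%:E).
    apply: (measurable_fun_tree (measurable_tree_at t)) => T.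
    apply: (eq_measurable_fun (fun=> (z ^+ n_children T w)%:E)) => // om.
    by rewrite in_setE => /= ->.
  rewrite -[in RHS]FT ge0_integral_bigcup//; last 2 first.
  - by rewrite FT.
  - by move=> om _; rewrite lee_fin exprn_ge0.
  apply: eq_eseriesr => i _; rewrite EFinM -PF muleC -integral_cst//.
  by apply: eq_integral => om; rewrite in_setE /F /= => ->.
apply: (pgf_inj (a := fun i => fine (P (F i)))) => //.
- by move=> i; rewrite fine_ge0.
- by move=> i; exact: poisson_ge0.
- have := sumF 1%R; rewrite ler01 lexx => /(_ isT).
  under eq_eseriesr do rewrite expr1n mulr1.
  by move=> ->; rewrite lee_fin; have /andP[] := gf_01 l0 m0 Hq T0 w t (z := 1%R) (ltac:(by rewrite ler01 lexx)).
- by rewrite poisson_sum.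
- move=> z z01; rewrite sumF// poisson_pgf//; last by case/andP: z01.
  by rewrite gf_leaf.
Qed.

Lemma steady_descendants (r : R) : is_leaf T0 w -> (0 <= r)%R ->
  itg q 0 t @[t --> +oo%R] --> (r / lambda)%R -> steady_mean_descendants G T0 r.
Proof.
move=> lw r0 q_r; exists (poisson r); split; last 2 first.
- exact: poisson_sum.
- exact: poisson_mean.
move=> j.
have M_r : (lambda * itg q 0 t)%R @[t --> +oo%R] --> r.
  rewrite -[X in _ --> X](@mulfVK _ lambda) ?gt_eqF//; rewrite mulrC.
  by apply: cvgM => //; exact: cvg_cst.
have pow_r : ((lambda * itg q 0 t) ^+ j)%R @[t --> +oo%R] --> (r ^+ j)%R.
  elim: j => [|j IH]; first by under eq_fun do rewrite expr0; exact: cvg_cst.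
  by under eq_fun do rewrite exprS; rewrite exprS; exact: cvgM.
have : poisson (lambda * itg q 0 t) j @[t --> +oo%R] --> poisson r j.
  apply: cvgM; first exact: (continuous_cvg _ (@continuous_expR R _) (cvgN M_r)).
  by apply: cvgM => //; exact: cvg_cst.
apply: cvg_trans; apply: near_eq_cvg; near=> t.
by rewrite descendants_poisson//; near: t; exact: nbhs_pinfty_ge.
Unshelve. all: by end_near.
Qed.

End Descendants.

(** * Recurrence and transience *)

Section Foster.
Context {R : realType}.
Variables (lambda mu : R).
Hypotheses (l0 : 0 < lambda) (m0 : 0 < mu).
Local Notation c_ := (exit_rate lambda mu [::]).
Local Notation succs := (succs lambda mu [::]).

(** A finite nonnegative function whose drift under the generator is at most -1 off [T]; nothing is
    required at [T], where the return is counted from. *)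
Definition foster (T : tree) : Prop := exists k : tree -> R, (forall S, 0 <= k S) /\
  forall S, S != T -> 1 + \sum_(p <- succs S) p.1 * k p.2 <= c_ S * k S.

Let s0 T p : p \in succs T -> 0 <= p.1.
Proof. exact: succs_ge0. Qed.

(** The new function is 0 at [T'] and [k + A] elsewhere. A common shift preserves the drift off [T];
    at [T] the move to [T'] saves [a * A], and [A] is chosen so that this pays for the 1 and for the
    values of [k] at the successors. *)
Lemma foster_succ T a T' : foster T -> 0 < a -> (a, T') \in succs T -> foster T'.
Proof.
move=> [k [k0 kF]] a0 aT'.
pose A := (1 + \sum_(p <- succs T) p.1 * k p.2) / a.
have A0 : 0 <= A.
  rewrite divr_ge0 ?(ltW a0)// addr_ge0// big_seq sumr_ge0// => p /s0 p0.
  by rewrite mulr_ge0.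
pose k' S := if S == T' then 0 else k S + A.
have k'le S : k' S <= k S + A by rewrite /k'; case: ifP => // _; rewrite addr_ge0.
have sumD S : \sum_(p <- succs S) p.1 * (k p.2 + A) = \sum_(p <- succs S) p.1 * k p.2 + c_ S * A.
  by rewrite exit_rateE mulr_suml -big_split /=; apply: eq_bigr => p _; rewrite mulrDr.
exists k'; split; first by move=> S; rewrite /k'; case: ifP => // _; rewrite addr_ge0.
move=> S ST'; rewrite {2}/k' (negbTE ST') mulrDr.
have [->|ST] := eqVneq S T; last first.
  rewrite (le_trans _ (lerD (kF S ST) (lexx _)))// -addrA lerD2l -sumD.
  rewrite big_seq [leRHS]big_seq; apply: ler_sum => p /s0 p0.
  by rewrite ler_wpM2l.
apply: (@le_trans _ _ (c_ T * A)); last by rewrite lerDr mulr_ge0// ltW// exit_rate_gt0.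
have aA : a * A = 1 + \sum_(p <- succs T) p.1 * k p.2 by rewrite mulrC divfK// gt_eqF.
have -> : c_ T * A = a * A + \sum_(p <- rem (a, T') (succs T)) p.1 * A.
  by rewrite exit_rateE mulr_suml (big_rem _ aT').
rewrite [X in 1 + X](big_rem _ aT') /= {1}/k' eqxx mulr0 add0r aA -addrA lerD2l.
rewrite (big_rem _ aT') /= -addrA -[leLHS]add0r; apply: lerD; first exact: mulr_ge0 (ltW a0) (k0 _).
rewrite -big_split /= big_seq [leRHS]big_seq; apply: ler_sum => p /mem_rem/s0 p0.
by rewrite -mulrDr ler_wpM2l.
Qed.

Lemma foster_all : foster root_tree -> forall T, foster T.
Proof.
move=> F0; apply: tree_accessible => // T v FT.
  move=> vT; apply: (foster_succ FT l0); rewrite mem_cat; apply/orP; left.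
  by apply/mapP; exists v.
move=> v0 lv; apply: (foster_succ FT m0); rewrite mem_cat; apply/orP; right.
apply/mapP; exists v => //; rewrite mem_filter /deletable v0 lv /=.
by case/andP: lv.
Qed.

Variable (q : R -> R) (M : R).
Hypotheses (Hq : survival lambda mu q) (M0 : forall t, itg q 0 t <= M).

(** The mean, truncated at [t], of the epoch of the first mu-event at the root, from the tree
    [S]. *)
Let D (S : tree) (t : R) : R := itg (fun s => 1 - dead lambda mu q S [::] s) 0 t.

Let ld S : lip (dead lambda mu q S [::]). Proof. exact: lip_dead Hq _ _. Qed.

Let ld1 S : lip (fun s => 1 - dead lambda mu q S [::] s).
Proof. by apply: lipB; [exact: lip_cst|exact: ld]. Qed.

Let d01 S t : 0 <= dead lambda mu q S [::] t <= 1.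
Proof. exact: (dead_01 m0 Hq). Qed.

Lemma D_ndec S s t : s <= t -> D S s <= D S t.
Proof.
move=> st; have [s0'|s0'] := leP s 0.
  rewrite /D (itg_nil _ s0') itg_ge0// => x _ _; rewrite subr_ge0.
  by have /andP[] := d01 S x.
rewrite /D (itg_split (c := s) (ld1 S) (ltW s0') st) lerDl itg_ge0// => x _ _.
by rewrite subr_ge0; have /andP[] := d01 S x.
Qed.

(** The backward equation of [dead] at the root, integrated over [[0, t]]; the terms linear in [t]
    cancel because the rates of the moves add up to [c_ S]. *)
Lemma D_balance S t : 0 <= t ->
  \sum_(p <- succs S) p.1 * D p.2 t + dead lambda mu q S [::] t =
  c_ S * D S t + (if is_leaf S [::] then mu * itg q 0 t else 0).
Proof.
move=> t0; have := C11_ftc (C11_dead l0 m0 Hq (root_in_tree S)) (lexx 0) t0.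
rewrite (dead_nonpos lambda mu q (root_in_tree S) (lexx 0)) subr0 => <-.
have lq : lip q by case: Hq.
have DE S' : D S' t = t - itg (dead lambda mu q S' [::]) 0 t.
  by rewrite /D itgB//; [rewrite itg_cst// mul1r subr0|exact: lip_cst].
have ldd p : lip (fun s => dead lambda mu q p [::] s - dead lambda mu q S [::] s).
  by apply: lipB; exact: ld.
have lgen : lip (fun s => \sum_(p <- succs S) p.1 * (dead lambda mu q p.2 [::] s - dead lambda mu q S [::] s)).
  by apply: lip_sum => p; exact: lipZ (ldd _).
have lleaf : lip (fun s => if is_leaf S [::] then mu * q s else 0).
  by case: (is_leaf _ _); [exact: lipZ|exact: lip_cst].
rewrite (_ : (fun s => gen _ _ _ _ _ + _) = (fun s => (\sum_(p <- succs S)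
    p.1 * (dead lambda mu q p.2 [::] s - dead lambda mu q S [::] s)) +
    (if is_leaf S [::] then mu * q s else 0))); last first.
  by apply/funext => s; rewrite genE.
rewrite (itgD _ _ lgen lleaf) -itg_sum; last by move=> p; exact: lipZ (ldd _).
have -> : itg (fun s => if is_leaf S [::] then mu * q s else 0) 0 t =
    (if is_leaf S [::] then mu * itg q 0 t else 0).
  by case: (is_leaf _ _); [rewrite itgZ|rewrite itg_cst// mul0r].
rewrite addrA; congr (_ + _); rewrite exit_rateE mulr_suml -big_split /=.
apply: eq_bigr => p _; rewrite (itgZ _ _ _ (ldd p.2)).
rewrite (itgB _ _ (ld p.2) (ld S)) !DE -mulrDr; congr (_ * _).
by rewrite addrA subrK.
Qed.

(** At [root_tree], [D] is [itg q 0 t], bounded by [M]. In [D_balance] all terms are nonnegative, so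
    a bound at a tree passes to each of its successors. *)
Lemma D_bounded S : exists B : R, forall t, D S t <= B.
Proof.
have succ_bounded S' a T' : (exists B : R, forall t, D S' t <= B) -> 0 < a ->
    (a, T') \in succs S' -> exists B : R, forall t, D T' t <= B.
  move=> [B SB] a0 aT'; exists ((c_ S' * Num.max 0 B + mu * Num.max 0 M) / a) => t.
  have mM : 0 <= mu * Num.max 0 M by rewrite mulr_ge0 ?(ltW m0)// le_max lexx.
  have [t0|t0] := leP t 0.
    rewrite /D itg_nil// divr_ge0 ?(ltW a0)// addr_ge0// mulr_ge0 ?le_max ?lexx//.
    exact/ltW/exit_rate_gt0.
  rewrite ler_pdivlMr// mulrC.
  have D0 S'' : 0 <= D S'' t by have := D_ndec S'' (ltW t0); rewrite {1}/D itg_nil.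
  apply: (@le_trans _ _ (\sum_(p <- succs S') p.1 * D p.2 t + dead lambda mu q S' [::] t)).
    have /andP[d0 _] := d01 S' t; rewrite (big_rem _ aT') /= -addrA lerDl addr_ge0//.
    by rewrite big_seq sumr_ge0// => p /mem_rem/s0 p0; rewrite mulr_ge0.
  rewrite D_balance ?(ltW t0)//; apply: lerD.
    rewrite ler_wpM2l ?le_max ?SB ?orbT//; exact/ltW/exit_rate_gt0.
  by case: ifP => // _; rewrite ler_pM2l// le_max M0 orbT.
move: S; apply: tree_accessible.
- move=> T v TB vT; apply: (succ_bounded _ _ _ TB l0); rewrite mem_cat; apply/orP; left.
  by apply/mapP; exists v.
- move=> T v TB v0 lv; apply: (succ_bounded _ _ _ TB m0); rewrite mem_cat; apply/orP; right.
  apply/mapP; exists v => //; rewrite mem_filter /deletable v0 lv /=.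
  by case/andP: lv.
- exists M => t; have lr : is_leaf root_tree [::].
    by apply/is_leafP; split => [|i]; [exact: root_in_tree|apply/negP => /fset1P].
  rewrite /D (_ : (fun s => _) = q)//; apply/funext => s.
  by rewrite (dead_leaf Hq _ lr) opprB addrC subrK.
Qed.

Let k S := sup (range (D S)).

Let D_ubound S : has_ubound (range (D S)).
Proof. by have [B DB] := D_bounded S; exists B => _ [t _ <-]. Qed.

Let k_cvg S : D S t @[t --> +oo] --> k S.
Proof. by apply: nondecreasing_cvgr => //; move=> s t; exact: D_ndec. Qed.

(** In the limit, [D_balance] is the Foster inequality provided that [dead] tends to 1. The balance
    itself shows that [dead] has a limit, and a limit below 1 would make [D] grow linearly. *)
Lemma foster_root : foster root_tree.
Proof.
exists k; split => [S|S Sr].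
  rewrite -[leLHS](itg_nil (fun s => 1 - dead lambda mu q S [::] s) (lexx 0)).
  by apply: ub_le_sup => //; exists 0.
(* Off [root_tree] the root has a child, so the term [mu * itg q 0 t] is absent. *)
have nleaf : is_leaf S [::] = false.
  apply/negbTE; apply: contra Sr => /is_leafP[_ H]; apply/eqP/tree_eqP/fsetP => v.
  rewrite in_fset1; case: v => [|i v]; first by rewrite root_in_tree eqxx.
  apply/negbTE/negP => vS; have : suffix [:: last i v] (i :: v).
    by rewrite [X in suffix _ X]lastI -cats1; apply/suffixP; exists (belast i v).
  by move=> /suffix_in_tree/(_ vS); apply/negP; exact: H.
have sum_cvg : \sum_(p <- succs S) p.1 * D p.2 t @[t --> +oo] --> \sum_(p <- succs S) p.1 * k p.2.
  elim: (succs S) => [|p s IH].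
    rewrite big_nil; under eq_fun do rewrite big_nil; exact: cvg_cst.
  rewrite big_cons; under eq_fun do rewrite big_cons.
  by apply: cvgD => //; apply: cvgM; [exact: cvg_cst|exact: k_cvg].
set L := c_ S * k S - \sum_(p <- succs S) p.1 * k p.2.
have dL : dead lambda mu q S [::] t @[t --> +oo] --> L.
  have : c_ S * D S t - \sum_(p <- succs S) p.1 * D p.2 t @[t --> +oo] --> L.
    by apply: cvgB => //; apply: cvgM; [exact: cvg_cst|exact: k_cvg].
  apply: cvg_trans; apply: near_eq_cvg; near=> t.
  have t0 : 0 <= t by near: t; exact: nbhs_pinfty_ge.
  by apply/eqP; rewrite subr_eq addrC (D_balance S t0) nleaf addr0.
suff : 1 <= L by rewrite /L lerBrDr.
rewrite leNgt; apply/negP => L1.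
have [B DB] := D_bounded S.
pose e := (1 - L) / 2; have e0 : 0 < e by rewrite divr_gt0// subr_gt0.
have [t1 [_ t1P]] : \forall t \near +oo, dead lambda mu q S [::] t < L + e.
  by apply: (cvgr_lt _ dL); rewrite ltrDl.
pose t2 := Num.max 0 (t1 + 1); have t20 : 0 <= t2 by rewrite le_max lexx.
have t12 : t1 < t2 by rewrite lt_max ltrDl ltr01 orbT.
have D0 s : 0 <= D S s.
  apply: itg_ge0 => x _ _; rewrite subr_ge0.
  by have /andP[] := d01 S x.
have B0 : 0 <= B := le_trans (D0 0) (DB 0).
(* From [t2] on the integrand is at least [e], and the duration [(B + 1) / e] takes [D] beyond its
   bound [B]. *)
pose t3 := t2 + (B + 1) / e.
have t23 : t2 <= t3 by rewrite lerDl divr_ge0 ?(ltW e0)// addr_ge0.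
have := DB t3; apply/negP; rewrite -ltNge.
rewrite /D (itg_split (c := t2) (ld1 S) t20 t23).
apply: (@lt_le_trans _ _ (0 + e * (t3 - t2))).
  by rewrite add0r /t3 addrC addKr mulrC divfK ?gt_eqF// ltrDl.
apply: lerD; first exact: D0.
apply: ge_itg_cst => // x t2x _.
have := t1P x (lt_le_trans t12 t2x) => /ltW h.
rewrite lerBrDr -lerBrDl; apply: le_trans h _.
by rewrite lerBrDr -addrA -(splitr (1 - L)) addrC subrK.
Unshelve. all: by end_near.
Qed.

End Foster.

Section Recurrence.
Local Open Scope ereal_scope.
Context {R : realType}.
Variables (lambda mu : R).
Hypotheses (l0 : (0 < lambda)%R) (m0 : (0 < mu)%R).
Variables (G : tree_chain lambda mu [::]) (T : tree).
Local Notation Om := (chain_space G).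
Local Notation P := (chain_prob G T).
Local Notation X := (@jumpc R lambda mu [::] G).
Local Notation H := (@hold R lambda mu [::] G).
Local Notation J := (@jump_time R lambda mu [::] G).
Local Notation c_ := (exit_rate lambda mu [::]).
Local Notation succs := (succs lambda mu [::]).

Let c0 S : (0 < c_ S)%R. Proof. exact: exit_rate_gt0. Qed.

Lemma return_time_le (t : R) : [set om : Om | return_time om <= t%:E] =
  \bigcup_(n in [set n | (0 < n)%N]) ([set om | X n om = X 0%N om] `&` [set om | (J n om <= t)%R]).
Proof.
apply/seteqP; split => om /=; last first.
  move=> [n /= n0 [Xn Jn]]; apply: (@le_trans _ _ (J n om)%:E); last by rewrite lee_fin.
  by apply: ereal_inf_lbound; exists n.
have [[n0 n0P]|none] := pselect (exists n, (0 < n)%N && (X n om == X 0%N om)).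
  have ex : exists n, (0 < n)%N && (X n om == X 0%N om) by exists n0.
  case: (ex_minnP ex) => n /andP[n_gt0 /eqP Xn] nmin le_t; exists n => //; split => //.
  rewrite /= -lee_fin; apply: le_trans le_t; apply: le_ereal_inf_tmp => _ [i [i0 Xi] <-].
  by rewrite lee_fin le_jump_time// nmin// i0; apply/eqP.
rewrite /return_time (_ : [set _ | _ in _] = set0) ?ereal_inf0//.
by rewrite -subset0 => x [n [n0 Xn] _]; apply: none; exists n; rewrite n0 Xn eqxx.
Qed.

Lemma measurable_return_time : measurable_fun setT (@return_time R lambda mu [::] G).
Proof.
apply: (measurability (@ErealGenOInfty.G R)); first exact: ErealGenOInfty.measurableE.
move=> _ [_ [x ->] <-]; rewrite setTI (_ : _ @^-1` _ = ~` [set om | return_time om <= x%:E]).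
  apply: measurableC; rewrite return_time_le; apply: bigcup_measurable => n _.
  apply: measurableI.
    apply: (@past_measurable _ _ _ _ _ n).
    by apply: (past_path (Q := fun s => s n = s 0%N)) => s s' ss'; rewrite !ss'.
  rewrite (_ : [set om | _] = J n @^-1` `]-oo, x]%classic); last first.
    by apply/seteqP; split => om /=; rewrite in_itv.
  by rewrite -[X in measurable X]setTI; exact: measurable_jump_time.
apply/seteqP; split => om /=; rewrite in_itv /= andbT.
  by move=> h; apply/negP; rewrite -ltNge.
by move/negP; rewrite -ltNge.
Qed.

Lemma return_time_ge0 (om : Om) : 0 <= return_time om.
Proof.
by apply: le_ereal_inf_tmp => _ [n _ <-]; rewrite lee_fin jump_time_ge0.
Qed.

(** The crude factor 4 comes from [x <= exp x] at [x = c * y / 2], which dominates [y] times the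
    density of rate [c] by [4 / c] times that of rate [c / 2]. The absolute value keeps the
    integrand nonnegative on the whole line. *)
Lemma exponential_mean_le (a c : R) : (0 <= a)%R -> (0 < c)%R ->
  \int[lebesgue_measure]_y ((a + `|y|)%:E * (exponential_pdf c y)%:E) <= (a + 4 / c)%:E.
Proof.
move=> a0 c1.
have mpdf (d : R) : measurable_fun setT (fun y : R => (exponential_pdf d y)%:E).
  by apply/measurable_EFinP; exact: measurable_exponential_pdf.
have pdf0 (d y : R) : (0 < d)%R -> (0 <= exponential_pdf d y)%R.
  by move=> d0; exact: exponential_pdf_ge0 (ltW d0) _.
have mz (k d : R) : measurable_fun setT (fun y : R => k%:E * (exponential_pdf d y)%:E).
  by apply: emeasurable_funM => //; exact: mpdf.
have c2 : (0 < c / 2)%R by rewrite divr_gt0.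
have c4 : (0 < 4 / c)%R by rewrite divr_gt0.
apply: (@le_trans _ _ (\int[lebesgue_measure]_y (a%:E * (exponential_pdf c y)%:E +
    (4 / c)%:E * (exponential_pdf (c / 2) y)%:E))).
  apply: ge0_le_integral => //.
  - by move=> y _; rewrite -EFinM lee_fin mulr_ge0 ?addr_ge0// pdf0.
  - apply/measurable_EFinP; apply: measurable_funM; last exact: measurable_exponential_pdf.
    apply: measurable_funD => //; exact: normr_measurable.
  - exact: (emeasurable_funD (mz a c) (mz (4 / c) (c / 2))%R).
  - move=> y _; rewrite -!EFinM -EFinD lee_fin mulrDl lerD2l.
    have [y0|y0] := ltP y 0%R; first by rewrite !lt0_exponential_pdf// !mulr0.
    rewrite !exponential_pdfE// ger0_norm//.
    have h : (c / 2 * y <= expR (c / 2 * y))%R.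
      by apply: le_trans (expR_ge1Dx _); rewrite lerDr.
    have e1 : (expR (- c * y) = expR (- (c / 2) * y) * expR (- (c / 2) * y))%R.
      by rewrite -expRD -mulrDl -opprD -splitr.
    have e2 : (expR (- (c / 2) * y) * expR (c / 2 * y) = 1)%R.
      by rewrite -expRD mulNr addNr expR0.
    have e3 := expR_ge0 (- (c / 2) * y)%R.
    have -> : (4 / c * (c / 2 * expR (- (c / 2) * y)) = 2 * expR (- (c / 2) * y))%R.
      rewrite mulrA; congr (_ * _)%R; field; exact: lt0r_neq0.
    rewrite e1.
    have -> : (y * (c * (expR (- (c / 2) * y) * expR (- (c / 2) * y))) =
       2 * expR (- (c / 2) * y) * (expR (- (c / 2) * y) * (c / 2 * y)))%R.
      by move: (expR _) => e; field.
    rewrite ler_piMr ?mulr_ge0//.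
    by have := ler_wpM2l e3 h; rewrite e2.
rewrite ge0_integralD//; first last.
- exact: mz.
- by move=> y _; rewrite -EFinM lee_fin mulr_ge0 ?(ltW c4)// pdf0.
- exact: mz.
- by move=> y _; rewrite -EFinM lee_fin mulr_ge0// pdf0.
rewrite !ge0_integralZl//; try by [move=> y _; rewrite lee_fin pdf0|rewrite lee_fin// ltW].
- by rewrite !integral_exponential_pdf// !mule1 EFinD.
- exact: mpdf.
- exact: mpdf.
Qed.

Section FosterRecurrent.
Variable (k : tree -> R).
Hypotheses (k0 : forall S, (0 <= k S)%R).
Hypothesis kF : forall S, S != T -> (1 + \sum_(p <- succs S) p.1 * k p.2 <= c_ S * k S)%R.

Let B n : set Om := [set om | forall i, (0 < i <= n)%N -> X i om != T].
(** The factor 4 in front of [k] matches the one in [exponential_mean_le]. *)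
Let f (x y : tree) (z : R * R) : \bar R := (4 * k y + `|z.2|)%:E.

Let past_B n : @measurable _ (past G n) (B n).
Proof.
apply: (past_path (Q := fun s => forall i, (0 < i <= n)%N -> s i != T)) => s s' ss' h i /andP[i0 ni].
by rewrite -ss'// h// i0.
Qed.

Let mB n : measurable (B n). Proof. by apply: (@past_measurable _ _ _ _ _ n); exact: past_B. Qed.

Let mf x y : measurable_fun setT (f x y).
Proof.
apply/measurable_EFinP; apply: measurable_funD => //.
by apply: measurableT_comp => //; exact: normr_measurable.
Qed.

Let f0 x y z : 0 <= f x y z.
Proof. by rewrite lee_fin addr_ge0// mulr_ge0. Qed.

Let V S : R := (4 / c_ S * (1 + \sum_(p <- succs S) p.1 * k p.2))%R.

Let step_le S : step lambda mu [::] f S 0 <= (V S)%:E.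
Proof.
apply: (@le_trans _ _ (\sum_(p <- succs S) (p.1 / c_ S * (4 * k p.2 + 4 / c_ S))%:E)).
  rewrite /step big_seq [leRHS]big_seq; apply: lee_sum => p /(succs_ge0 l0 m0) p0.
  rewrite [leRHS]EFinM; apply: lee_wpmul2l; first by rewrite lee_fin divr_ge0// ltW.
  by apply: exponential_mean_le => //; rewrite mulr_ge0.
rewrite sumEFin lee_fin /V.
under eq_bigr do rewrite mulrDr.
rewrite big_split /= -!mulr_suml -exit_rateE divff ?gt_eqF// mul1r mulrDr mulr1 addrC lerD2l.
rewrite mulr_sumr; apply: ler_sum => p _.
by rewrite mulrACA (mulrC p.1) -mulrACA.
Qed.

Let measurable_tree_fun n (g : tree -> \bar R) : measurable_fun setT (fun om => g (X n om)).
Proof.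
apply: (measurable_fun_tree (Y := X n)) => S; first exact: jumpc_measurable.
by apply: (eq_measurable_fun (fun=> g S)) => // om; rewrite in_setE => /= ->.
Qed.

Let V0 S : (0 <= V S)%R.
Proof.
rewrite mulr_ge0 ?divr_ge0 ?(ltW (c0 _))// addr_ge0// big_seq sumr_ge0// => p ps.
by rewrite mulr_ge0// (succs_ge0 l0 m0 ps).
Qed.

Let mX n : measurable_fun setT (fun om => (4 * k (X n om))%:E).
Proof. exact: (measurable_tree_fun n (fun S => (4 * k S)%:E)). Qed.

Let mH n : measurable_fun setT (fun om => (H n om)%:E).
Proof. by apply/measurable_EFinP; exact: hold_measurable. Qed.

Let W n := \int[P]_(om in B n) (4 * k (X n om))%:E.
Let h n := \int[P]_(om in B n) (H n om)%:E.

Let h0 n : 0 <= h n.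
Proof. by apply: integral_ge0 => om _; rewrite lee_fin ltW// hold_gt0. Qed.

Let W0 n : 0 <= W n.
Proof. by apply: integral_ge0 => om _; rewrite lee_fin mulr_ge0. Qed.

Let one_step_foster n : W n.+1 + h n <= \int[P]_(om in B n) (V (X n om))%:E.
Proof.
have mK : measurable_fun (setT : set (past G n)) ((fun=> 0%R) : past G n -> R).
  exact: measurable_cst.
apply: (@le_trans _ _ (\int[P]_(om in B n) step lambda mu [::] f (X n om) 0)); last first.
  apply: ge0_le_integral => //.
  - by move=> om _; exact: step_ge0.
  - exact: measurable_funTS (measurable_tree_fun n (fun S => step lambda mu [::] f S 0%R)).
  - exact: measurable_funTS (measurable_tree_fun n (EFin \o V)).
rewrite -(one_step l0 m0 T (@past_B n) mK mf f0).
rewrite (eq_integral (fun om => (4 * k (X n.+1 om))%:E + (H n om)%:E)); last first.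
  by move=> om _; rewrite /f /= ger0_norm// ltW// hold_gt0.
rewrite ge0_integralD//; last 4 first.
- by move=> om _; rewrite lee_fin mulr_ge0.
- exact: measurable_funTS.
- by move=> om _; rewrite lee_fin ltW// hold_gt0.
- exact: measurable_funTS.
apply: leeD => //; apply: ge0_subset_integral => //.
- exact: measurable_funTS.
- by move=> om _; rewrite lee_fin mulr_ge0.
- by move=> om Bom i /andP[i0 ni]; apply: Bom; rewrite i0 leqW.
Qed.

(** The drift condition enters here: on [B n.+1] the current tree is not [T], and then [V] is at
    most [4 * k]. *)
Let VW n : \int[P]_(om in B n.+1) (V (X n.+1 om))%:E <= W n.+1.
Proof.
apply: ge0_le_integral => //.
- by move=> om _; rewrite lee_fin.
- exact: measurable_funTS (measurable_tree_fun _ (EFin \o V)).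
- exact: measurable_funTS.
- move=> om Bom; have XT : X n.+1 om != T by apply: Bom; rewrite leqnn.
  rewrite lee_fin /V mulrAC ler_pdivrMr// -mulrA ler_pM2l// (mulrC (k _)).
  exact: kF.
Qed.

Let W1 : W 1 + h 0 <= (V T)%:E.
Proof.
apply: le_trans (one_step_foster 0) _.
apply: (@le_trans _ _ (\int[P]_(om in B 0) (V T)%:E)).
  apply: ae_ge0_le_integral => //.
  - by move=> om _; rewrite lee_fin.
  - exact: measurable_funTS (measurable_tree_fun _ (EFin \o V)).
  - by move=> om _; rewrite lee_fin.
  - by apply: filterS (chain_start G T) => om -> _.
by rewrite integral_cst// -[leRHS]mule1 lee_wpmul2l ?probability_le1// lee_fin.
Qed.

(** Summing the one-step inequalities bounds by [V T] the mean total holding time before the return.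
    This total dominates the return time almost surely: if no return occurs, non-explosion makes it
    infinite. *)
Lemma foster_recurrent : \int[P]_om return_time om < +oo.
Proof.
have partial n : W n.+1 + \sum_(0 <= i < n.+1) h i <= (V T)%:E.
  elim: n => [|n IH]; first by rewrite big_nat1.
  rewrite big_nat_recr//= [X in _ + X]addeC addeA; apply: le_trans IH; apply: leeD2r.
  exact: le_trans (one_step_foster n.+1) (VW n).
have sum_le : \sum_(0 <= i <oo) h i <= (V T)%:E.
  apply: lime_le; first exact: is_cvg_nneseries.
  apply: nearW => -[|n]; first by rewrite big_geq// (le_trans _ (partial 0%N))// adde_ge0// sume_ge0.
  by apply: le_trans (partial n); rewrite leeDr.
apply: le_lt_trans (ltry (V T)).
apply: le_trans sum_le.
rewrite (eq_eseriesr (g := fun n => \int[P]_om ((H n om)%:E * (\1_(B n) om)%:E))); last first.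
  move=> n _; rewrite /h integral_mkcond; apply: eq_integral => om _.
  by rewrite patchE indicE; case: ifP => _; rewrite ?mule1 ?mule0.
rewrite -integral_nneseries//; last 2 first.
- move=> n; apply: emeasurable_funM => //; apply/measurable_EFinP; exact: measurable_indic.
- by move=> n om _; rewrite mule_ge0// lee_fin ltW// hold_gt0.
apply: ae_ge0_le_integral => //.
- by move=> om _; exact: return_time_ge0.
- exact: measurable_return_time.
- by move=> om _; apply: nneseries_ge0 => n _ _; rewrite mule_ge0// lee_fin ltW// hold_gt0.
- apply: ge0_emeasurable_sum.
  + by move=> n om _ _; rewrite mule_ge0// lee_fin ltW// hold_gt0.
  + by move=> n _; apply: emeasurable_funM => //; apply/measurable_EFinP; exact: measurable_indic.
have := ae_no_explosion G l0 m0 T; have := chain_start G T.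
apply: filterS2 => om X0 explode _.
have pos n : 0 <= (H n om)%:E * (\1_(B n) om)%:E.
  by rewrite mule_ge0// lee_fin ltW// hold_gt0.
have JB n : B n om -> (J n om)%:E <= \sum_(0 <= i <oo) ((H i om)%:E * (\1_(B i) om)%:E).
  move=> Bn; rewrite (nneseries_split 0%N n)//.
  rewrite add0n -[leLHS]adde0; apply: leeD; last exact: nneseries_ge0.
  rewrite /jump_time -sumEFin big_mkord; apply: lee_sum => i _.
  rewrite indicE mem_set ?mule1// => j /andP[j0 ji]; apply: Bn.
  by rewrite j0 (leq_trans ji)// ltnW.
have [[n0 n0P]|none] := pselect (exists n, (0 < n)%N && (X n om == T)).
  have ex : exists n, (0 < n)%N && (X n om == T) by exists n0.
  case: (ex_minnP ex) => -[//|n] /andP[_ /eqP Xn] nmin.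
  apply: (@le_trans _ _ (J n.+1 om)%:E).
    by apply: ereal_inf_lbound; exists n.+1 => //; rewrite /= Xn X0.
  rewrite (nneseries_split 0%N n.+1)// add0n -[leLHS]adde0.
  apply: leeD; last exact: nneseries_ge0.
  rewrite /jump_time -sumEFin big_mkord; apply: lee_sum => i _.
  rewrite indicE mem_set ?mule1// => j /andP[j0 ji]; apply/negP => /eqP Xj.
  have := nmin j; rewrite j0 Xj eqxx => /(_ isT); rewrite leqNgt ltnS.
  by rewrite (leq_trans ji)// -ltnS.
have Bn n : B n om.
  by move=> i /andP[i0 _]; apply/negP => Xi; apply: none; exists i; rewrite i0.
rewrite (_ : \sum_(0 <= i <oo) _ = +oo) ?leey//.
apply/eqyP => A A0; have [n An] := explode A.
by apply: le_trans (JB n (Bn n)); rewrite lee_fin ltW.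
Qed.

End FosterRecurrent.

Section Transience.
Variable q : R -> R.
Hypothesis Hq : survival lambda mu q.

(* With positive probability the first transition gives birth to a vertex that
   is never deleted, and then [T] is not visited again. *)
Lemma no_return : (0 < inf (range q))%R -> P [set om | return_time om < +oo] < 1.
Proof.
move=> q_inf.
pose v := newborn T [::]; pose T' := add_child T [::].
have vT : v \notin vertices T by exact: newborn_notin.
have lv : is_leaf T' v by apply: leaf_newborn; exact: root_in_tree.
pose E0 : set Om := [set om | X 0%N om = T /\ X 1%N om = T'].
have pE0 : @measurable _ (past G 1) E0.
  by apply: (past_path (Q := fun s => s 0%N = T /\ s 1%N = T')) => s s' ss'; rewrite !ss'.
have mE0 : measurable E0 by apply: (@past_measurable _ _ _ _ _ 1%N).
have PE0 : 0 < P E0.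
  have mT : @measurable _ (past G 0) setT by exact: measurableT.
  have := markov l0 m0 T T T' mT (lexx 0%R).
  rewrite mulr0 oppr0 expR0 mulr1 setTI.
  have -> : P [set om | X 0%N om = T] = 1.
    rewrite -(probability_setT P); apply: (measure_ae_eq (mu := P)) => //.
      exact: jumpc_measurable.
    by apply: filterS (chain_start G T).
  rewrite mule1 (_ : _ `&` _ = E0); last first.
    apply/seteqP; split => om /=; first by move=> [].
    by move=> h; split => //; exact: hold_gt0.
  move=> ->; rewrite lte_fin divr_gt0// rateE.
  have Ts : (lambda, T') \in succs T.
    rewrite mem_cat; apply/orP; left; apply/mapP; exists [::] => //; exact: root_in_tree.
  rewrite (big_rem _ Ts) /= eqxx mulr1 ltr_wpDr// big_seq sumr_ge0// => p /mem_rem ps.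
  by rewrite mulr_ge0// (succs_ge0 l0 m0 ps).
pose D : set Om := [set om | exists2 n, (1 < n)%N & v \notin vertices (X n om)].
have mD : measurable D.
  rewrite (_ : D = \bigcup_(n in [set n | (1 < n)%N]) [set om | v \notin vertices (X n om)]).
    apply: bigcup_measurable => n _; apply: (@past_measurable _ _ _ _ _ n).
    by apply: (past_path (Q := fun s => v \notin vertices (s n))) => s s' ss'; rewrite ss'.
  by apply/seteqP; split => om [n n1 vn]; exists n.
have E0v : E0 `<=` [set om | is_leaf (X 1%N om) v] by move=> om [_ /= ->].
have PD : P (E0 `&` D) <= (1 - inf (range q))%:E * P E0.
  exact: (death_eventually l0 m0 Hq T pE0 E0v).
have PE0_fin : P E0 \is a fin_num by rewrite fin_num_measure.
have lt : P (E0 `&` D) < P E0.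
  apply: le_lt_trans PD _; rewrite -(fineK PE0_fin) -EFinM lte_fin gtr_pMl ?ltrBlDr ?ltrDl//.
  by rewrite fine_gt0// PE0 /= -ge0_fin_numE.
have mED : measurable (E0 `\` D) by exact: measurableD.
have PED : 0 < P (E0 `\` D) by rewrite measureD// ?sube_gt0// -ge0_fin_numE.
have mret : measurable [set om : Om | return_time om < +oo].
  rewrite -[X in measurable X]setTI; apply: emeasurable_fun_infty_o => //.
  exact: measurable_return_time.
(* On [E0] without [D] the vertex [v], which is not in [T], is present from step 1 on, so that [T]
   is never visited again. *)
apply: (@le_lt_trans _ _ (P (~` (E0 `\` D)))); last first.
  have fin : P (E0 `\` D) \is a fin_num by rewrite fin_num_measure.
  rewrite probability_setC// -(fineK fin) -EFinB lte_fin ltrBlDr ltrDl.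
  by rewrite fine_gt0// PED /= -ge0_fin_numE.
apply: le_measure; rewrite ?in_setE//; first exact: measurableC.
move=> om ret [[X0 X1] nD]; move: ret; rewrite /= ltNge => /negP; apply.
rewrite leye_eq /return_time (_ : [set _ | _ in _] = set0) ?ereal_inf0//.
rewrite -subset0 => x [n [n0 Xn] _].
have : v \in vertices (X n om).
  case: n n0 Xn => [//|[|n]] _ _; first by rewrite X1; case/andP: lv.
  by apply: contraT => vn; case: nD; exists n.+2.
by rewrite Xn X0; apply/negP.
Qed.

Lemma infinite_return_mean : P [set om | return_time om < +oo] < 1 ->
  \int[P]_om return_time om = +oo.
Proof.
move=> ret_lt1.
have mret : measurable [set om : Om | return_time om = +oo].
  rewrite -[X in measurable X]setTI.
  exact: (measurable_return_time measurableT (emeasurable_set1 +oo)).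
apply/eqP; rewrite -leye_eq.
apply: (@le_trans _ _ (\int[P]_(om in [set om : Om | return_time om = +oo]) return_time om)).
  rewrite (eq_integral (cst +oo)); last by move=> om; rewrite in_setE.
  rewrite integral_cst// gt0_mulye//.
  have lt_fin : P [set om | return_time om < +oo] \is a fin_num.
    rewrite ge0_fin_numE//; exact: lt_trans ret_lt1 (ltry 1).
  rewrite (_ : [set om | _] = ~` [set om : Om | return_time om < +oo]); last first.
    apply/seteqP; split => om /=; first by move=> ->; rewrite ltxx.
    by move=> /negP; rewrite -leNgt leye_eq => /eqP.
  have mlt : measurable [set om : Om | return_time om < +oo].
    rewrite -[X in measurable X]setTI; apply: emeasurable_fun_infty_o => //.
    exact: measurable_return_time.
  have : 0 < P (~` [set om | return_time om < +oo]) by rewrite probability_setC// sube_gt0.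
  exact.
apply: ge0_subset_integral => //.
- exact: measurable_return_time.
- by move=> om _; exact: return_time_ge0.
Qed.

End Transience.
End Recurrence.

Theorem theorem2p1 (R : realType) :
  (forall (lambda mu : R) (G : tree_chain lambda mu [::]),
     0 < lambda -> 0 < mu ->
     let rho := lambda / mu in
     [/\ (* (A) *)
         positive_recurrent G <-> rho <= (expR 1)^-1,
         (* (B) *)
         positive_recurrent G ->
         exists r : R,
           [/\ smallest_root rho r,
               r <= 1,
               forall (k : nat) (v : vertex),
                 (0 < proba G (born k v))%E ->
                 mean_lifetime G k v = (r / lambda)%:E &
               forall (w : vertex) (H : tree_chain lambda mu w) (T : tree),
                 is_leaf T w -> steady_mean_descendants H T r],
         (* (C) *)
         (expR 1)^-1 < rho ->
         transient G /\
         forall (k : nat) (v : vertex),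
           (0 < proba G (born k v))%E -> ell G k v < 1 &
         exists x : R,
           unique (positive_root rho) x /\
           forall (k : nat) (v : vertex),
             (0 < proba G (born k v))%E ->
             [/\ lifetime_df G k v t @[t --> +oo] --> ell G k v,
                 (expR 1)^-1 <= rho -> x <= ell G k v &
                 ell G k v <= Num.min 1 rho^-1]]) /\
  (forall e : R, 0 < e -> exists M : R,
     forall (lambda mu : R) (G : tree_chain lambda mu [::])
            (k : nat) (v : vertex),
       0 < lambda -> 0 < mu -> M < lambda / mu ->
       (0 < proba G (born k v))%E ->
       `|lambda / mu * ell G k v - 1| < e).
Proof.
split=> [lambda mu G l0 m0 rho|e e0].
  have [q Hq] := survival_exists l0 m0.
  have qmono s t (st : s <= t) : q t <= q s := survival_ninc l0 m0 Hq G st.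
  have rho0 : 0 < rho by exact: divr_gt0.
  have [bound_x bound_1 _] := defect_bounds l0 m0 Hq qmono.
  have recurrent : rho <= (expR 1)^-1 -> positive_recurrent G.
    move=> /(ergodic_survival l0 m0 Hq qmono)[r [_ _ _ Mr _]] T.
    have [k [k0 kF]] := foster_all l0 m0 (foster_root l0 m0 Hq Mr) T.
    exact: foster_recurrent kF.
  have tr : (expR 1)^-1 < rho -> transient G.
    by move=> /(transient_survival l0 m0 Hq qmono) c0 T; exact: no_return Hq c0.
  have ergodic : positive_recurrent G -> rho <= (expR 1)^-1.
    move=> rec; rewrite leNgt; apply/negP => /tr /(_ root_tree)/infinite_return_mean inf_mean.
    by have := rec root_tree; rewrite inf_mean ltxx.
  split.
  - by split.
  - move=> /ergodic/(ergodic_survival l0 m0 Hq qmono)[r [small r1 q_r Mr c0]].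
    have r0 : 0 <= r.
      by have := Mr 0; rewrite itg_nil// ler_pdivlMr// mul0r.
    exists r; split => // [k v born_gt0|w H T lw].
      exact: (mean_lifetimeE l0 m0 Hq).
    by apply: (steady_descendants l0 m0 Hq) => //; case/andP: lw.
  - move=> erho; split; first exact: tr.
    move=> k v born_gt0; rewrite (ellE l0 m0 Hq)// ltrBlDr ltrDl.
    exact: (transient_survival l0 m0 Hq).
  - have [x x_root] := positive_root_exists rho0; exists x; split => // k v born_gt0.
    rewrite (ellE l0 m0 Hq)//; split => //; first exact: (lifetime_df_cvg l0 m0 Hq).
    by apply: bound_x; case: x_root.
(* For [rho > 1] the error is at most [rho^-1], by [defect_bounds]. *)
exists (Num.max 1 e^-1) => lambda mu G k v l0 m0; rewrite gt_max => /andP[rho1 rhoe] born_gt0.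
have [q Hq] := survival_exists l0 m0.
have qmono s t (st : s <= t) : q t <= q s := survival_ninc l0 m0 Hq G st.
have [_ _ bound_e] := defect_bounds l0 m0 Hq qmono.
rewrite (ellE l0 m0 Hq)//; apply: le_lt_trans (bound_e rho1) _.
by rewrite invf_plt// posrE divr_gt0.
Qed.
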